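(* Let $q>2+\lambda_2^{\mathrm{rad}}$. Then there exists $\delta\in(0,1)$ such that for every $m\in(2-\delta,2)$, every $\mathcal C_m$-ground state solution $u_m$ of $(P_m)$ is nonconstant.
   Context: $B$ is the open unit ball of $\mathbb R^N$, $N\ge 1$, and $\nu$ is the outer unit normal of $\partial B$. For $1<m<\infty$ and $q>m$ (the exponent $q$ may be Sobolev-supercritical), $(P_m)$ denotes the Neumann problem $$-\Delta_m u+u^{m-1}=u^{q-1}\ \text{ in } B,\qquad u>0 \text{ and } u \text{ radial in } B,\qquad \frac{\partial u}{\partial\nu}=0\ \text{ on }\partial B,$$ where $\Delta_m u=\mathrm{div}(|\nabla u|^{m-2}\nabla u)$. $\lambda_2^{\mathrm{rad}}$ denotes the first positive eigenvalue, associated to a radial eigenfunction, of the Neumann Laplacian in $B$, i.e. the smallest $\lambda>0$ for which the problem $-\Delta u=\lambda u$ in $B$, $u$ radial in $B$, $\partial u/\partial\nu=0$ on $\partial B$, has a nonzero solution. For radial $u$ write $u(|x|)=u(x)$. The cone $\mathcal C_m$ is $$\mathcal C_m=\{u\in W^{1,m}_{\mathrm{rad}}(B): u\ge 0,\ u(r_1)\le u(r_2)\text{ for all }0<r_1\le r_2\le 1\},$$ where $W^{1,m}_{\mathrm{rad}}(B)$ is the space of radial functions in $W^{1,m}(B)$. Functions in $\mathcal C_m$ are bounded. A solution $u\in\mathcal C_m$ of $(P_m)$ is understood in the weak sense: $u>0$ in $B$ and $\int_B(|\nabla u|^{m-2}\nabla u\cdot\nabla\varphi+u^{m-1}\varphi)\,dx=\int_B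 u^{q-1}\varphi\,dx$ for all $\varphi\in W^{1,m}(B)$. Ground states. Let $s_0=s_0(m)=\left(\frac qm\right)^{\frac1{q-m}}+1$, fix $\ell\in(m,m^* )$, where $m^*$ is the critical Sobolev exponent ($m^*=Nm/(N-m)$ if $m<N$, $m^*=+\infty$ otherwise), and set $$f_q(s)=\begin{cases}s^{q-1}& s\in[0,s_0],\\ s_0^{q-1}+\frac{q-1}{\ell-1}s_0^{q-\ell}(s^{\ell-1}-s_0^{\ell-1})& s>s_0,\end{cases}\qquad F_q(u)=\int_0^u f_q(s)\,ds.$$ Define $$I_m(u)=\int_B\left(\frac{|\nabla u|^m}{m}+\frac{|u|^m}{m}-F_q(u)\right)dx,$$ $$\mathcal N_m=\left\{u\in\mathcal C_m\setminus\{0\}:\ \int_B(|\nabla u|^m+|u|^m)\,dx=\int_B f_q(u)u\,dx\right\},\qquad c_m=\inf_{u\in\mathcal N_m}I_m(u).$$ A $\mathcal C_m$-ground state solution of $(P_m)$ is a solution $u\in\mathcal C_m$ of $(P_m)$ such that $u\in\mathcal N_m$ and $I_m(u)=c_m$. It is known that a $\mathcal C_m$-ground state solution exists for every $q>m$; in general it may be the constant function $1$. *)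

(* Defs.v *)
From HB Require Import structures.
From mathcomp Require Import all_boot all_order all_algebra.
From mathcomp Require Import all_classical all_reals all_analysis.

Set Implicit Arguments.
Unset Strict Implicit.
Unset Printing Implicit Defensive.

Import Order.TTheory GRing.Theory Num.Theory.
Import numFieldNormedType.Exports.
Local Open Scope classical_set_scope.
Local Open Scope ring_scope.

(** * Lebesgue measure on ['rV[R]_n]

    The sigma-algebra is generated by the coordinates (it is the Borel one);
    the measure is the iterated product of the one-dimensional Lebesgue
    measure, transported along [(t, v) |-> row_mx t%:M v].  Every Lebesgue
    measurable function agrees almost everywhere with a Borel one, so that
    Borel functions suffice to represent classes of functions. *)

Section rV_measurable.
Context (R : realType) (n : nat).

Let coors : 'I_n -> 'rV[R]_n -> R := fun i v => v ord0 i.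

Let rV_set0 : g_sigma_preimage coors set0.
Proof. exact: sigma_algebra0. Qed.

Let rV_setC A : g_sigma_preimage coors A -> g_sigma_preimage coors (~` A).
Proof. exact: sigma_algebraC. Qed.

Let rV_bigcup (F : _^nat) : (forall i, g_sigma_preimage coors (F i)) ->
  g_sigma_preimage coors (\bigcup_i (F i)).
Proof. exact: sigma_algebra_bigcup. Qed.

HB.instance Definition _ := @isMeasurable.Build
  (measure_tuple_display default_measure_display)
  ('rV[R]_n) (g_sigma_preimage coors) rV_set0 rV_setC rV_bigcup.

End rV_measurable.

Lemma measurable_coord (R : realType) n (i : 'I_n) :
  measurable_fun [set: 'rV[R]_n] (fun v : 'rV[R]_n => v ord0 i).
Proof.
move=> _ Y mY; rewrite setTI; apply: sub_sigma_algebra => /=.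
rewrite -bigcup_seq/=; exists i => /=; first by rewrite mem_index_enum.
by exists Y => //; rewrite setTI.
Qed.

Lemma measurable_fun_rVP d (T : measurableType d) (R : realType) n
    (f : T -> 'rV[R]_n) :
  (forall i, measurable_fun [set: T] (fun x => f x ord0 i)) ->
  measurable_fun [set: T] f.
Proof.
move=> mf; have sub : g_sigma_preimage (fun i (v : 'rV[R]_n) => v ord0 i) `<=`
    image_set_system setT f (@measurable _ T).
  apply: smallest_sub.
    by apply: sigma_algebra_image; exact: sigma_algebra_measurable.
  move=> A; rewrite -bigcup_seq => -[i _ [Y mY <-]] /=.
  by rewrite /image_set_system /= setTI; exact: (mf i).
by move=> _ A /sub; rewrite /image_set_system /=.
Qed.

Section rV_cons.
Context (R : realType) (n : nat).

Definition rV_cons (p : measurableTypeR R * 'rV[R]_n) : 'rV[R]_n.+1 :=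
  row_mx ((p.1 : R)%:M : 'rV[R]_1) p.2.

Definition rV_uncons (v : 'rV[R]_n.+1) : measurableTypeR R * 'rV[R]_n :=
  (v ord0 ord0, rsubmx (v : 'rV[R]_(1 + n))).

Lemma rV_consK : cancel rV_cons rV_uncons.
Proof.
move=> [t v]; congr pair; last exact: row_mxKr.
have -> : (ord0 : 'I_n.+1) = lshift n (ord0 : 'I_1) by exact: val_inj.
by apply: etrans (row_mxEl _ _ _ _) _; rewrite mxE.
Qed.

Lemma measurable_rV_cons : measurable_fun setT rV_cons.
Proof.
apply: measurable_fun_rVP => i; case: (split_ordP (i : 'I_(1 + n))) => j ->.
  rewrite (_ : (fun _ => _) = fst); first exact: measurable_fst.
  apply/funext => -[t v]; apply: etrans (row_mxEl _ _ _ _) _.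
  by rewrite !ord1 mxE.
rewrite (_ : (fun _ => _) = (fun v : 'rV[R]_n => v ord0 j) \o snd).
  by apply: measurableT_comp; [exact: measurable_coord|exact: measurable_snd].
by apply/funext => -[t v]; exact: row_mxEr.
Qed.

Lemma measurable_rV_uncons : measurable_fun setT rV_uncons.
Proof.
apply: measurable_fun_pair => /=; first exact: measurable_coord.
apply: measurable_fun_rVP => i.
rewrite (_ : (fun _ => _) = fun v : 'rV[R]_n.+1 => v ord0 (rshift 1 i)).
  exact: measurable_coord.
by apply/funext => v; rewrite mxE.
Qed.

Variable mu : {sigma_finite_measure set 'rV[R]_n -> \bar R}.

Definition rV_step : set 'rV[R]_n.+1 -> \bar R :=
  pushforward ((@lebesgue_measure R) \x mu)%E rV_cons.

Let rV_step0 : rV_step set0 = 0%E.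
Proof. by rewrite /rV_step /pushforward preimage_set0 measure0. Qed.

Let rV_step_ge0 A : (0 <= rV_step A)%E.
Proof. by rewrite /rV_step /pushforward measure_ge0. Qed.

Let rV_step_sigma_additive : semi_sigma_additive rV_step.
Proof.
move=> F mF tF mUF; rewrite /rV_step /pushforward preimage_bigcup.
have mpre k : measurable (rV_cons @^-1` F k).
  by rewrite -[X in measurable X]setTI; exact: measurable_rV_cons.
apply: measure_semi_sigma_additive => //; last exact: bigcup_measurable.
apply/trivIsetP => i j _ _ ij; rewrite -preimage_setI.
by move/trivIsetP : tF => /(_ _ _ _ _ ij) ->//; rewrite preimage_set0.
Qed.

HB.instance Definition _ := isMeasure.Build _ _ _
  rV_step rV_step0 rV_step_ge0 rV_step_sigma_additive.

Lemma rV_step_sigma_finite : sigma_finite setT rV_step.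
Proof.
have /sigma_finiteP[F [TF ndF Foo]] := sigma_finiteT (@lebesgue_measure R).
have /sigma_finiteP[G [TG ndG Goo]] := sigma_finiteT mu.
exists (fun k => rV_uncons @^-1` (F k `*` G k)).
  rewrite -preimage_bigcup (_ : \bigcup_k _ = setT) ?preimage_setT//.
  rewrite -setXTT TF TG predeqE => -[x y]; split; last first.
    by move=> [/= [i _ Fix] [j _ Gjy]]; exists (maxn i j) => //; split;
      [move: x Fix; exact/subsetPset/ndF/leq_maxl|
       move: y Gjy; exact/subsetPset/ndG/leq_maxr].
  by move=> [i _ []/= ? ?]; split; exists i.
move=> k; have [mF oF] := Foo k; have [mG oG] := Goo k; split.
  rewrite -[X in measurable X]setTI; apply: measurable_rV_uncons => //.
  exact: measurableX.
rewrite /rV_step /pushforward -comp_preimage.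
rewrite (_ : _ \o _ = id); last by apply/funext => p; exact: rV_consK.
by rewrite preimage_id product_measure1E// lte_mul_pinfty// ge0_fin_numE.
Qed.

HB.instance Definition _ := @Measure_isSigmaFinite.Build _ _ _
  rV_step rV_step_sigma_finite.

End rV_cons.

Fixpoint lebesgue_rV (R : realType) (n : nat) :
    {sigma_finite_measure set 'rV[R]_n -> \bar R} :=
  match n return {sigma_finite_measure set 'rV[R]_n -> \bar R} with
  | 0 => \d_(0 : 'rV[R]_0)
  | n'.+1 => rV_step (lebesgue_rV R n')
  end.

Section neumann.
Context {R : realType} {N : nat}.
Local Notation vec := 'rV[R]_N.
Local Notation mu := (lebesgue_rV R N).
Implicit Types (u phi : vec -> R) (g : vec -> vec) (p : R).

Definition dot (x y : vec) : R := \sum_(i < N) x ord0 i * y ord0 i.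

(* The library norm on ['rV_N] is the max-norm. *)
Definition enorm (x : vec) : R := Num.sqrt (dot x x).

Definition uball : set vec := [set x | enorm x < 1].

(** * Sobolev spaces on the unit ball *)

Definition partial (i : 'I_N) u : vec -> R := 'D_(delta_mx ord0 i : vec) u.

Definition iter_partial (s : seq 'I_N) u : vec -> R := foldr partial u s.

Definition smooth u : Prop := forall s : seq 'I_N,
  continuous (iter_partial s u) /\
  forall x (i : 'I_N), derivable (iter_partial s u) x (delta_mx ord0 i : vec).

Definition test_fun u : Prop :=
  [/\ smooth u, compact (closure [set x | u x != 0]) &
      closure [set x | u x != 0] `<=` uball].

Definition L1loc u : Prop := measurable_fun uball u /\
  forall K : set vec, compact K -> K `<=` uball -> mu.-integrable K (EFin \o u).

Definition is_weak_grad u g : Prop := forall i : 'I_N,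
  L1loc (fun x => g x ord0 i) /\
  forall phi, test_fun phi ->
    (\int[mu]_(x in uball) (u x * partial i phi x)%:E =
     - \int[mu]_(x in uball) (g x ord0 i * phi x)%:E)%E.

(* Some weak gradient of [u]; it is unique up to a null set. *)
Definition wgrad u : vec -> vec := xget (cst 0) (is_weak_grad u).

Definition sobolev p u : Prop :=
  [/\ measurable_fun uball u,
      (\int[mu]_(x in uball) (`|u x| `^ p)%:E < +oo)%E &
      exists g, is_weak_grad u g /\
        (\int[mu]_(x in uball) (enorm (g x) `^ p)%:E < +oo)%E].

Definition radial u : Prop :=
  forall x y, uball x -> uball y -> enorm x = enorm y -> u x = u y.

Definition ae_const u (c : R) : Prop := {ae mu, forall x, uball x -> u x = c}.

(** * The radial Neumann eigenvalue *)

Definition radial_neumann_eigen (lam : R) : Prop := exists w : vec -> R,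
  [/\ sobolev 2 w, radial w, ~ ae_const w 0 &
      forall phi, sobolev 2 phi ->
        (\int[mu]_(x in uball) (dot (wgrad w x) (wgrad phi x))%:E =
         \int[mu]_(x in uball) (lam * w x * phi x)%:E)%E].

Definition is_lambda2_rad (lam : R) : Prop :=
  [/\ 0 < lam, radial_neumann_eigen lam &
      forall lam', 0 < lam' -> radial_neumann_eigen lam' -> lam <= lam'].

(** * The Neumann problem in the cone *)

Section problem.
Variables m q ell : R.

(* Elements of the Sobolev space are represented by functions for which
   radiality and monotonicity hold pointwise, up to [enorm x = 1]; every class
   satisfying the conditions has such a representative. *)
Definition cone u : Prop :=
  [/\ sobolev m u, radial u, (forall x, uball x -> 0 <= u x) &
      forall x y, 0 < enorm x -> enorm x <= enorm y -> enorm y <= 1 ->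
        u x <= u y].

Definition cone_solution u : Prop :=
  [/\ cone u, (forall x, uball x -> 0 < u x) &
      forall phi, sobolev m phi ->
        (\int[mu]_(x in uball)
            (enorm (wgrad u x) `^ (m - 2) * dot (wgrad u x) (wgrad phi x)
             + u x `^ (m - 1) * phi x)%:E =
         \int[mu]_(x in uball) (u x `^ (q - 1) * phi x)%:E)%E].

Definition s0 : R := (q / m) `^ (q - m)^-1 + 1.

(* Only used at nonnegative arguments. *)
Definition fq (s : R) : R :=
  if s <= s0 then s `^ (q - 1)
  else s0 `^ (q - 1)
       + (q - 1) / (ell - 1) * s0 `^ (q - ell)
         * (s `^ (ell - 1) - s0 `^ (ell - 1)).

Definition Fq (t : R) : R := \int[@lebesgue_measure R]_(s in `[0, t]) fq s.

Definition energy u : \bar R :=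
  (\int[mu]_(x in uball)
     (enorm (wgrad u x) `^ m / m + `|u x| `^ m / m - Fq (u x))%:E)%E.

Definition nehari u : Prop :=
  [/\ cone u, ~ ae_const u 0 &
      (\int[mu]_(x in uball) (enorm (wgrad u x) `^ m + `|u x| `^ m)%:E =
       \int[mu]_(x in uball) (fq (u x) * u x)%:E)%E].

Definition ground_level : \bar R := ereal_inf [set energy u | u in nehari].

Definition ground_state u : Prop :=
  [/\ cone_solution u, nehari u & energy u = ground_level].

End problem.

End neumann.

Definition critical_exponent {R : realType} (N : nat) (m : R) : \bar R :=
  if m < N%:R then (N%:R * m / (N%:R - m))%:E else +oo%E.

(* Main.v *)
Require Import Defs.
From HB Require Import structures.
From mathcomp Require Import all_boot all_order all_algebra.
From mathcomp Require Import all_classical all_reals all_analysis.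
From mathcomp Require Import measurable_realfun ring lra.

Import Order.TTheory GRing.Theory Num.Theory.
Import numFieldNormedType.Exports.
Local Open Scope classical_set_scope.
Local Open Scope ring_scope.

Set Implicit Arguments.
Unset Strict Implicit.
Unset Printing Implicit Defensive.

(** Suppose that a ground state [u] is constant almost everywhere.  Testing the
equation with a constant gives [u = 1], whose energy is [(1/m - 1/q) |B|].
An element of the Nehari set of smaller energy yields a contradiction, so it
suffices to produce one for every [m] in a left neighbourhood of [2].

It is found near the constant [1].  For [z = 1 + t W], with [W] radial,
nondecreasing and of mean zero, the multiple [tau z] lies on the Nehari set for
[tau ^ (q - m) = A_m / B_q], where [A_m] is the integral of
[|grad z| ^ m + z ^ m] and [B_q] that of [z ^ q], and its energy is
[(1/m - 1/q) tau ^ q B_q].  When [m = 2] this is below [(1/2 - 1/q) |B|] as soon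
as [(A_2 / |B|) ^ (q / 2) < B_q / |B|], and the second order expansion in [t]
turns this into

  the integral of [|grad W|^2] is less than [q - 2] times that of [W^2].

The inequality between [A_2] and [B_q] is strict and [z] is fixed, so that it
survives for [m] in a left neighbourhood of [2] ([static_gap],
[exponent_perturbation]).  The values of [tau z] stay below [2 <= s0], where
[f_q] is the pure power, whence [nehari_competitor] and [energy_competitor].

The function [W] comes from [lambda < q - 2] ([radial_competitor]).  Instead of
proving that the eigenfunction is smooth and monotone, one argues by
contradiction, in three steps.

- Monotonicity.  Assume that the Poincare inequality with a constant
  [kappa > lambda] holds for all radial nondecreasing functions of mean zero.
  Replacing the radial derivative by its absolute value keeps the Dirichlet
  integral and increases all differences of values, so the inequality holds for
  all radial [C^1] functions ([radial_poincare]).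

- Radial Neumann problem.  For a smooth radial [rho] of mean zero supported in
  an open shell, the problem [- Delta U = rho] has a radial solution whose
  gradient is a smooth field of compact support in the ball, given by an
  explicit primitive ([exists_neumann_potential]).  The definition of weak
  gradients allows to pair such a field with the weak gradient of an arbitrary
  Sobolev function ([weak_divergence]).

- Density.  Such [rho] are dense in the radial square integrable functions of
  mean zero ([radial_approx_mean0]).  Taking [rho] close to an eigenfunction [w]
  and testing the weak equation with [U], the inequality for [kappa] forces the
  integral of [w^2] to be at most [lambda / kappa] times itself up to a small
  error, hence [w = 0].

Everything is expressed through the squared norm [s = |x|^2], which is smooth
at the origin: a radial function is written [F (nsq x)], and it is of class [C^k]
on the space when [F] is on the line.  The weak gradients of the definitions are chosen
by an unspecified choice; they are identified with the classical gradient of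
[C^1] functions by the fundamental lemma of the calculus of variations
([wgrad_C1]). *)

(** * Functions of class C^k along given directions *)

Section ck.
Context {R : realType}.

(** The chain rule, along a direction only: [u] need not be differentiable, so the
statement is reduced to the one-dimensional one on the line through [x]. *)
Lemma is_derive_comp (V : normedModType R) (f : R -> R) (u : V -> R)
    (x v : V) (df du : R) :
  is_derive (u x) 1 f df -> is_derive x v u du ->
  is_derive x v (f \o u) (df * du).
Proof.
move=> [f1 f2] [u1 u2].
pose l (h : R) := h *: v + x.
have l0 : l 0 = x by rewrite /l scale0r add0r.
have line (g : V -> R) : 'D_v g x = derive1 (g \o l) 0.
  rewrite derive1E /derive.
  suff -> : (fun h : R => h^-1 *: ((g \o shift x) (h *: v) - g x)) =
      (fun h => h^-1 *: (((g \o l) \o shift 0) (h *: (1 : R)) - (g \o l) 0)).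
    by [].
  by apply/funext => h /=; rewrite l0 /l addr0 /GRing.scale/= mulr1.
have du1 : derivable (u \o l) 0 1 by move: u1; rewrite derivable1P.
have df1 : derivable f ((u \o l) 0) 1 by rewrite /= l0; exact: f1.
split.
  rewrite derivable1P -[X in derivable X]/(f \o (u \o l)).
  apply/derivable1_diffP; apply: differentiable_comp.
    exact: (derivable1_diffP _ _).1 du1.
  exact: (derivable1_diffP _ _).1 df1.
rewrite line -[f \o u \o l]/(f \o (u \o l)).
rewrite derive1_comp; [|exact: du1|exact: df1].
by rewrite -line u2 derive1E /= l0 f2.
Qed.

Variables (V : normedModType R) (I : Type) (dir : I -> V).

(** Derivatives are taken along a family of directions and derivability is required
at each order, so that one definition covers functions of one variable and, with
the coordinate directions, functions on row vectors. *)
Fixpoint Ck (n : nat) (u : V -> R) : Prop :=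
  if n is n'.+1 then continuous u /\
    forall i, (forall x, derivable u x (dir i)) /\ Ck n' ('D_(dir i) u)
  else continuous u.

Lemma Ck_continuous n u : Ck n u -> continuous u.
Proof. by case: n => //= n []. Qed.

Lemma CkW n u : Ck n.+1 u -> Ck n u.
Proof.
elim: n u => [u []//|n ih u [cu du]].
by split=> // i; have [? ?] := du i; split => //; exact: ih.
Qed.

(** Continuity must be supplied separately: derivability along the given directions
does not imply it. *)
Lemma CkS n (u : V -> R) : continuous u ->
  (forall i, exists2 du, Ck n du & forall x, is_derive x (dir i) u (du x)) ->
  Ck n.+1 u.
Proof.
move=> cu du; split=> // i; have [du' Cdu' h] := du i.
split=> [x|]; first by have [] := h x.
by rewrite (_ : 'D_ _ _ = du')//; apply/funext => x; have [_] := h x.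
Qed.

Lemma Ck_derive n u i x : Ck n.+1 u -> is_derive x (dir i) u ('D_(dir i) u x).
Proof. by move=> [_ /(_ i)[h _]]; exact/derivableP. Qed.

Lemma Ck_partial n u i : Ck n.+1 u -> Ck n ('D_(dir i) u).
Proof. by move=> [_ /(_ i)[]]. Qed.

Lemma Ck_cst n (c : R) : Ck n (fun=> c).
Proof.
elim: n c => [|n ih] c; first exact: cst_continuous.
apply: CkS => [|i]; first exact: cst_continuous.
by exists (fun=> 0) => // x; exact: is_derive_cst.
Qed.

Lemma CkD n u v : Ck n u -> Ck n v -> Ck n (fun x => u x + v x).
Proof.
elim: n u v => [|n ih] u v Cu Cv.
  by move=> x; apply: continuousD; [exact: Cu|exact: Cv].
apply: CkS => [x|i].
  by apply: continuousD; [exact: (Ck_continuous Cu)|exact: (Ck_continuous Cv)].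
eexists; first exact: ih (Ck_partial i Cu) (Ck_partial i Cv).
move=> x; have du := Ck_derive i x Cu; have dv := Ck_derive i x Cv.
exact: is_deriveD.
Qed.

Lemma CkM n u v : Ck n u -> Ck n v -> Ck n (fun x => u x * v x).
Proof.
elim: n u v => [|n ih] u v Cu Cv.
  by move=> x; apply: continuousM; [exact: Cu|exact: Cv].
apply: CkS => [x|i].
  by apply: continuousM; [exact: (Ck_continuous Cu)|exact: (Ck_continuous Cv)].
exists (fun x => u x * 'D_(dir i) v x + v x * 'D_(dir i) u x).
  by apply: CkD; apply: ih; [exact: CkW Cu|exact: Ck_partial|
    exact: CkW Cv|exact: Ck_partial].
move=> x; have du := Ck_derive i x Cu; have dv := Ck_derive i x Cv.
exact: is_deriveM.
Qed.

Lemma CkZ n c u : Ck n u -> Ck n (fun x => c * u x).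
Proof. by move=> Cu; apply: CkM => //; exact: Ck_cst. Qed.

Lemma CkN n u : Ck n u -> Ck n (fun x => - u x).
Proof.
move=> /(CkZ (-1)); congr Ck; apply/funext => x; exact: mulN1r.
Qed.

Lemma CkB n u v : Ck n u -> Ck n v -> Ck n (fun x => u x - v x).
Proof. by move=> Cu Cv; apply: CkD => //; exact: CkN. Qed.

Lemma Ck_sum n (J : Type) (s : seq J) (u : J -> V -> R) :
  (forall j, Ck n (u j)) -> Ck n (fun x => \sum_(j <- s) u j x).
Proof.
move=> Cu; elim: s => [|j s ih].
  by under eq_fun do rewrite big_nil; exact: Ck_cst.
by under eq_fun do rewrite big_cons; exact: CkD.
Qed.

Lemma Ck_prod n (J : Type) (s : seq J) (u : J -> V -> R) :
  (forall j, Ck n (u j)) -> Ck n (fun x => \prod_(j <- s) u j x).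
Proof.
move=> Cu; elim: s => [|j s ih].
  by under eq_fun do rewrite big_nil; exact: Ck_cst.
by under eq_fun do rewrite big_cons; exact: CkM.
Qed.

End ck.

Definition Ck1 {R : realType} (n : nat) (f : R -> R) :=
  @Ck R R unit (fun=> 1) n f.

Lemma Ck1_derive (R : realType) n (f : R -> R) (x : R) :
  Ck1 n.+1 f -> is_derive x (1 : R) f ('D_1 f x).
Proof. by move=> Cf; exact: (Ck_derive tt x Cf). Qed.

Section ck_comp.
Context {R : realType} (V : normedModType R) (I : Type) (dir : I -> V).

Lemma Ck_comp n (f : R -> R) (u : V -> R) :
  Ck1 n f -> Ck dir n u -> Ck dir n (fun x => f (u x)).
Proof.
elim: n f u => [|n ih] f u Cf Cu.
  by move=> x; apply: continuous_comp; [exact: Cu|exact: Cf].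
apply: CkS => [x|i].
  by apply: continuous_comp;
    [exact: (Ck_continuous Cu)|exact: (Ck_continuous Cf)].
exists (fun x => 'D_1 f (u x) * 'D_(dir i) u x).
  apply: CkM; last exact: Ck_partial.
  by apply: (ih ('D_1 f)); [exact: (Ck_partial tt Cf)|exact: CkW].
by move=> x; apply: is_derive_comp; [exact: (Ck1_derive _ Cf)|exact: (Ck_derive i x Cu)].
Qed.

Lemma Ck1_id n : Ck1 n (@id R).
Proof.
case: n => [|n]; first by move=> x; exact: cvg_id.
apply: CkS => [x|_]; first exact: cvg_id.
by exists (fun=> 1); [exact: Ck_cst|move=> x; exact: is_derive_id].
Qed.

Lemma Ck1S n (f df : R -> R) : Ck1 n df ->
  (forall x : R, is_derive x (1 : R) f (df x)) -> Ck1 n.+1 f.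
Proof.
move=> Cdf fdf; apply: CkS => [x|_]; last by exists df.
by apply/differentiable_continuous/derivable1_diffP; have [] := fdf x.
Qed.

End ck_comp.

Section rV_smooth.
Context {R : realType} {N : nat}.
Local Notation vec := 'rV[R]_N.
Local Notation e i := (delta_mx ord0 i : vec).

Definition CkV (n : nat) (u : vec -> R) := Ck (fun i : 'I_N => e i) n u.

Lemma CkV_continuous n (u : vec -> R) : CkV n u -> continuous u.
Proof. exact: Ck_continuous. Qed.

Lemma CkV_partial n (u : vec -> R) i : CkV n.+1 u -> CkV n ('D_(e i) u).
Proof. exact: Ck_partial. Qed.

Lemma CkV_derive n (u : vec -> R) i x :
  CkV n.+1 u -> is_derive x (e i) u ('D_(e i) u x).
Proof. exact: Ck_derive. Qed.

Lemma smoothP (u : vec -> R) : smooth u <-> forall n, CkV n u.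
Proof.
split=> [su n|Cu].
  have : forall s, CkV n (iter_partial s u).
    elim: n => [s|n ih s] /=; first exact: (su s).1.
    by split; [exact: (su s).1|move=> i; split; [move=> x; exact: (su s).2|
      exact: ih (i :: s)]].
  by move=> /(_ [::]).
have h : forall s n, CkV n (iter_partial s u).
  by elim=> [//|i s ih] n; exact: Ck_partial (ih n.+1).
by move=> s; split; [exact: h s 0%N|move=> x i; have [_ /(_ i)[]] := h s 1%N].
Qed.

Lemma is_derive_coord i j x :
  is_derive x (e j) (fun y : vec => y ord0 i) (j == i)%:R.
Proof.
have did : derivable (fun y : vec => y) x (e j) by exact: derivable_id.
have did' := did; move/derivable_mxP : did' => /(_ ord0 i) dc.
split; first exact: dc.
have /matrixP/(_ ord0 i) := derive_mx did.
by rewrite derive_id !mxE eqxx/= eq_sym => ->.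
Qed.

Lemma CkV_coord n (i : 'I_N) : CkV n (fun x : vec => x ord0 i).
Proof.
case: n => [|n]; first exact: coord_continuous.
apply: CkS => [|j]; first exact: coord_continuous.
exists (fun=> (j == i)%:R); first exact: Ck_cst.
by move=> x; exact: is_derive_coord.
Qed.

Lemma CkV_dot_self n : CkV n (fun x : vec => dot x x).
Proof. by apply: Ck_sum => i; apply: CkM; exact: CkV_coord. Qed.

End rV_smooth.

(** * Smooth cut-off functions on the line *)

Section theta.
Context {R : realType}.
Implicit Types (p : {poly R}) (x y : R).

(** The functions [p(1/x) exp(-1/x)] for a polynomial [p]: this class is closed under
differentiation, which gives smoothness of [exp(-1/x)] by a plain induction. *)
Definition flat p x : R :=
  if 0 < x then p.[x^-1] * expR (- x^-1) else 0.

Lemma expr_le_expR n y : 0 <= y -> y ^+ n <= n%:R ^+ n * expR y.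
Proof.
move=> y0; case: n => [|n]; first by rewrite !expr0 mul1r -expR0 ler_expR.
have n0 : (n.+1%:R : R) != 0 by rewrite pnatr_eq0.
have -> : expR y = expR (y / n.+1%:R) ^+ n.+1.
  by rewrite -expRM_natr divfK.
rewrite -exprMn; apply: lerXn2r; rewrite ?nnegrE ?mulr_ge0 ?expR_ge0//.
rewrite -ler_pdivrMl ?ltr0n// mulrC.
by apply: le_trans (expR_ge1Dx _); rewrite lerDr.
Qed.

Lemma poly_le_expR p : exists2 C, 0 <= C &
  forall y, 0 <= y -> `|p.[y]| <= C * expR y.
Proof.
exists (\sum_(i < size p) `|p`_i| * i%:R ^+ i).
  by apply: sumr_ge0 => i _; rewrite mulr_ge0// exprn_ge0.
move=> y y0; rewrite horner_coef mulr_suml.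
apply: le_trans (ler_norm_sum _ _ _) _; apply: ler_sum => i _.
by rewrite normrM -mulrA ler_wpM2l// ger0_norm ?exprn_ge0// expr_le_expR.
Qed.

(** Exponential decay beats the polynomial [X^2 p], hence a quadratic bound, which
gives derivability at the origin with derivative [0]. *)
Lemma flat_le p : exists2 C, 0 <= C & forall x, `|flat p x| <= C * x ^+ 2.
Proof.
have [C C0 h] := poly_le_expR (p * 'X^2).
exists C => // x; rewrite /flat; case: ifPn => [x0|_]; last first.
  by rewrite normr0 mulr_ge0// sqr_ge0.
have y0 : 0 <= x^-1 by rewrite invr_ge0 ltW.
have := h _ y0; rewrite hornerM hornerXn normrM (ger0_norm (exprn_ge0 _ y0)).
rewrite normrM (ger0_norm (expR_ge0 _)) expRN => hh.
rewrite ler_pdivrMr ?expR_gt0// mulrAC -ler_pdivrMr ?exprn_gt0//.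
by rewrite -exprVn.
Qed.

Lemma is_derive_flat p x :
  is_derive x (1 : R) (flat p) (flat ('X^2 * (p - deriv p)) x).
Proof.
have [x0|x0|->] := ltgtP x 0.
- rewrite /(flat _ x) ltNge (ltW x0)/=.
  apply: (@near_eq_is_derive _ _ _ (fun=> 0)).
  near=> y; rewrite /flat ltNge ltW//.
  by near: y; exact: lt_nbhsl.
- apply: (@near_eq_is_derive _ _ _
    ((fun y => p.[y^-1]) * (fun y => expR (- y^-1)))).
    near=> y; rewrite /flat (_ : 0 < y)//.
    by near: y; exact: (cvgr_gt x).
  have xn0 : x != 0 by rewrite gt_eqF.
  have dV : is_derive x (1 : R) (fun y : R => y^-1) (- (x ^- 2)).
    apply: is_derive_eq; first exact: is_deriveV.
    by rewrite /GRing.scale/= mulr1.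
  have dp : is_derive x (1 : R) (fun y => p.[y^-1])
      ((deriv p).[x^-1] * - (x ^- 2)).
    exact: (@is_derive_comp _ _ (horner p) (fun y => y^-1)).
  have dN : is_derive x (1 : R) (fun y => - y^-1) (x ^- 2).
    by have := @is_deriveN _ _ _ _ _ _ _ dV; rewrite opprK.
  have de : is_derive x (1 : R) (fun y => expR (- y^-1))
      (expR (- x^-1) * x ^- 2).
    exact: (@is_derive_comp _ _ expR (fun y => - y^-1)).
  have dM := @is_deriveM _ _ _ _ _ _ _ _ dp de.
  apply: (@is_derive_eq _ _ _ _ _ _ _ _ dM).
  rewrite /flat x0 !hornerE /GRing.scale/=.
  by rewrite exprVn; ring.
- have [C C0 hC] := flat_le p.
  rewrite {2}/flat ltxx.
  suff h : (fun h : R => h^-1 *: ((flat p \o shift 0) (h *: (1 : R)) - flat p 0))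
      @ 0^' --> (0 : R).
    by split; [apply/cvg_ex; exists 0|exact: cvg_lim].
  apply/cvgr0Pnorm_le => e e0; near=> h.
  rewrite /= addr0 [X in flat p X](_ : _ = h) ?[X in _ - X](_ : _ = 0); last 2 first.
    by rewrite /flat ltxx.
    by rewrite /GRing.scale/= mulr1.
  have h0 : h != 0 by near: h; exact: nbhs_dnbhs_neq.
  rewrite subr0 /GRing.scale/= normrM normfV.
  rewrite mulrC ler_pdivrMr ?normr_gt0//.
  (* the difference quotient is at most C |h| *)
  apply: le_trans (hC h) _.
  rewrite -[h ^+ 2]real_normK ?num_real// expr2 mulrA ler_wpM2r//.
  have : `|h| <= e / (C + 1).
    by near: h; apply: dnbhs0_le; rewrite divr_gt0// ltr_wpDl.
  rewrite ler_pdivlMr ?ltr_wpDl// mulrDr mulr1 mulrC.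
  by apply: le_trans; rewrite lerDl.
Unshelve. all: by end_near. Qed.

Lemma Ck1_flat n p : Ck1 n (flat p).
Proof.
elim: n p => [|n ih] p; last by apply: Ck1S (is_derive_flat p); exact: ih.
move=> x; apply/differentiable_continuous/derivable1_diffP.
by have [] := is_derive_flat p x.
Qed.

Definition theta := flat 1.

Lemma theta_ge0 x : 0 <= theta x.
Proof. by rewrite /theta /flat; case: ifP => // _; rewrite hornerE mul1r expR_ge0. Qed.

Lemma theta_le1 x : theta x <= 1.
Proof.
rewrite /theta /flat; case: ifPn => // x0; rewrite hornerE mul1r.
by rewrite -expR0 ler_expR oppr_le0 invr_ge0 ltW.
Qed.

Lemma theta0 x : x <= 0 -> theta x = 0.
Proof. by rewrite leNgt /theta /flat => /negbTE ->. Qed.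

Lemma Ck1_theta n : Ck1 n theta. Proof. exact: Ck1_flat. Qed.

(** Rescaling [theta] approximates the indicator of the positive half-line from
below, pointwise, which is enough for dominated convergence. *)
Lemma cvg_theta x : theta (k.+1%:R * x) @[k --> \oo] --> ((0 < x)%R%:R : R).
Proof.
have [x0|x0] := ltP 0 x; last first.
  rewrite (_ : (fun _ => _) = cst 0); first exact: cvg_cst.
  by apply/funext => k; rewrite theta0// mulr_ge0_le0.
rewrite (_ : (fun _ => _) = (fun k => expR (- (k.+1%:R^-1 * x^-1)))); last first.
  apply/funext => k; rewrite /theta /flat mulr_gt0// hornerE mul1r.
  by rewrite invfM.
have h : (k.+1%:R^-1 : R) * x^-1 @[k --> \oo] --> (0 : R).
  have : (k.+1%:R^-1 : R) * x^-1 @[k --> \oo] --> (0 * x^-1 : R).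
    by apply: cvgM; [exact: cvg_harmonic|exact: cvg_cst].
  by rewrite mul0r.
have : - ((k.+1%:R^-1 : R) * x^-1) @[k --> \oo] --> (- 0 : R) by exact: cvgN.
rewrite oppr0 => /(continuous_cvg _ (@continuous_expR R 0)).
by rewrite expR0.
Qed.

End theta.

(** A smooth function vanishing off the interval from [a] to [b]; it increases with
[k] to the indicator of that open interval. *)
Section bump.
Context {R : realType}.
Implicit Types (a b c x y p : R).

Definition bump a b (k : nat) x : R :=
  theta (k.+1%:R * (x - a)) * theta (k.+1%:R * (b - x)).

Lemma Ck1_affine n c a : Ck1 n (fun x => c * (x - a)).
Proof.
by apply: CkZ; apply: CkB; [exact: Ck1_id|exact: Ck_cst].
Qed.

Lemma Ck1_bump n a b k : Ck1 n (bump a b k).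
Proof.
apply: CkM; apply: (Ck_comp (Ck1_theta n)); first exact: Ck1_affine.
rewrite (_ : (fun _ => _) = fun x => (- k.+1%:R) * (x - b)); first exact: Ck1_affine.
by apply/funext => x; ring.
Qed.

Lemma bump_ge0 a b k x : 0 <= bump a b k x.
Proof. by rewrite mulr_ge0// theta_ge0. Qed.

Lemma bump_le1 a b k x : bump a b k x <= 1.
Proof. by rewrite mulr_ile1// ?theta_ge0// theta_le1. Qed.

Lemma bump0 a b k x : ~~ (a < x < b) -> bump a b k x = 0.
Proof.
rewrite negb_and -!leNgt /bump => /orP[h|h].
  by rewrite theta0 ?mul0r// mulr_ge0_le0// subr_le0.
by rewrite (theta0 (x := _ * (b - x))) ?mulr0// mulr_ge0_le0// subr_le0.
Qed.

Lemma cvg_bump a b x :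
  bump a b k x @[k --> \oo] --> ((a < x < b)%R%:R : R).
Proof.
rewrite -mulnb natrM -subr_gt0 -(subr_gt0 x b).
by apply: cvgM; exact: cvg_theta.
Qed.

Lemma near_lt_eq0 (f : R -> R) a x : (forall y, y < a -> f y = 0) -> x < a ->
  \forall y \near x, 0 = f y.
Proof. by move=> fa xa; near=> y; rewrite fa//; near: y; exact: lt_nbhsl.
Unshelve. all: by end_near. Qed.

Lemma derive_lt_eq0 (f : R -> R) a x : (forall y, y < a -> f y = 0) -> x < a ->
  'D_1 f x = 0.
Proof.
move=> fa xa.
have h : is_derive x (1 : R) f 0.
  apply: (@near_eq_is_derive _ _ _ (fun=> 0)); first exact: near_lt_eq0 xa.
by have [] := h.
Qed.

(** Since [f] vanishes near the singularity of the power and on the negative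
half-line, the product is derivable everywhere, also where the power is not. *)
Lemma is_derive_mul_powR (f : R -> R) a p x df : 0 < a ->
  (forall y, y < a -> f y = 0) -> is_derive x (1 : R) f df ->
  is_derive x (1 : R) (fun x => f x * x `^ p)
    (df * x `^ p + f x * (p * x `^ (p - 1))).
Proof.
move=> a0 fa dfx; have [x0|x0] := ltP 0 x.
  have dp := is_derive1_powR p x0.
  apply: (@is_derive_eq _ _ _ _ _ _ _ _ (@is_deriveM _ _ _ _ _ _ _ _ dfx dp)).
  by rewrite /GRing.scale/= addrC [x `^ p * df]mulrC.
have xa : x < a by exact: le_lt_trans a0.
have -> : df = 0 by case: dfx => _ <-; exact: derive_lt_eq0 xa.
rewrite fa// !mul0r addr0; apply: (@near_eq_is_derive _ _ _ (fun=> 0)).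
apply: near_lt_eq0 xa => y ya; by rewrite fa// mul0r.
Qed.

Lemma Ck1_mul_powR n (f : R -> R) a p : 0 < a ->
  (forall y, y < a -> f y = 0) -> (forall k, Ck1 k f) ->
  Ck1 n (fun x => f x * x `^ p).
Proof.
move=> a0; elim: n f p => [|n ih] f p fa Cf.
  move=> x; apply/differentiable_continuous/derivable1_diffP.
  by have [] := is_derive_mul_powR p a0 fa (Ck1_derive x (Cf 1%N)).
apply: Ck1S => [|x]; last first.
  exact: is_derive_mul_powR a0 fa (Ck1_derive x (Cf 1%N)).
apply: CkD.
  apply: ih => [y ya|k]; first exact: derive_lt_eq0 ya.
  exact: (Ck_partial tt (Cf k.+1)).
rewrite (_ : (fun _ => _) = (fun x => p * (f x * x `^ (p - 1)))).
  by apply: CkZ; exact: ih.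
by apply/funext => x; rewrite mulrCA.
Qed.

(** The integral from minus infinity, rather than from [0], makes the fundamental
theorem of calculus available at every point. *)
Lemma primitive (g : R -> R) : continuous g -> (forall x, x <= 0 -> g x = 0) ->
  exists G : R -> R, (forall x, is_derive x (1 : R) G (g x)) /\
    (forall x, x <= 0 -> G x = 0).
Proof.
move=> cg g0.
pose G x := (\int[@lebesgue_measure R]_(t in `]-oo, x]) g t)%R.
have intg u : (@lebesgue_measure R).-integrable `]-oo, u] (EFin \o g).
  have : (@lebesgue_measure R).-integrable `]-oo, u] ((EFin \o g) \_ `[0, u]).
    apply/integrable_restrict => //.
    rewrite (_ : _ `&` _ = `[0, u]%classic); last first.
      apply/seteqP; split => t; first by case.
      by move=> tu; split=> //; move: tu; rewrite /= !in_itv/= => /andP[].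
    apply: continuous_compact_integrable; first exact: segment_compact.
    exact: continuous_subspaceT.
  apply: eq_integrable => // t /[!inE]/=; rewrite in_itv/= => tu; rewrite patchE.
  case: ifPn => //; rewrite notin_setE/= in_itv/= tu andbT => /negP.
  by rewrite -ltNge => /ltW/g0 ->.
exists G; split=> [x|x x0]; last first.
  rewrite /G /Rintegral integral0_eq// => t /=; rewrite in_itv/= => tu.
  by rewrite g0// (le_trans tu).
have x1 : x < x + 1 by rewrite ltrDl.
have [|d1 d2] := continuous_FTC1 x1 (intg (x + 1)) _ (cg x).
  exact: ltNyr.
split; first exact: d1.
by rewrite -derive1E; exact: d2.
Qed.

End bump.

(** * Borel sets, boxes and the unit ball *)

Section boxes.
Context {R : realType} {N : nat}.
Local Notation vec := 'rV[R]_N.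
Implicit Types (a b x y : vec).

Definition obox a b : set vec :=
  [set x | forall i, a ord0 i < x ord0 i < b ord0 i].
Definition cbox a b : set vec :=
  [set x | forall i, a ord0 i <= x ord0 i <= b ord0 i].

Lemma obox_cbox a b : obox a b `<=` cbox a b.
Proof. by move=> x h i; have /andP[/ltW -> /ltW ->] := h i. Qed.

Lemma measurable_coord_preimage (i : 'I_N) (Y : set R) : measurable Y ->
  measurable [set x : vec | Y (x ord0 i)].
Proof.
by move=> mY; rewrite -[X in measurable X]setTI; exact: measurable_coord.
Qed.

Lemma measurable_obox a b : measurable (obox a b).
Proof.
rewrite (_ : obox a b = \bigcap_(i in [set: 'I_N])
    [set x : vec | `]a ord0 i, b ord0 i[%classic (x ord0 i)]).
  apply: fin_bigcap_measurable => // i _.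
  exact: measurable_coord_preimage.
apply/seteqP; split=> x /=.
  by move=> h i _ /=; rewrite in_itv/=.
by move=> h i; have := h i I; rewrite /= in_itv/=.
Qed.

Lemma compact_cbox a b : compact (cbox a b).
Proof.
rewrite (_ : cbox a b =
    [set x : vec | forall i, `[a ord0 i, b ord0 i]%classic (x ord0 i)]).
  apply: (@rV_compact R N (fun i => `[a ord0 i, b ord0 i]%classic)) => i.
  exact: segment_compact.
by apply/seteqP; split=> x h i; have := h i; rewrite /= in_itv/=.
Qed.

Lemma closed_cbox a b : closed (cbox a b).
Proof.
by apply: compact_closed; [exact: norm_hausdorff|exact: compact_cbox].
Qed.

(** With [c = -1] and [c = 1] these are the corners of overlapping boxes, of which
there are countably many. *)
Definition grid (k : nat) (z : 'rV[int]_N) (c : int) : vec :=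
  \row_i ((z ord0 i + c)%:~R / k.+1%:R).

(** An open set is a countable union of open boxes whose closures it contains.  This
is what relates open sets to the sigma-algebra generated by the coordinates, and
it reduces almost everywhere statements on open sets to boxes. *)
Lemma open_boxes (U : set vec) x : open U -> U x -> exists kz : nat * 'rV[int]_N,
  obox (grid kz.1 kz.2 (-1)) (grid kz.1 kz.2 1) x /\
  cbox (grid kz.1 kz.2 (-1)) (grid kz.1 kz.2 1) `<=` U.
Proof.
move=> oU Ux; have /nbhs_ballP[e /= e0 eU] : nbhs x U by exact: open_nbhs_nbhs.
have [k ke] : exists k : nat, 2 / k.+1%:R < e.
  exists (Num.truncn (2 / e)); rewrite ltr_pdivrMr// mulrC -ltr_pdivrMr//.
  by have /andP[_] := truncn_itv (ltW (divr_gt0 (ltr0n R 2) e0)).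
have k0 : (0 : R) < k.+1%:R by rewrite ltr0n.
(* rounding down the coordinates of x to multiples of 1 / (k + 1) *)
exists (k, \row_i Num.floor (k.+1%:R * x ord0 i)); split => [i|y hy] /=.
  rewrite !mxE ltr_pdivrMr// ltr_pdivlMr// (mulrC (x ord0 i)) !intrD.
  have := floor_itv (k.+1%:R * x ord0 i); rewrite intrD => /andP[h1 h2].
  by rewrite h2 andbT (lt_le_trans _ h1)// gtrDl.
apply: eU; split=> // i j; rewrite (ord1 i); have := hy j; rewrite !mxE.
rewrite ler_pdivrMr// ler_pdivlMr// !intrD => /andP[h1 h2].
have /andP[h3 h4] := floor_itv (k.+1%:R * x ord0 j).
apply: le_lt_trans ke; rewrite ler_pdivlMr// -(ger0_norm (ltW k0)) -normrM.
rewrite mulrBl ler_norml; move: h1 h2 h3 h4; rewrite intrD.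
by rewrite mulrC; lra.
Qed.

Lemma open_rV_measurable (U : set vec) : open U -> measurable U.
Proof.
move=> oU.
rewrite (_ : U = \bigcup_(kz : nat * 'rV[int]_N)
   (if `[< cbox (grid kz.1 kz.2 (-1)) (grid kz.1 kz.2 1) `<=` U >]
    then obox (grid kz.1 kz.2 (-1)) (grid kz.1 kz.2 1) else set0)).
  apply: countable_bigcupT_measurable => [|kz]; first exact: countableP.
  by case: asboolP => // _; exact: measurable_obox.
apply/seteqP; split=> x.
  by move=> /(open_boxes oU)[kz [h1 h2]]; exists kz => //; rewrite asboolT.
by move=> [kz _]; case: asboolP => // h1 /obox_cbox/h1.
Qed.

Lemma closed_rV_measurable (A : set vec) : closed A -> measurable A.
Proof.
by move=> /closed_openC/open_rV_measurable/measurableC; rewrite setCK.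
Qed.

Lemma measurable_cbox a b : measurable (cbox a b).
Proof. by apply: closed_rV_measurable; exact: closed_cbox. Qed.

Lemma continuous_rV_measurable (u : vec -> R) : continuous u ->
  measurable_fun [set: vec] u.
Proof.
move=> cu; apply: (measurability _ (measurable_realfun.RGenOpens.measurableE R)) => //.
move=> _ [_ [c [d ->]] <-]; rewrite setTI; apply: open_rV_measurable.
by apply: open_comp => [x _|]; [exact: cu|exact: interval_open].
Qed.

End boxes.

Section ball_facts.
Context {R : realType} {N : nat}.
Local Notation vec := 'rV[R]_N.
Implicit Types (x y : vec).

(** The squared Euclidean norm, unlike the norm itself, is smooth at the origin. *)
Definition nsq x : R := dot x x.

Lemma nsq_ge0 x : 0 <= nsq x.
Proof. by apply: sumr_ge0 => i _; rewrite -expr2 sqr_ge0. Qed.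

Lemma enorm_ge0 x : 0 <= enorm x. Proof. exact: sqrtr_ge0. Qed.

Lemma enorm_sqr x : enorm x ^+ 2 = nsq x.
Proof. by rewrite sqr_sqrtr// nsq_ge0. Qed.

Lemma uballE x : uball x <-> nsq x < 1.
Proof.
rewrite /uball/= -[X in _ <-> X < _]enorm_sqr.
by rewrite expr_lt1 ?enorm_ge0.
Qed.

Lemma CkV_nsq n : CkV n nsq.
Proof. exact: CkV_dot_self. Qed.

Lemma continuous_nsq : continuous nsq.
Proof. exact: (Ck_continuous (CkV_nsq 0)). Qed.

Lemma open_uball : open (uball : set vec).
Proof.
rewrite (_ : uball = nsq @^-1` `]-oo, 1[%classic); last first.
  by apply/seteqP; split=> x /=; rewrite in_itv/= => /uballE.
by apply: open_comp => [x _|]; [exact: continuous_nsq|exact: interval_open].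
Qed.

Lemma measurable_uball : measurable (uball : set vec).
Proof. by apply: open_rV_measurable; exact: open_uball. Qed.

Lemma coord_sqr_le_nsq x i : x ord0 i ^+ 2 <= nsq x.
Proof.
rewrite /nsq /dot (bigD1 i)//= -expr2 lerDl; apply: sumr_ge0 => j _.
by rewrite -expr2 sqr_ge0.
Qed.

Definition cube (c : R) : set vec := cbox (const_mx (- c)) (const_mx c).

Lemma cubeP c x : cube c x <-> forall i, `|x ord0 i| <= c.
Proof. by split=> h i; have := h i; rewrite !mxE ler_norml. Qed.

Lemma uball_cube : uball `<=` cube 1.
Proof.
move=> x /uballE/ltW x1; apply/cubeP => i; rewrite -(@ler_pXn2r _ 2)//.
by rewrite expr1n real_normK ?num_real// (le_trans (coord_sqr_le_nsq _ _)).
by rewrite nnegrE.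
Qed.

Lemma compact_cube c : compact (cube c). Proof. exact: compact_cbox. Qed.
Lemma measurable_cube c : measurable (cube c).
Proof. exact: measurable_cbox. Qed.

Lemma continuous_bounded_cube (k : R) (u : vec -> R) : 0 <= k ->
  continuous u -> exists2 C, 0 < C & forall x, cube k x -> `|u x| <= C.
Proof.
move=> k0 cu; have ne : cube k !=set0.
  by exists 0; apply/cubeP => i; rewrite mxE normr0.
have [|c _ hc] := @EVT_max_rV R N (fun x => `|u x|) _ ne (@compact_cube k).
  apply: continuous_subspaceT => x.
  by apply: continuous_comp; [exact: cu|exact: norm_continuous].
exists (`|u c| + 1); first by rewrite ltr_wpDl.
by move=> x bx; apply: le_trans (hc _ (mem_set bx)) _; rewrite lerDl.
Qed.

End ball_facts.

Section box_measure.
Context {R : realType}.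

Lemma rV_cons0 n (p : measurableTypeR R * 'rV[R]_n) :
  rV_cons p ord0 ord0 = p.1.
Proof.
have -> : (ord0 : 'I_n.+1) = lshift n (ord0 : 'I_1) by exact: val_inj.
by apply: etrans (row_mxEl _ _ _ _) _; rewrite mxE.
Qed.

Lemma rV_consS n (p : measurableTypeR R * 'rV[R]_n) (j : 'I_n) :
  rV_cons p ord0 (lift ord0 j) = p.2 ord0 j.
Proof.
have -> : lift ord0 j = rshift 1 j by exact: val_inj.
exact: row_mxEr.
Qed.

(** The measure is an iterated product, so the volume is found by induction; it
yields finiteness and positivity of the measure of the ball, the latter by an
inscribed cube. *)
Lemma cube_measure n (c : R) : 0 <= c ->
  lebesgue_rV R n (cube c) = ((2 * c) ^+ n)%:E.
Proof.
move=> c0; elim: n => [|n ih].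
  rewrite /= diracE mem_set ?expr0// => -[]//.
rewrite /= /rV_step /pushforward.
rewrite (_ : _ @^-1` _ = `[- c, c]%classic `*` cube c); last first.
  apply/seteqP; split=> -[t v] /=.
    move=> /cubeP h; split=> [|].
      by have := h ord0; rewrite rV_cons0 /= in_itv/= ler_norml.
    by apply/cubeP => i; have := h (lift ord0 i); rewrite rV_consS.
  move=> [tc /cubeP vc]; apply/cubeP => i.
  case: (unliftP ord0 i) => [j|] ->; first by rewrite rV_consS.
  by rewrite rV_cons0; move: tc; rewrite in_itv/= ler_norml.
rewrite product_measure1E//; last exact: measurable_cube.
have lc : (@lebesgue_measure R) `[- c, c]%classic = (2 * c)%:E.
  rewrite lebesgue_measure_itv/= lte_fin; case: ifPn => [cc|].
    by rewrite -EFinD opprK mulr_natl mulr2n.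
  by rewrite -leNgt => cc; rewrite (_ : c = 0) ?mulr0//; lra.
by rewrite [X in (X * _)%E]lc [X in (_ * X)%E]ih -EFinM exprS.
Qed.

Lemma uball_fin n : (lebesgue_rV R n uball < +oo)%E.
Proof.
apply: (@le_lt_trans _ _ (lebesgue_rV R n (cube 1))).
  by apply: le_measure; rewrite ?inE; [exact: measurable_uball|
    exact: measurable_cube|exact: uball_cube].
by rewrite cube_measure// ltry.
Qed.

Lemma uball_gt0 n : (0 < lebesgue_rV R n uball)%E.
Proof.
have [c c0 hc] : exists2 c : R, 0 < c & n%:R * c ^+ 2 < 1.
  exists (n.+1%:R^-1); first by rewrite invr_gt0.
  rewrite exprVn ltr_pdivrMr ?exprn_gt0// mul1r -natrX ltr_nat.
  by rewrite (@leq_ltn_trans (n * n.+1)) ?leq_pmulr// expnS expn1 ltn_pmul2r.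
apply: (@lt_le_trans _ _ ((2 * c) ^+ n)%:E).
  by rewrite lte_fin exprn_gt0// mulr_gt0.
rewrite -(cube_measure _ (ltW c0)); apply: le_measure; rewrite ?inE.
- exact: measurable_cube.
- exact: measurable_uball.
- move=> x /cubeP xc; apply/uballE; apply: le_lt_trans hc.
  rewrite -[n in n%:R](card_ord n) mulr_natl -sumr_const.
  apply: ler_sum => i _; rewrite -expr2 -real_normK ?num_real//.
  by rewrite ler_pXn2r ?nnegrE// ltW.
Qed.

End box_measure.

(** * The integral of a partial derivative of compact support vanishes *)

Section slices.
Context {R : realType} {n : nat}.
Local Notation vec := 'rV[R]_n.+1.

Lemma rV_cons_line0 (h t : R) (v : 'rV[R]_n) :
  h *: (delta_mx ord0 ord0 : vec) + rV_cons (t, v) = rV_cons (h + t, v).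
Proof.
apply/rowP => i; rewrite [LHS]mxE [X in X + _]mxE [X in h * X]mxE eqxx/=.
case: (unliftP ord0 i) => [j|] ->; first by rewrite mulr0 add0r !rV_consS.
by rewrite eqxx mulr1 !rV_cons0.
Qed.

Lemma rV_cons_lineS (h t : R) (j : 'I_n) (v : 'rV[R]_n) :
  h *: (delta_mx ord0 (lift ord0 j) : vec) + rV_cons (t, v) =
  rV_cons (t, h *: delta_mx ord0 j + v).
Proof.
apply/rowP => i; rewrite [LHS]mxE [X in X + _]mxE [X in h * X]mxE eqxx/=.
case: (unliftP ord0 i) => [l|] ->; last by rewrite mulr0 add0r !rV_cons0.
by rewrite !rV_consS/= !mxE eqxx (inj_eq lift_inj).
Qed.

Lemma continuous_rV_cons_snd (t : R) : continuous (fun v : 'rV[R]_n => rV_cons (t, v)).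
Proof.
move=> v A /nbhs_ballP[e e0 eA]; apply/nbhs_ballP; exists e => //= w [_ vw].
apply: eA; split=> // i j; rewrite !ord1; case: (unliftP ord0 j) => [l|] ->.
  by rewrite !rV_consS /=; exact: vw.
by rewrite !rV_cons0; exact: ballxx.
Qed.

Lemma continuous_rV_cons_fst (v : 'rV[R]_n) : continuous (fun t : R => rV_cons (t, v)).
Proof.
move=> t A /nbhs_ballP[e e0 eA]; apply/nbhs_ballP; exists e => //= s ts.
apply: eA; split=> // i j; rewrite !ord1; case: (unliftP ord0 j) => [l|] ->.
  by rewrite !rV_consS /=; exact: ballxx.
by rewrite !rV_cons0.
Qed.

(** Fixing the first coordinate turns a derivative along a later direction into one
on a space of lower dimension. *)
Lemma is_derive_slice (f : vec -> R) (t : R) (v : 'rV[R]_n) (j : 'I_n) df :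
  is_derive (rV_cons (t, v) : vec) (delta_mx ord0 (lift ord0 j) : vec) f df ->
  is_derive v (delta_mx ord0 j : 'rV[R]_n) (fun v => f (rV_cons (t, v))) df.
Proof.
move=> [].
suff E : (fun h : R => h^-1 *: ((f \o shift (rV_cons (t, v) : vec))
      (h *: (delta_mx ord0 (lift ord0 j) : vec)) - f (rV_cons (t, v)))) =
    (fun h => h^-1 *: (((fun v => f (rV_cons (t, v))) \o shift v)
      (h *: delta_mx ord0 j) - f (rV_cons (t, v)))).
  by rewrite /derivable /derive E => d1 d2; split; [exact: d1|exact: d2].
by apply/funext => h /=; rewrite rV_cons_lineS.
Qed.

Lemma is_derive_slice0 (f : vec -> R) (t : R) (v : 'rV[R]_n) df :
  is_derive (rV_cons (t, v) : vec) (delta_mx ord0 ord0 : vec) f df ->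
  is_derive t (1 : R) (fun t => f (rV_cons (t, v))) df.
Proof.
move=> [].
suff E : (fun h : R => h^-1 *: ((f \o shift (rV_cons (t, v) : vec))
      (h *: (delta_mx ord0 ord0 : vec)) - f (rV_cons (t, v)))) =
    (fun h => h^-1 *: (((fun t => f (rV_cons (t, v))) \o shift t)
      (h *: (1 : R)) - f (rV_cons (t, v)))).
  by rewrite /derivable /derive E => d1 d2; split; [exact: d1|exact: d2].
by apply/funext => h /=; rewrite rV_cons_line0 /GRing.scale/= mulr1.
Qed.

Lemma CkV_slice k (f : vec -> R) (t : R) : CkV k f ->
  CkV k (fun v : 'rV[R]_n => f (rV_cons (t, v))).
Proof.
elim: k f => [|k ih] f Cf.
  by move=> v; apply: continuous_comp; [exact: continuous_rV_cons_snd|exact: Cf].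
apply: CkS => [v|j].
  by apply: continuous_comp;
    [exact: continuous_rV_cons_snd|exact: (Ck_continuous Cf)].
eexists; first by apply: ih; exact: (Ck_partial (lift ord0 j) Cf).
by move=> v; apply: is_derive_slice; exact: (Ck_derive (lift ord0 j) _ Cf).
Qed.

End slices.

Section integral_partial.
Context {R : realType}.
Local Notation leb n := (lebesgue_rV R n).
Local Notation e := (fun i => delta_mx ord0 i).

Lemma partial_out_cube n k (f : 'rV[R]_n -> R) i x : (forall x, ~ cube k x -> f x = 0) ->
  ~ cube k x -> 'D_(delta_mx ord0 i) f x = 0.
Proof.
move=> f0 kx.
have h : is_derive x (delta_mx ord0 i : 'rV[R]_n) f 0.
  apply: (@near_eq_is_derive _ _ _ (fun=> 0)).
  near=> y; rewrite f0//.
  by near: y; apply: open_nbhs_nbhs; split=> //; apply: closed_openC; exact: closed_cbox.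
by have [] := h.
Unshelve. all: by end_near. Qed.

Lemma integrable_cube n (k : R) (f : 'rV[R]_n -> R) : 0 <= k -> continuous f ->
  (forall x, ~ cube k x -> f x = 0) -> (leb n).-integrable setT (EFin \o f).
Proof.
move=> k0 cf f0; have [C C0 fC] := continuous_bounded_cube k0 cf.
have mk := @measurable_cube R n k.
have : (leb n).-integrable (cube k) (EFin \o f).
  apply: measurable_bounded_integrable => //.
  - by rewrite [ltLHS](cube_measure n k0) ltry.
  - by apply: measurable_funTS; exact: continuous_rV_measurable.
  - exists C; split; first exact: num_real.
    by move=> D CD x kx; apply: le_trans (ltW CD); exact: fC.
move/(integrable_mkcond _ mk); apply: eq_integrable => // x _.
by rewrite patchE; case: ifPn => //; rewrite notin_setE /= => /f0 ->.
Qed.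

Lemma integral_cons n (f : 'rV[R]_n.+1 -> R) : measurable_fun setT f ->
  (leb n.+1).-integrable setT (EFin \o f) ->
  ((@lebesgue_measure R) \x leb n)%E.-integrable setT
    (fun p => (f (rV_cons p))%:E) /\
  (\int[leb n.+1]_x (f x)%:E =
   \int[((@lebesgue_measure R) \x leb n)%E]_p (f (rV_cons p))%:E)%E.
Proof.
move=> mf intf; have mc := @measurable_rV_cons R n.
have i2 : ((@lebesgue_measure R) \x leb n)%E.-integrable setT
    (fun p => (f (rV_cons p))%:E).
  apply/integrableP; split.
    by apply/measurable_EFinP; exact: measurableT_comp.
  have /integrableP[_] := intf.
  rewrite [X in (X < _)%E -> _](@ge0_integral_pushforward _ _ _ _ _ _ mc
    ((@lebesgue_measure R) \x leb n)%E setT (fun x => `|(EFin \o f) x|%E))//.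
  by apply: measurableT_comp => //; exact/measurable_EFinP.
split=> //; rewrite [LHS](@integral_pushforward _ _ _ _ _ _ mc
    ((@lebesgue_measure R) \x leb n)%E setT (EFin \o f))//.
exact/measurable_EFinP.
Qed.

Lemma integral_derive_compact (k : R) (g dg : R -> R) : 0 <= k ->
  (forall t, is_derive t (1 : R) g (dg t)) -> continuous dg ->
  (forall t, k < `|t| -> g t = 0) -> (forall t, k < `|t| -> dg t = 0) ->
  (\int[@lebesgue_measure R]_t (dg t)%:E = 0)%E.
Proof.
move=> k0 gdg cdg g0 dg0.
have kk : - (k + 1) < k + 1 by lra.
have -> : (\int[@lebesgue_measure R]_t (dg t)%:E =
    \int[@lebesgue_measure R]_(t in `[(- (k + 1))%R, (k + 1)%R]) (dg t)%:E)%E.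
  rewrite [RHS]integral_mkcond; apply: eq_integral => t _.
  rewrite patchE; case: ifPn => //; rewrite notin_setE/= in_itv/= => h.
  rewrite dg0// ltNge; apply/negP => tk; apply: h.
  by move: tk; rewrite ler_norml; lra.
have cg : continuous g.
  move=> t; apply/differentiable_continuous/derivable1_diffP.
  by have [] := gdg t.
rewrite (@continuous_FTC2 _ dg g)//.
- have kk1 : k < `|k + 1| by rewrite gtr0_norm; lra.
  have kk2 : k < `|- (k + 1)| by rewrite normrN.
  by rewrite (g0 _ kk1) (g0 _ kk2) subee.
- exact: continuous_subspaceT.
- split; [by move=> t _; have [] := gdg t|apply: cvg_at_right_filter; exact: cg|
    apply: cvg_at_left_filter; exact: cg].
- by move=> t _; rewrite derive1E; have [_] := gdg t.
Qed.

(** Induction on the dimension, through the Fubini theorem: in the first direction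
the inner integral is that of a derivative of compact support on the line; in
the other directions the slice at a fixed first coordinate is handled by the
induction hypothesis. *)
Lemma integral_partial_eq0 n (k : R) (f : 'rV[R]_n -> R) i : 0 <= k ->
  CkV 1 f -> (forall x, ~ cube k x -> f x = 0) ->
  (\int[leb n]_x ('D_(delta_mx ord0 i) f x)%:E = 0)%E.
Proof.
elim: n k f i => [k f [] //|n ih] k f i k0 Cf f0.
have cdf := CkV_continuous (CkV_partial i Cf).
have df0 x : ~ cube k x -> 'D_(delta_mx ord0 i) f x = 0 by exact: partial_out_cube.
have cslice (v : 'rV[R]_n) :
    continuous (fun t : R => 'D_(delta_mx ord0 i) f (rV_cons (t, v))).
  move=> t; apply: (@continuous_comp _ _ _ (fun t : R => rV_cons (t, v))
    ('D_(delta_mx ord0 i) f)); [exact: continuous_rV_cons_fst|exact: cdf].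
have [intp ->] := integral_cons (continuous_rV_measurable cdf) (integrable_cube k0 cdf df0).
case: (unliftP ord0 i) => [j|] ei.
- rewrite -(integral12_prod_meas1 intp) integral0_eq// => t _; rewrite /fubini_F.
  rewrite -[RHS](ih k (fun v => f (rV_cons (t, v))) j k0).
  + apply: eq_integral => v _; congr EFin; rewrite ei.
    have := is_derive_slice (CkV_derive (lift ord0 j) (rV_cons (t, v)) Cf).
    by case=> _ ->.
  + exact: CkV_slice.
  + move=> v kv; apply: f0 => /cubeP h; apply: kv; apply/cubeP => l.
    by have := h (lift ord0 l); rewrite rV_consS.
- rewrite -(integral21_prod_meas1 intp) integral0_eq// => v _; rewrite /fubini_G.
  apply: (@integral_derive_compact k (fun t => f (rV_cons (t, v)))) => //.
  + move=> t; apply: is_derive_slice0; rewrite ei; exact: (CkV_derive ord0 _ Cf).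
  + move=> t kt; apply: f0 => /cubeP/(_ ord0); rewrite rV_cons0/= leNgt.
    by rewrite kt.
  + move=> t kt; apply: df0 => /cubeP/(_ ord0); rewrite rV_cons0/= leNgt.
    by rewrite kt.
Qed.

End integral_partial.

(** * Weak gradients of smooth functions *)

Section continuous_fun.
Context {R : realType} {T : topologicalType}.
Implicit Types f g : T -> R.

Lemma continuous_mul f g : continuous f -> continuous g ->
  continuous (fun x => f x * g x).
Proof. by move=> cf cg x; exact: (continuousM (cf x) (cg x)). Qed.

Lemma continuous_add f g : continuous f -> continuous g ->
  continuous (fun x => f x + g x).
Proof. by move=> cf cg x; exact: (continuousD (cf x) (cg x)). Qed.

Lemma continuous_sum (I : Type) (s : seq I) (f : I -> T -> R) :
  (forall i, continuous (f i)) -> continuous (fun x => \sum_(i <- s) f i x).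
Proof.
move=> cf; elim: s => [|i s ih].
  by under eq_fun do rewrite big_nil; exact: cst_continuous.
by under eq_fun do rewrite big_cons; exact: continuous_add.
Qed.

End continuous_fun.

Section weak_gradient.
Context {R : realType} {N : nat}.
Local Notation vec := 'rV[R]_N.
Local Notation mu := (lebesgue_rV R N).
Local Notation e i := (delta_mx ord0 i : vec).

Lemma bounded_integrable_ball (C : R) (f : vec -> R) : measurable_fun uball f ->
  (forall x, uball x -> `|f x| <= C) -> mu.-integrable uball (EFin \o f).
Proof.
move=> mf fC; apply: measurable_bounded_integrable => //.
- exact: measurable_uball.
- exact: uball_fin.
- exists C; split; first exact: num_real.
  by move=> D CD x kx; apply: le_trans (ltW CD); exact: fC.
Qed.

Lemma continuous_bounded_ball (f : vec -> R) : continuous f ->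
  exists2 C, 0 < C & forall x, uball x -> `|f x| <= C.
Proof.
move=> /(continuous_bounded_cube ler01)[C C0 fC].
by exists C => // x /uball_cube; exact: fC.
Qed.

Lemma continuous_measurable_ball (f : vec -> R) : continuous f ->
  measurable_fun uball f.
Proof. by move=> cf; apply: measurable_funTS; exact: continuous_rV_measurable. Qed.

Lemma continuous_integrable_ball (f : vec -> R) : continuous f ->
  mu.-integrable uball (EFin \o f).
Proof.
move=> cf; have [C _ fC] := continuous_bounded_ball cf.
exact: bounded_integrable_ball (continuous_measurable_ball cf) fC.
Qed.

Lemma continuous_L1loc (f : vec -> R) : continuous f -> L1loc f.
Proof.
move=> cf; split; first exact: continuous_measurable_ball.
move=> K cK KB; apply: integrableS (continuous_integrable_ball cf) => //.
- exact: measurable_uball.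
- by apply: closed_rV_measurable; apply: compact_closed => //; exact: norm_hausdorff.
Qed.

Lemma test_fun_smooth (phi : vec -> R) k : test_fun phi -> CkV k phi.
Proof. by case=> /smoothP. Qed.

Lemma test_fun_out (phi : vec -> R) x : test_fun phi -> ~ uball x -> phi x = 0.
Proof.
move=> [_ _ h] Bx; apply: contrapT => /eqP p0; apply: Bx; apply: h.
exact: subset_closure.
Qed.

Lemma test_fun_partial_out (phi : vec -> R) i x : test_fun phi -> ~ uball x ->
  'D_(e i) phi x = 0.
Proof.
move=> [_ _ h] Bx.
have d0 : is_derive x (e i) phi 0.
  apply: (@near_eq_is_derive _ _ _ (fun=> 0)).
  near=> y; apply/esym/eqP/negP => /negP p0.
  have : (~` closure [set x | phi x != 0]) y.
    near: y; apply: open_nbhs_nbhs; split; last by move=> /h.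
    by apply: closed_openC; exact: closed_closure.
  by apply; exact: subset_closure.
by have [] := d0.
Unshelve. all: by end_near. Qed.

(** Vanishing off some compact subset is easier to check than compactness of the
closure of the support. *)
Lemma supported_test_fun (phi : vec -> R) (K : set vec) :
  (forall k, CkV k phi) -> compact K -> K `<=` uball ->
  (forall x, ~ K x -> phi x = 0) -> test_fun phi.
Proof.
move=> sphi cK KB phi0.
have clK : closure [set x | phi x != 0] `<=` K.
  rewrite [X in _ `<=` X]((closure_id _).1 _).
    apply: closureS => x /= /eqP p0; apply: contrapT => Kx.
    by apply: p0; exact: phi0.
  by apply: compact_closed => //; exact: norm_hausdorff.
split; first exact/smoothP.
- by apply: subclosed_compact cK clK; exact: closed_closure.
- by apply: subset_trans KB.
Qed.

Lemma integral_ball_partial_eq0 (f : vec -> R) i : CkV 1 f ->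
  (forall x, ~ uball x -> f x = 0) ->
  (forall x, ~ uball x -> 'D_(e i) f x = 0) ->
  (\int[mu]_(x in uball) ('D_(e i) f x)%:E = 0)%E.
Proof.
move=> Cf f0 df0; rewrite -[RHS](@integral_partial_eq0 _ _ 1 f i ler01 Cf).
  rewrite integral_mkcond; apply: eq_integral => x _; rewrite patchE.
  by case: ifPn => //; rewrite notin_setE => /df0 ->.
by move=> x cx; apply: f0 => /uball_cube.
Qed.

(** The product vanishes off the ball together with its derivative, so that it may
be integrated over the whole space, where no boundary term appears. *)
Lemma integration_by_parts_ball (u phi : vec -> R) i : CkV 1 u -> test_fun phi ->
  (\int[mu]_(x in uball) (u x * partial i phi x)%:E =
   - \int[mu]_(x in uball) ('D_(e i) u x * phi x)%:E)%E.
Proof.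
move=> Cu tphi; have Cphi := test_fun_smooth 1 tphi.
have cu := CkV_continuous Cu; have cphi := CkV_continuous Cphi.
have cdu := CkV_continuous (CkV_partial i Cu).
have cdphi := CkV_continuous (CkV_partial i Cphi).
pose F x := u x * phi x.
have dF x : is_derive x (e i) F (u x * 'D_(e i) phi x + phi x * 'D_(e i) u x).
  have du := CkV_derive i x Cu; have dphi := CkV_derive i x Cphi.
  exact: is_deriveM.
have DF x : 'D_(e i) F x = u x * 'D_(e i) phi x + 'D_(e i) u x * phi x.
  by have [_ ->] := dF x; rewrite (mulrC (phi x)).
have CF : CkV 1 F by exact: CkM.
have F0 x : ~ uball x -> F x = 0 by move=> Bx; rewrite /F (test_fun_out tphi)// mulr0.
have dF0 x : ~ uball x -> 'D_(e i) F x = 0.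
  move=> Bx; rewrite DF (test_fun_out tphi)// mulr0 (test_fun_partial_out _ tphi)//.
  by rewrite mulr0 addr0.
have := integral_ball_partial_eq0 CF F0 dF0.
under eq_integral do rewrite DF EFinD.
have i1 : mu.-integrable uball (EFin \o (fun x => u x * 'D_(e i) phi x)).
  by apply: continuous_integrable_ball; exact: continuous_mul.
have i2 : mu.-integrable uball (EFin \o (fun x => 'D_(e i) u x * phi x)).
  by apply: continuous_integrable_ball; exact: continuous_mul.
rewrite integralD//; last exact: measurable_uball.
have /fineK := integrable_fin_num measurable_uball i1.
have /fineK := integrable_fin_num measurable_uball i2.
move=> /= <- <- [] /eqP; rewrite addr_eq0 => /eqP h.
by rewrite /partial h EFinN.
Qed.

Definition grad (u : vec -> R) (x : vec) : vec := \row_i 'D_(e i) u x.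

Lemma weak_grad_C1 (u : vec -> R) : CkV 1 u -> is_weak_grad u (grad u).
Proof.
move=> Cu i; rewrite (_ : (fun x => grad u x ord0 i) = 'D_(e i) u); last first.
  by apply/funext => x; rewrite mxE.
split; first by apply: continuous_L1loc; exact: CkV_continuous (CkV_partial i Cu).
move=> phi tphi; rewrite integration_by_parts_ball//; congr (- _)%E.
by apply: eq_integral => x _; rewrite mxE.
Qed.

End weak_gradient.

(** * The fundamental lemma of the calculus of variations *)

(** Countably many boxes cover the ball, and on each of them the previous lemma
applies. *)
Section fundamental_lemma.
Context {R : realType} {N : nat}.
Local Notation vec := 'rV[R]_N.
Local Notation mu := (lebesgue_rV R N).
Implicit Types (a b c x : vec) (h : vec -> R).

(** Orthants form a generating family that is stable under intersection, and the
intersection of a box with an orthant is again a box. *)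
Definition orthant c : set vec := [set x | forall i, x ord0 i < c ord0 i].

Lemma measurable_orthant c : measurable (orthant c).
Proof.
rewrite (_ : orthant c = \bigcap_(i in [set: 'I_N])
    [set x : vec | `]-oo, c ord0 i[%classic (x ord0 i)]).
  apply: fin_bigcap_measurable => // i _; exact: measurable_coord_preimage.
apply/seteqP; split=> x /=.
  by move=> xc i _ /=; rewrite in_itv/=.
by move=> xc i; have := xc i I; rewrite /= in_itv/=.
Qed.

Lemma orthants_generate :
  @measurable _ vec = <<s [set orthant c | c in setT] >>.
Proof.
apply/seteqP; split=> [A mA|]; last first.
  apply: smallest_sub; first exact: sigma_algebra_measurable.
  by move=> _ [c _ <-]; exact: measurable_orthant.
pose T := g_sigma_algebraType [set orthant c | c in setT].
have : measurable_fun [set: T] (fun x : T => x : vec).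
  apply: measurable_fun_rVP => i.
  apply: (measurability _ (measurable_realfun.RGenInftyO.measurableE R)) => //.
  move=> _ [_ [r ->] <-]; rewrite setTI.
  (* a half-space is the union of the orthants whose other bounds grow *)
  rewrite (_ : _ @^-1` _ = \bigcup_k orthant (\row_j (if j == i then r else k%:R))).
    apply: bigcup_measurable => k _; apply: sub_sigma_algebra.
    by eexists.
  apply/seteqP; split=> x /=; last first.
    by move=> [k _ /(_ i)]; rewrite !mxE eqxx in_itv/=.
  rewrite in_itv/= => xr.
  have [k xk] : exists k : nat, forall j, `|x ord0 j| <= k%:R.
    exists (\max_j (Num.truncn `|x ord0 j|).+1)%N => j.
    apply: le_trans (ltW (truncnS_gt _)) _.
    by rewrite ler_nat (leq_bigmax_cond (F := fun j => (Num.truncn `|x ord0 j|).+1)).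
  exists k.+1 => //= j; rewrite !mxE; case: eqP => [->//|_].
  by rewrite (le_lt_trans (ler_norm _))// (le_lt_trans (xk j))// ltr_nat.
by move=> /(_ measurableT A mA); rewrite setTI.
Qed.

Lemma orthants_setI_closed : setI_closed [set orthant c | c in setT].
Proof.
move=> _ _ [c _ <-] [d _ <-]; exists (\row_i Num.min (c ord0 i) (d ord0 i)) => //.
apply/seteqP; split=> x /=.
  by move=> xcd; split=> i; have := xcd i; rewrite mxE lt_min => /andP[].
by move=> [xc xd] i; rewrite mxE lt_min xc xd.
Qed.

Definition box_bump a b (k : nat) : vec -> R :=
  fun x => \prod_i bump (a ord0 i) (b ord0 i) k (x ord0 i).

Lemma CkV_box_bump a b k n : CkV n (box_bump a b k).
Proof.
apply: Ck_prod => i; apply: Ck_comp; [exact: Ck1_bump|exact: CkV_coord].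
Qed.

Lemma box_bump_ge0 a b k x : 0 <= box_bump a b k x.
Proof. by apply: prodr_ge0 => i _; exact: bump_ge0. Qed.

Lemma box_bump_le1 a b k x : box_bump a b k x <= 1.
Proof. rewrite /box_bump; elim: (index_enum _) => [|i s ih]; first by rewrite big_nil.
rewrite big_cons mulr_ile1// ?bump_ge0 ?bump_le1//.
by apply: prodr_ge0 => j _; exact: bump_ge0. Qed.

Lemma box_bump_out a b k x : ~ obox a b x -> box_bump a b k x = 0.
Proof.
move=> /existsNP[i /negP h]; rewrite /box_bump (bigD1 i)//= bump0 ?mul0r//.
Qed.

Lemma cvg_box_bump a b x :
  box_bump a b k x @[k --> \oo] --> (\1_(obox a b) x : R).
Proof.
rewrite indicE; have [ab|ab] := pselect (obox a b x); last first.
  rewrite memNset//; under eq_fun do rewrite box_bump_out//.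
  exact: cvg_cst.
rewrite mem_set//.
have -> : (true%:R : R) = \prod_(i < N) (a ord0 i < x ord0 i < b ord0 i)%R%:R.
  by rewrite big1// => i _; rewrite ab.
rewrite /box_bump; elim: (index_enum _) => [|i s ih].
  by under eq_fun do rewrite big_nil; rewrite big_nil; exact: cvg_cst.
under eq_fun do rewrite big_cons.
by rewrite big_cons; apply: cvgM => //; exact: cvg_bump.
Qed.

Lemma box_bump_test_fun a b a' b' k : cbox a' b' `<=` uball ->
  obox a b `<=` cbox a' b' -> test_fun (box_bump a b k).
Proof.
move=> KB ab; apply: (@supported_test_fun _ _ _ (cbox a' b')) => //.
- by move=> n; exact: CkV_box_bump.
- exact: compact_cbox.
- by move=> x nK; apply: box_bump_out => /ab.
Qed.

Section orthogonal.
Variable h : vec -> R.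
Hypothesis Lh : L1loc h.
Hypothesis h0 : forall phi, test_fun phi ->
  (\int[mu]_(x in uball) (h x * phi x)%:E = 0)%E.
Variables a b : vec.
Hypothesis abB : cbox a b `<=` uball.

Let Q := obox a b.
Let mQ : measurable Q. Proof. exact: measurable_obox. Qed.
Let QB : Q `<=` uball. Proof. by move=> x /obox_cbox /abB. Qed.

Let intQ : mu.-integrable Q (EFin \o h).
Proof.
apply: (@integrableS _ _ _ _ (cbox a b)) => //.
- exact: measurable_cbox.
- exact: obox_cbox.
- by apply: Lh.2 => //; exact: compact_cbox.
Qed.

Let integral_orthant c : (\int[mu]_(x in Q `&` orthant c) (h x)%:E = 0)%E.
Proof.
(* the box Q cut by the orthant has upper corner b' *)
pose b' : vec := \row_i Num.min (b ord0 i) (c ord0 i).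
have QcE : Q `&` orthant c = obox a b'.
  apply/seteqP; split=> x.
    by move=> [xQ xc] i; rewrite mxE lt_min xc; have /andP[-> ->] := xQ i.
  by move=> xab; split=> i; have := xab i; rewrite mxE lt_min =>
    /and3P[h1 h2 h3]; rewrite ?h1 ?h2 ?h3.
have tk k : test_fun (box_bump a b' k).
  apply: (box_bump_test_fun k abB); rewrite -QcE => x [xQ _]; exact: obox_cbox.
have mh : measurable_fun Q h.
  by apply: measurable_funS Lh.1 => //; exact: measurable_uball.
have [//|||||_ _] := @dominated_convergence _ _ R mu Q mQ
  (fun k x => (h x * box_bump a b' k x)%:E) (fun x => (h x * \1_(obox a b') x)%:E)
  (fun x => `|h x|%:E).
- move=> k; apply/measurable_EFinP; apply: measurable_funM => //.
  apply: measurable_funTS; apply: continuous_rV_measurable.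
  exact: CkV_continuous (CkV_box_bump a b' k 0).
- apply/measurable_EFinP; apply: measurable_funM => //.
  by apply: measurable_funTS; apply: measurable_indic; exact: measurable_obox.
- apply: aeW => x _; apply: cvg_EFin; first by apply: nearW => k.
  by apply: cvgM; [exact: cvg_cst|exact: cvg_box_bump].
- exact: integrable_norm intQ.
- apply: aeW => x k _; rewrite lee_fin normrM ler_piMr//.
  by rewrite ger0_norm ?box_bump_ge0// box_bump_le1.
rewrite (_ : [sequence _]_n = cst 0%E); last first.
  apply/funext => k /=; rewrite -[RHS](h0 (tk k)).
  rewrite [LHS]integral_mkcond [RHS]integral_mkcond; apply: eq_integral => x _.
  rewrite !patchE; case: ifPn; case: ifPn => //; rewrite ?inE ?notin_setE.
    by move=> + /QB.
  move=> _ nQ; rewrite box_bump_out ?mulr0// -QcE => -[]//.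
move=> /(cvg_lim (@ereal_hausdorff R)); rewrite lim_cst// => /esym.
rewrite QcE => <-; rewrite [LHS]integral_mkcond [RHS]integral_mkcond.
apply: eq_integral => x _; rewrite !patchE indicE.
have [xo|xo] := boolP (x \in obox a b').
  have xQ : x \in Q by move: xo; rewrite !inE -QcE => -[].
  by rewrite xQ mulr1.
by rewrite mulr0; case: ifP.
Qed.

Let integral_Q A : measurable A -> (\int[mu]_(x in Q `&` A) (h x)%:E = 0)%E.
Proof.
rewrite orthants_generate.
have QT : (\int[mu]_(x in Q) (h x)%:E = 0)%E.
  rewrite -[RHS](integral_orthant b); congr (integral _ _ _).
  by apply/esym/setIidl => x xQ i; have /andP[] := xQ i.
pose P S := (\int[mu]_(x in Q `&` S) (h x)%:E = 0)%E.
apply: (@dynkin_induction _ vec _ P orthants_generate orthants_setI_closed).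
- by rewrite /P setIT.
- by move=> _ [c _ <-]; exact: integral_orthant.
- move=> S mS IS; rewrite /P.
  have QE : Q = (Q `&` S) `|` (Q `&` ~` S) by rewrite -setIUr setUv setIT.
  have mQS : measurable (Q `&` S) by exact: measurableI.
  have mQSC : measurable (Q `&` ~` S).
    by apply: measurableI => //; exact: measurableC.
  move: QT; rewrite {1}QE integral_setU//.
  + by move: IS; rewrite /P => ->; rewrite add0e.
  + by rewrite -QE; have /integrableP[] := intQ.
  + rewrite disj_set2E; apply/eqP/seteqP; split=> x //.
    by move=> [[_ ?] [_ ?]].
- move=> F mF tF IF; rewrite /P setI_bigcupr integral_bigcup//.
  + by rewrite eseries0// => k _ _; exact: IF.
  + exact: trivIset_setIl.
  + by move=> k; exact: measurableI.
  + apply: integrableS intQ => //.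
      by apply: bigcup_measurable => k _; exact: measurableI.
    by move=> x [k _ []].
Qed.

(** Products of bumps converge to indicators of boxes, so the integral of [h] over
the trace on [Q] of every orthant is [0]; a Dynkin argument extends this to all
measurable subsets of [Q]. *)
Lemma orthogonal_box : {ae mu, forall x, obox a b x -> h x = 0}.
Proof.
have : ae_eq mu Q (EFin \o h) (cst 0%E).
  apply: integral_ae_eq => // E EQ mE.
  rewrite [RHS]integral_cst// mul0e -[RHS](integral_Q mE); congr (integral _ _ _).
  by rewrite setIidr.
by apply: filterS => x hx /hx[].
Qed.

End orthogonal.

Lemma fundamental_lemma h : L1loc h ->
  (forall phi, test_fun phi -> (\int[mu]_(x in uball) (h x * phi x)%:E = 0)%E) ->
  {ae mu, forall x, uball x -> h x = 0}.
Proof.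
move=> Lh h0.
pose lo (kz : nat * 'rV[int]_N) : vec := grid kz.1 kz.2 (-1).
pose hi (kz : nat * 'rV[int]_N) : vec := grid kz.1 kz.2 1.
pose bad kz := [set x | cbox (lo kz) (hi kz) `<=` uball /\
   ~ (obox (lo kz) (hi kz) x -> h x = 0)].
have nbad kz : mu.-negligible (bad kz).
  have [s|s] := pselect (cbox (lo kz) (hi kz) `<=` uball).
    by apply: negligibleS (orthogonal_box Lh h0 s) => x [_].
  by apply: negligibleS (negligible_set0 mu) => x [].
have : mu.-negligible (\bigcup_n oapp bad set0 (unpickle n)).
  apply: negligible_bigcup => n.
  by case: (unpickle n) => [kz|] /=; [exact: nbad|exact: negligible_set0].
apply: negligibleS => x /= /not_implyP[Bx hx].
have [kz [xo KB]] := open_boxes open_uball Bx.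
exists (pickle kz) => //; rewrite pickleK /=; split => //.
by move=> /(_ xo).
Qed.

End fundamental_lemma.

(** * Uniqueness of weak gradients *)

Section weak_gradient_unique.
Context {R : realType} {N : nat}.
Local Notation vec := 'rV[R]_N.
Local Notation mu := (lebesgue_rV R N).
Implicit Types (u phi : vec -> R) (g : vec -> vec).

Lemma CkV_cst k (c : R) : CkV k (fun _ : vec => c).
Proof. exact: Ck_cst. Qed.

Lemma L1loc_mul_test_fun f phi : L1loc f -> test_fun phi ->
  mu.-integrable uball (EFin \o (fun x => f x * phi x)).
Proof.
move=> [mf lf] tphi; have [_ cK KB] := tphi.
set K := closure _ in cK KB.
have mK : measurable K.
  by apply: closed_rV_measurable; exact: closed_closure.
have cphi := CkV_continuous (test_fun_smooth 0 tphi).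
have [C C0 phiC] := continuous_bounded_ball cphi.
have mB := @measurable_uball R N.
have intK : mu.-integrable uball ((fun x => C%:E * (f x)%:E)%E \_ K).
  apply/(integrable_restrict mu mK mB); rewrite setIidr//.
  by apply: integrableZl => //; exact: lf.
apply: le_integrable intK => //.
  apply/measurable_EFinP; apply: measurable_funM => //.
  exact: continuous_measurable_ball.
move=> x Bx; rewrite patchE /=; case: ifPn => [|] xK.
  rewrite -EFinM lee_fin !normrM mulrC ler_wpM2r// (ger0_norm (ltW C0)).
  exact: phiC.
rewrite (_ : phi x = 0) ?mulr0//; apply: contrapT => /eqP p0.
by move: xK; rewrite notin_setE; apply; exact: subset_closure.
Qed.

Lemma L1locB (f1 f2 : vec -> R) : L1loc f1 -> L1loc f2 ->
  L1loc (fun x => f1 x - f2 x).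
Proof.
move=> [mf lf] [mg lg]; split; first exact: measurable_funB.
move=> K cK KB.
rewrite (_ : _ \o _ = (EFin \o f1) \- (EFin \o f2))%E//.
apply: integrableB => //; [|exact: lf|exact: lg].
by apply: closed_rV_measurable; apply: compact_closed => //; exact: norm_hausdorff.
Qed.

Lemma weak_grad_unique u g g' : is_weak_grad u g -> is_weak_grad u g' ->
  {ae mu, forall x, uball x -> g x = g' x}.
Proof.
move=> ug ug'.
have h i : {ae mu, forall x, uball x -> g x ord0 i - g' x ord0 i = 0}.
  have [Lg gu] := ug i; have [Lg' gu'] := ug' i.
  apply: fundamental_lemma => [|phi tphi]; first exact: L1locB.
  under eq_integral do rewrite mulrBl EFinB.
  have i1 := L1loc_mul_test_fun Lg tphi.
  have i2 := L1loc_mul_test_fun Lg' tphi.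
  rewrite integralB//; last exact: measurable_uball.
  have := gu phi tphi; rewrite gu'// => /(congr1 oppe); rewrite !oppeK => <-.
  rewrite subee//; exact: (integrable_fin_num measurable_uball i2).
have : {ae mu, forall x, forall i, uball x -> g x ord0 i - g' x ord0 i = 0}.
  exact: filter_forall.
apply: filterS => x hx Bx.
by apply/rowP => i; apply/eqP; rewrite -subr_eq0; apply/eqP; exact: hx.
Qed.

Lemma wgradP u g : is_weak_grad u g -> is_weak_grad u (wgrad u).
Proof. by move=> ug; apply: (@xgetPex _ (cst 0) (is_weak_grad u)); exists g. Qed.

Lemma wgrad_unique u g : is_weak_grad u g ->
  {ae mu, forall x, uball x -> wgrad u x = g x}.
Proof. by move=> ug; apply: weak_grad_unique => //; exact: wgradP ug. Qed.

Lemma wgrad_C1 u : CkV 1 u ->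
  {ae mu, forall x, uball x -> wgrad u x = grad u x}.
Proof. by move=> Cu; apply: wgrad_unique; exact: weak_grad_C1. Qed.

Lemma grad_cst (c : R) (x : vec) : grad (fun=> c) x = 0.
Proof.
apply/rowP => i; rewrite !mxE.
by have [_] := is_derive_cst c x (delta_mx ord0 i : vec).
Qed.

(** Weak gradients see only the class of [u]; in particular a weak gradient of an
almost everywhere constant function exists and is unique. *)
Lemma wgrad_ae_const u (c : R) : measurable_fun uball u -> ae_const u c ->
  {ae mu, forall x, uball x -> wgrad u x = 0}.
Proof.
move=> mu_ uc; have Cc : CkV 1 (fun _ : vec => c) by exact: CkV_cst.
have wc := weak_grad_C1 Cc.
have : is_weak_grad u (fun=> 0 : vec).
  move=> i; have [L h] := wc i; split.
    by move: L; congr L1loc; apply/funext => x; rewrite grad_cst.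
  move=> phi tphi.
  have -> : (\int[mu]_(x in uball) ((fun=> 0 : vec) x ord0 i * phi x)%:E =
     \int[mu]_(x in uball) (grad (fun=> c) x ord0 i * phi x)%:E)%E.
    by apply: eq_integral => x _; rewrite grad_cst.
  rewrite -h//; apply: ae_eq_integral => //.
  - exact: measurable_uball.
  - apply/measurable_EFinP; apply: measurable_funM => //.
    apply: continuous_measurable_ball; apply: CkV_continuous.
    exact: CkV_partial (test_fun_smooth 1 tphi).
  - apply/measurable_EFinP; apply: measurable_funM => //.
    apply: continuous_measurable_ball; apply: CkV_continuous.
    exact: CkV_partial (test_fun_smooth 1 tphi).
  - by apply: filterS uc => x ux Bx; rewrite ux.
exact: wgrad_unique.
Qed.

Lemma continuous_dot_grad u v : CkV 1 u -> CkV 1 v ->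
  continuous (fun x => dot (grad u x) (grad v x)).
Proof.
move=> Cu Cv; apply: continuous_sum => i; apply: continuous_mul.
  under eq_fun do rewrite mxE; exact: CkV_continuous (CkV_partial i Cu).
under eq_fun do rewrite mxE; exact: CkV_continuous (CkV_partial i Cv).
Qed.

Lemma continuous_enorm_grad u : CkV 1 u -> continuous (fun x => enorm (grad u x)).
Proof.
move=> Cu x; have cd := @continuous_dot_grad _ _ Cu Cu x.
exact: (continuous_comp cd (@sqrt_continuous R _)).
Qed.

Lemma measurable_powR_ball (f : vec -> R) p : continuous f ->
  measurable_fun uball (fun x => f x `^ p).
Proof.
move=> cf; apply: (measurableT_comp (measurable_powR p)) => //.
exact: continuous_measurable_ball.
Qed.

Lemma integrable_powR_ball (f : vec -> R) p : 0 <= p -> continuous f ->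
  (forall x, uball x -> 0 <= f x) ->
  mu.-integrable uball (EFin \o (fun x => f x `^ p)).
Proof.
move=> p0 cf f0; have [C C0 fC] := continuous_bounded_ball cf.
apply: (@bounded_integrable_ball _ _ (C `^ p)); first exact: measurable_powR_ball.
move=> x Bx; rewrite ger0_norm ?powR_ge0// ge0_ler_powR// ?nnegrE ?f0//; first exact: ltW.
by rewrite -[f x]ger0_norm ?f0// fC.
Qed.

Lemma sobolev_C1 p u : 0 <= p -> CkV 1 u -> sobolev p u.
Proof.
move=> p0 Cu; have cu := CkV_continuous Cu.
have lt f : mu.-integrable uball (EFin \o f) ->
    (\int[mu]_(x in uball) (f x)%:E < +oo)%E.
  move=> /(integrable_fin_num measurable_uball) /fineK /= <-; exact: ltry.
split.
- exact: continuous_measurable_ball.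
- apply/lt/integrable_powR_ball => //.
  by move=> x; apply: continuous_comp; [exact: cu|exact: norm_continuous].
- exists (grad u); split; first exact: weak_grad_C1.
  apply/lt/integrable_powR_ball => //; first exact: continuous_enorm_grad.
  by move=> x _; exact: enorm_ge0.
Qed.

End weak_gradient_unique.

(** * Integrals over the ball *)

Section ball_integral.
Context {R : realType} {N : nat}.
Local Notation vec := 'rV[R]_N.
Local Notation mu := (lebesgue_rV R N).
Implicit Types (f g : vec -> R).

(** Integrals over the ball are handled as real numbers, with integrability as a
side condition; the extended-real integrals of the definitions are related to
them by [bintE]. *)
Definition bint f : R := (\int[mu]_(x in uball) f x)%R.
Definition bintegrable f := mu.-integrable uball (EFin \o f).
Definition vol : R := bint (fun=> 1).

Lemma bintE f : bintegrable f ->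
  (\int[mu]_(x in uball) (f x)%:E = (bint f)%:E)%E.
Proof.
by move=> fi; rewrite /bint /Rintegral fineK//; exact: (integrable_fin_num measurable_uball fi).
Qed.

Lemma eq_bint f g : (forall x, uball x -> f x = g x) -> bint f = bint g.
Proof. by move=> fg; apply: eq_Rintegral => x /set_mem; exact: fg. Qed.

Lemma ae_eq_bint f g : measurable_fun uball f -> measurable_fun uball g ->
  {ae mu, forall x, uball x -> f x = g x} -> bint f = bint g.
Proof.
move=> mf mg fg; rewrite /bint /Rintegral; congr fine; apply: ae_eq_integral => //.
- exact: measurable_uball.
- exact/measurable_EFinP.
- exact/measurable_EFinP.
- by apply: filterS fg => x fgx Bx; rewrite fgx.
Qed.

Lemma continuous_bintegrable f : continuous f -> bintegrable f.
Proof. exact: continuous_integrable_ball. Qed.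

Lemma bintD f g : bintegrable f -> bintegrable g ->
  bint (fun x => f x + g x) = bint f + bint g.
Proof. by move=> fi gi; apply: RintegralD => //; exact: measurable_uball. Qed.

Lemma bintB f g : bintegrable f -> bintegrable g ->
  bint (fun x => f x - g x) = bint f - bint g.
Proof. by move=> fi gi; apply: RintegralB => //; exact: measurable_uball. Qed.

Lemma bintZ (k : R) f : bintegrable f -> bint (fun x => k * f x) = k * bint f.
Proof. by move=> fi; apply: RintegralZl => //; exact: measurable_uball. Qed.

Lemma bintegrableD f g : bintegrable f -> bintegrable g ->
  bintegrable (fun x => f x + g x).
Proof. move=> fi gi; exact: (integrableD measurable_uball fi gi). Qed.

Lemma bintegrableB f g : bintegrable f -> bintegrable g ->
  bintegrable (fun x => f x - g x).
Proof. move=> fi gi; exact: (integrableB measurable_uball fi gi). Qed.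

Lemma bintegrableZ k f : bintegrable f -> bintegrable (fun x => k * f x).
Proof. move=> fi; exact: (integrableZl measurable_uball k fi). Qed.

Lemma bintegrable_sum (I : Type) (s : seq I) (f : I -> vec -> R) :
  (forall i, bintegrable (f i)) -> bintegrable (fun x => \sum_(i <- s) f i x).
Proof.
move=> fi; elim: s => [|i s ih].
  under eq_fun do rewrite big_nil.
  by apply: continuous_bintegrable; exact: cst_continuous.
by under eq_fun do rewrite big_cons; exact: bintegrableD.
Qed.

Lemma bint_cst c : bint (fun=> c) = c * vol.
Proof.
rewrite -bintZ; last by apply: continuous_bintegrable; exact: cst_continuous.
by apply: eq_bint => x _; rewrite mulr1.
Qed.

Lemma bint_sum (I : Type) (s : seq I) (f : I -> vec -> R) :
  (forall i, bintegrable (f i)) ->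
  bint (fun x => \sum_(i <- s) f i x) = \sum_(i <- s) bint (f i).
Proof.
move=> fi; elim: s => [|i s ih].
  by under eq_fun do rewrite big_nil; rewrite big_nil bint_cst mul0r.
under eq_fun do rewrite big_cons.
by rewrite bintD ?big_cons ?ih//; exact: bintegrable_sum.
Qed.

Lemma bint_ge0 f : (forall x, uball x -> 0 <= f x) -> 0 <= bint f.
Proof. by move=> f0; apply: Rintegral_ge0. Qed.

Lemma le_bint f g : bintegrable f -> bintegrable g ->
  (forall x, uball x -> f x <= g x) -> bint f <= bint g.
Proof.
move=> fi gi fg; rewrite -subr_ge0 -bintB//; apply: bint_ge0 => x Bx.
by rewrite subr_ge0 fg.
Qed.

Lemma vol_measure : mu uball = vol%:E.
Proof.
rewrite /vol -bintE; last by apply: continuous_bintegrable; exact: cst_continuous.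
by rewrite integral_cst ?mul1e//; exact: measurable_uball.
Qed.

Lemma vol_gt0 : 0 < vol.
Proof. by rewrite -lte_fin -vol_measure; exact: uball_gt0. Qed.

Lemma bintegrable_le f g : measurable_fun uball f -> bintegrable g ->
  (forall x, uball x -> `|f x| <= g x) -> bintegrable f.
Proof.
move=> mf gi fg; apply: le_integrable gi => //.
- exact: measurable_uball.
- exact/measurable_EFinP.
- by move=> x Bx; rewrite /= lee_fin (le_trans (fg x Bx))// ler_norm.
Qed.

(** Measurability of [f] is not implied by that of its square. *)
Definition L2 f := measurable_fun uball f /\ bintegrable (fun x => f x ^+ 2).

Lemma L2_mul f g : L2 f -> L2 g -> bintegrable (fun x => f x * g x).
Proof.
move=> [mf fi] [mg gi].
apply: (@bintegrable_le _ (fun x => f x ^+ 2 + g x ^+ 2)).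
- exact: measurable_funM.
- exact: bintegrableD.
- move=> x _; rewrite normrM -(real_normK (num_real (f x))) -(real_normK (num_real (g x))).
  have := sqr_ge0 (`|f x| - `|g x|); have := normr_ge0 (f x); have := normr_ge0 (g x).
  by nra.
Qed.

Lemma L2_continuous f : continuous f -> L2 f.
Proof.
move=> cf; split; first exact: continuous_measurable_ball.
by apply: continuous_bintegrable; exact: continuous_mul.
Qed.

Lemma L2_bintegrable f : L2 f -> bintegrable f.
Proof.
move=> fi; have := L2_mul fi (L2_continuous (@cst_continuous _ _ (1 : R))).
by under eq_fun do rewrite mulr1.
Qed.

Lemma L2D f g : L2 f -> L2 g -> L2 (fun x => f x + g x).
Proof.
move=> Lf Lg; have [mf fi] := Lf; have [mg gi] := Lg.
split; first exact: measurable_funD.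
under eq_fun do rewrite sqrrD.
apply: bintegrableD => //; apply: bintegrableD => //.
under eq_fun do rewrite -mulr_natl.
by apply: bintegrableZ; exact: L2_mul.
Qed.

Lemma L2Z k f : L2 f -> L2 (fun x => k * f x).
Proof.
move=> [mf fi]; split; first exact: measurable_funM.
by under eq_fun do rewrite exprMn; exact: bintegrableZ.
Qed.

Lemma L2B f g : L2 f -> L2 g -> L2 (fun x => f x - g x).
Proof.
move=> Lf /(L2Z (-1)) Lg; have := L2D Lf Lg.
by under eq_fun do rewrite mulN1r.
Qed.

Lemma bint_sqr_eq0 f : L2 f -> bint (fun x => f x ^+ 2) = 0 -> ae_const f 0.
Proof.
move=> [mf fi] f0.
have : (\int[mu]_(x in uball) (`|((f x) ^+ 2)%:E|) = 0)%E.
  under eq_integral do rewrite abse_EFin ger0_norm ?sqr_ge0//.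
  by rewrite bintE// f0.
have mf2 : measurable_fun uball (fun x => (f x ^+ 2)%:E).
  by have /integrableP[] := fi.
move=> /(ae_eq_integral_abs _ measurable_uball mf2).
by apply: filterS => x fx Bx; have [/eqP] := fx Bx; rewrite sqrf_eq0 => /eqP.
Qed.

End ball_integral.

(** * Radial functions and radial vector fields *)

Lemma Ck1_partial (R : realType) n (f : R -> R) : Ck1 n.+1 f -> Ck1 n ('D_1 f).
Proof. exact: (Ck_partial tt). Qed.

Section radial_fields.
Context {R : realType} {N : nat}.
Local Notation vec := 'rV[R]_N.
Local Notation mu := (lebesgue_rV R N).
Local Notation e i := (delta_mx ord0 i : vec).
Implicit Types (x : vec) (F V : R -> R).

Lemma is_derive_nsq i x : is_derive x (e i) (nsq : vec -> R) (2 * x ord0 i).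
Proof.
pose h j : vec -> R := fun y => y ord0 j * y ord0 j.
have -> : (nsq : vec -> R) = \sum_(j < N) h j.
  by apply/funext => y; rewrite fct_sumE.
have dh j : is_derive x (e i) (h j) (2 * x ord0 j * (i == j)%:R).
  have dc := is_derive_coord j i x.
  have := @is_deriveM _ _ _ _ _ _ _ _ dc dc.
  by rewrite /GRing.scale/= -mulrA mulr_natl mulr2n.
have := is_derive_sum dh; congr is_derive.
rewrite (bigD1 i)//= eqxx mulr1 big1 ?addr0// => j /negbTE.
by rewrite eq_sym => ->; rewrite mulr0.
Qed.

Lemma is_derive_radial F i x dF : is_derive (nsq x) (1 : R) F dF ->
  is_derive x (e i) (fun y => F (nsq y)) (dF * (2 * x ord0 i)).
Proof. by move=> dF_; apply: is_derive_comp => //; exact: is_derive_nsq. Qed.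

Lemma CkV_radial k F : Ck1 k F -> CkV k (fun x => F (nsq x)).
Proof. by move=> CF; apply: Ck_comp => //; exact: CkV_nsq. Qed.

Lemma grad_radial F x i : Ck1 1 F ->
  grad (fun y => F (nsq y)) x ord0 i = 'D_1 F (nsq x) * (2 * x ord0 i).
Proof.
move=> CF; rewrite mxE.
by have [_] := is_derive_radial i (Ck1_derive (nsq x) CF).
Qed.

Lemma nsq_grad_radial F x : Ck1 1 F ->
  nsq (grad (fun y => F (nsq y)) x) = 4 * nsq x * ('D_1 F (nsq x)) ^+ 2.
Proof.
move=> CF; rewrite /nsq /dot.
under eq_bigr do rewrite grad_radial//.
rewrite -/(dot x x) -/(nsq x).
rewrite -mulrA mulrCA mulr_suml -/(nsq _); apply/esym.
by apply: eq_bigr => i _; ring.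
Qed.

Definition radial_field (psi : R -> R) i x : R := x ord0 i * psi (nsq x).

Lemma is_derive_radial_field psi i x : Ck1 1 psi ->
  is_derive x (e i) (radial_field psi i)
    (psi (nsq x) + 2 * x ord0 i ^+ 2 * 'D_1 psi (nsq x)).
Proof.
move=> Cpsi.
have dc := is_derive_coord i i x.
have dp := is_derive_radial i (Ck1_derive (nsq x) Cpsi).
have := @is_deriveM _ _ _ _ _ _ _ _ dc dp; congr is_derive.
by rewrite eqxx /GRing.scale/=; ring.
Qed.

(** In terms of [s = |x|^2], the divergence of [psi(s) x] is
[N psi(s) + 2 s psi'(s)]. *)
Lemma div_radial_field psi x : Ck1 1 psi ->
  \sum_i 'D_(e i) (radial_field psi i) x =
  N%:R * psi (nsq x) + 2 * nsq x * 'D_1 psi (nsq x).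
Proof.
move=> Cpsi.
have D i : 'D_(e i) (radial_field psi i) x =
    psi (nsq x) + 2 * 'D_1 psi (nsq x) * (x ord0 i * x ord0 i).
  by have [_ ->] := is_derive_radial_field i x Cpsi; ring.
under eq_bigr do rewrite D.
rewrite big_split/= sumr_const card_ord -mulr_sumr -[\sum_i _]/(nsq x).
by rewrite mulr_natl; congr (_ + _); ring.
Qed.

(** The support avoids the origin and the sphere, which is where radial powers and
the boundary condition could cause trouble. *)
Lemma radial_field_test_fun psi i a b : 0 < a -> b < 1 ->
  (forall k, Ck1 k psi) -> (forall s, ~~ (a <= s <= b) -> psi s = 0) ->
  test_fun (radial_field psi i).
Proof.
move=> a0 b1 Cpsi psi0.
pose K : set vec := nsq @^-1` `[a, b]%classic.
have KB : K `<=` uball.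
  move=> x; rewrite /K /= in_itv/= => /andP[_ xb]; apply/uballE.
  exact: le_lt_trans b1.
apply: (@supported_test_fun _ _ _ K) => //.
- by move=> k; apply: CkM; [exact: CkV_coord|exact: CkV_radial].
- apply: (subclosed_compact _ (@compact_cube R N 1)).
    by apply: closed_comp => [x _|]; [exact: continuous_nsq|exact: interval_closed].
  by move=> x /KB/uball_cube.
- move=> x xK; rewrite /radial_field psi0 ?mulr0//.
  by apply/negP => h; apply: xK; rewrite /K /= in_itv.
Qed.

End radial_fields.

Lemma Ck1_primitive (R : realType) (E g : R -> R) :
  (forall k, Ck1 k g) -> (forall s, is_derive s (1 : R) E (g s)) ->
  forall k, Ck1 k E.
Proof.
move=> Cg dE [|k]; last exact: Ck1S dE.
exact: Ck_continuous (Ck1S (Cg 0%N) dE).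
Qed.

Lemma is_derive1_eq (R : realType) (f df : R -> R) (a b : R) : a <= b ->
  (forall s, a <= s <= b -> is_derive s (1 : R) f (df s)) ->
  (forall s, a <= s <= b -> df s = 0) -> f a = f b.
Proof.
move=> ab fdf df0; move: ab; rewrite le_eqVlt => /predU1P[->//|ab].
have cf : {within `[a, b], continuous f}.
  apply: derivable_within_continuous => x; rewrite in_itv/= => xab.
  by have [] := fdf _ xab.
have [|c] := @MVT R f df a b ab _ cf.
  move=> x; rewrite in_itv/= => /andP[ax xb]; apply: fdf; by rewrite !ltW.
rewrite in_itv/= => /andP[ac cb] /eqP.
by rewrite df0 ?mul0r ?subr_eq0 ?ltW// => /eqP.
Qed.

(** * From monotone to arbitrary radial functions in the Poincare inequality *)

(** Let [V' = |F'|].  Then [V] is nondecreasing with the same Dirichlet integral as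
[F], while [|F s - F t| <= |V s - V t|].  By the intermediate value theorem [V]
takes its mean at some [z], and [F z] is the constant to subtract from [F]: this
avoids comparing the means of [F] and [V]. *)
Section radial_poincare.
Context {R : realType} {N : nat}.
Local Notation vec := 'rV[R]_N.
Local Notation mu := (lebesgue_rV R N).
Local Notation "F \@ 'r'" := (fun x : vec => F (nsq x)) (at level 40).
Implicit Types (x : vec) (F V : R -> R).

Definition dirichlet (u : vec -> R) : R := bint (fun x => nsq (grad u x)).

Lemma Ck1_continuous k F : Ck1 k F -> continuous F.
Proof. exact: Ck_continuous. Qed.

Lemma continuous_radial F : continuous F -> continuous (F \@ r).
Proof.
by move=> cF x; apply: continuous_comp; [exact: continuous_nsq|exact: cF].
Qed.

Lemma nsq_uball x : uball x -> 0 <= nsq x <= 1.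
Proof. by move=> /uballE/ltW ->; rewrite nsq_ge0. Qed.

Lemma monotone_of_derive_ge0 F (dF : R -> R) : (forall s, is_derive s (1 : R) F (dF s)) ->
  (forall s, 0 <= dF s) -> forall s t, s <= t -> F s <= F t.
Proof.
move=> FdF dF0 s t; rewrite le_eqVlt => /predU1P[->//|st].
have cf : {within `[s, t], continuous F}.
  by apply: derivable_within_continuous => x _; have [] := FdF x.
have [c _ /eqP] := @MVT R F dF s t st (fun y _ => FdF y) cf.
by rewrite subr_eq => /eqP ->; rewrite lerDr mulr_ge0// subr_ge0 ltW.
Qed.

Variable kappa : R.
Hypothesis kappa_ge0 : 0 <= kappa.
Hypothesis poincare : forall V, Ck1 1 V -> {homo V : s t / s <= t} ->
  bint (V \@ r) = 0 ->
  kappa * bint (fun x => V (nsq x) ^+ 2) <= dirichlet (V \@ r).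

Lemma radial_poincare F : Ck1 1 F -> (forall s, s <= 0 -> 'D_1 F s = 0) ->
  exists c, kappa * bint (fun x => (F (nsq x) - c) ^+ 2) <= dirichlet (F \@ r).
Proof.
move=> CF dF0; have cdF : continuous ('D_1 F) := Ck1_partial CF.
have cn : continuous (fun s => `|'D_1 F s|).
  by move=> s; exact: (continuous_comp (cdF s) (@norm_continuous _ _ _)).
have [V [dV V0]] : exists G : R -> R, (forall s, is_derive s (1 : R) G `|'D_1 F s|) /\
    (forall s, s <= 0 -> G s = 0).
  by apply: primitive => // s s0; rewrite dF0// normr0.
have CV : Ck1 1 V by exact: (Ck1S (n := 0) cn dV).
have cV := Ck1_continuous CV; have cF := Ck1_continuous CF.
have dVE s : 'D_1 V s = `|'D_1 F s| by have [_] := dV s.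
pose m := bint (V \@ r) / @vol R N.
have v0 := @vol_gt0 R N.
have Vmono : {homo V : s t / s <= t}.
  by move=> s t; apply: (monotone_of_derive_ge0 dV) => u; exact: normr_ge0.
have FVmono s t : s <= t -> `|F t - F s| <= V t - V s.
  move=> st.
  (* V + F and V - F are both nondecreasing *)
  have h1 : forall u, is_derive u (1 : R) (fun u => V u + F u) (`|'D_1 F u| + 'D_1 F u).
    by move=> u; have dF := Ck1_derive u CF; exact: is_deriveD.
  have h2 : forall u, is_derive u (1 : R) (fun u => V u - F u) (`|'D_1 F u| - 'D_1 F u).
    by move=> u; have dF := Ck1_derive u CF; exact: is_deriveB.
  have p1 u : 0 <= `|'D_1 F u| + 'D_1 F u.
    by have := ler_norm (- 'D_1 F u); rewrite normrN; lra.
  have p2 u : 0 <= `|'D_1 F u| - 'D_1 F u by rewrite subr_ge0 ler_norm.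
  have := monotone_of_derive_ge0 h1 p1 st; have := monotone_of_derive_ge0 h2 p2 st.
  by rewrite ler_norml /=; lra.
have iV : bintegrable (V \@ r) by apply: continuous_bintegrable; exact: continuous_radial.
have ic (c : R) : bintegrable (fun _ : vec => c).
  by apply: continuous_bintegrable; exact: cst_continuous.
have [z z01 Vz] : exists2 z, z \in `[0, 1] & V z = m.
  apply: IVT => //; first exact: continuous_subspaceT.
  rewrite minEle maxEle Vmono// /m ler_pdivlMr// ler_pdivrMr//.
  rewrite -!bint_cst; apply/andP; split; apply: le_bint => // x Bx;
    by apply: Vmono; have /andP[] := nsq_uball Bx.
exists (F z).
pose W s := V s - m.
have CW : Ck1 1 W by exact: (CkB CV (Ck_cst (fun _ : unit => 1 : R) 1 m)).
have hW : kappa * bint (fun x => W (nsq x) ^+ 2) <= dirichlet (W \@ r).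
  apply: poincare => //; first by move=> s t st; rewrite lerD2r Vmono.
  by rewrite bintB// bint_cst /m divfK ?subrr// gt_eqF.
have -> : dirichlet (F \@ r) = dirichlet (W \@ r).
  apply: eq_bint => x _; rewrite !nsq_grad_radial//; congr (_ * _).
  have [_ ->] : is_derive (nsq x) (1 : R) W (`|'D_1 F (nsq x)| - 0).
    by apply: is_deriveB.
  by rewrite subr0 real_normK ?num_real.
apply: le_trans hW; rewrite ler_wpM2l//; apply: le_bint.
- apply: continuous_bintegrable; apply: (@continuous_radial (fun s => (F s - F z) ^+ 2)).
  by apply: continuous_mul; apply: continuous_add => //; exact: cst_continuous.
- apply: continuous_bintegrable; apply: (@continuous_radial (fun s => (W s) ^+ 2)).
  by apply: continuous_mul; exact: Ck1_continuous CW.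
- move=> x Bx; rewrite /W -Vz -[leLHS]real_normK ?num_real//.
  rewrite -[leRHS]real_normK ?num_real// lerXn2r// ?nnegrE//.
  have [sz|zs] := leP (nsq x) z.
    rewrite distrC [leRHS]distrC (le_trans (FVmono _ _ sz))// ler_norm//.
  by rewrite (le_trans (FVmono _ _ (ltW zs)))// ler_norm.
Qed.

End radial_poincare.

(** * The radial Neumann problem with smooth data *)

Section radial_poisson.
Context {R : realType} (N : nat).
Local Notation vec := 'rV[R]_N.
Local Notation mu := (lebesgue_rV R N).
Local Notation e i := (delta_mx ord0 i : vec).
Implicit Types (x : vec) (F V rho psi : R -> R) (u : vec -> R).

(** Smooth profiles with compact support in the open interval from [0] to [1]. *)
Definition bump_like rho := (forall k, Ck1 k rho) /\
  exists a b, [/\ 0 < a, a < b, b < 1 & forall s, ~~ (a <= s <= b) -> rho s = 0].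

(** In the variable [s = |x|^2] the volume element of the space is, up to a constant
factor, [s^(N/2 - 1) ds]; so the primitive below measures the mass of [rho] in
concentric balls. *)
Definition weight : R := (N%:R / 2) - 1.

Definition weighted_primitive rho (E : R -> R) :=
  (forall s, is_derive s (1 : R) E (rho s * s `^ weight)) /\
  (forall s, s <= 0 -> E s = 0).

Lemma exists_weighted_primitive rho : bump_like rho ->
  exists E, weighted_primitive rho E.
Proof.
move=> [Crho [a [b [a0 ab b1 rho0]]]].
have rhoa s : s < a -> rho s = 0 by move=> sa; apply: rho0; rewrite negb_and -ltNge sa.
have [E [dE E0]] : exists G, (forall s, is_derive s (1 : R) G (rho s * s `^ weight)) /\
    (forall s, s <= 0 -> G s = 0).
  apply: primitive.
    exact: (Ck1_continuous (Ck1_mul_powR 0 weight a0 rhoa Crho)).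
  by move=> s s0; rewrite rhoa ?mul0r// (le_lt_trans s0).
by exists E.
Qed.

(** The field [X = psi(|x|^2) x] satisfies [div X = rho] and [X = - grad U] for
[U = F(|x|^2)], that is [- Delta U = rho].  The components of [X] are test
functions, which encodes the Neumann condition and lets [X] be paired with any
weak gradient.  The last field normalises [F] off the range of the squared
norm. *)
Record neumann_potential rho psi F := {
  potential_field : forall i, test_fun (radial_field (N := N) psi i);
  potential_div : forall x, \sum_i 'D_(e i) (radial_field psi i) x = rho (nsq x);
  potential_C1 : Ck1 1 F;
  potential_grad : forall x i,
    grad (fun y : vec => F (nsq y)) x ord0 i = - radial_field psi i x;
  potential_left : forall s, s <= 0 -> 'D_1 F s = 0 }.

(** Solving [N psi + 2 s psi' = rho] by the integrating factor [s^(N/2)] gives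
[psi = E s^(-N/2) / 2], where [E] is the weighted primitive of [rho].  It vanishes
near [0] since [rho] does, and near [1] exactly because the total mass [E 1] is
zero. *)
Lemma exists_neumann_potential rho E : bump_like rho ->
  weighted_primitive rho E -> E 1 = 0 ->
  exists psi F, neumann_potential rho psi F.
Proof.
move=> [Crho [a [b [a0 ab b1 rho0]]]] [dE E0] E1.
have rhoa s : s < a -> rho s = 0 by move=> sa; apply: rho0; rewrite negb_and -ltNge sa.
have CE : forall k, Ck1 k E.
  by apply: Ck1_primitive dE => k; exact: Ck1_mul_powR a0 rhoa Crho.
pose dE' s := rho s * s `^ weight.
have Ea s : s < a -> E s = 0.
  move=> sa; have [s0|s0] := leP s 0; first exact: E0.
  have <- : E 0 = E s; last exact: E0.
  apply: (is_derive1_eq (ltW s0) (df := dE')) => t /andP[_ ts].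
  by rewrite /dE' rhoa ?mul0r// (le_lt_trans ts).
have Eb s : b < s -> E s = 0.
  move=> bs; rewrite -E1; have [s1|s1] := leP s 1.
    apply: (is_derive1_eq s1 (df := dE')) => t /andP[st _].
    by rewrite /dE' rho0 ?mul0r// negb_and orbC -ltNge (lt_le_trans bs).
  apply/esym; apply: (is_derive1_eq (ltW s1) (df := dE')) => t /andP[st _].
  by rewrite /dE' rho0 ?mul0r// negb_and orbC -ltNge (lt_le_trans b1).
pose psi s := 2^-1 * (E s * s `^ (- (N%:R / 2))).
have Cpsi k : Ck1 k psi.
  by apply: CkZ; exact: Ck1_mul_powR a0 Ea CE.
have psi0 s : ~~ (a <= s <= b) -> psi s = 0.
  rewrite negb_and -!ltNge /psi => /orP[/Ea ->|/Eb ->]; by rewrite mul0r mulr0.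
have dpsi s : is_derive s (1 : R) psi (2^-1 * (rho s * s `^ weight * s `^ (- (N%:R / 2)) +
    E s * (- (N%:R / 2) * s `^ (- (N%:R / 2) - 1)))).
  have := is_derive_mul_powR (- (N%:R / 2)) a0 Ea (dE s).
  exact: is_deriveZ.
(* the gradient of F(|x|^2) is 2 F'(|x|^2) x *)
pose f (s : R) : R := - 2^-1 * psi s.
have Cf k : Ck1 k f by exact: (CkZ (- 2^-1) (Cpsi k)).
have f0 s : s <= 0 -> f s = 0.
  move=> s0; rewrite /f psi0 ?mulr0// negb_and -ltNge.
  by rewrite (le_lt_trans s0 a0).
have [F [dF F0]] := primitive (Ck1_continuous (Cf 0%N)) f0.
exists psi, F; split => //.
- by move=> i; exact: radial_field_test_fun a0 b1 Cpsi psi0.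
- move=> x; rewrite div_radial_field//.
  have [_ ->] := dpsi (nsq x).
  have [s0|s0] := ltP 0 (nsq x); last first.
    have sa : nsq x < a by exact: le_lt_trans a0.
    have -> : nsq x = 0 by apply/eqP; rewrite eq_le s0 nsq_ge0.
    by rewrite psi0 ?rhoa// ?mulr0 ?mul0r ?addr0// negb_and -ltNge a0.
  have sn0 : nsq x != 0 by rewrite gt_eqF.
  have h1 : nsq x `^ weight * nsq x `^ (- (N%:R / 2)) = (nsq x)^-1.
    rewrite -powRD ?sn0 ?implybT// /weight.
    have -> : N%:R / 2 - 1 + - (N%:R / 2) = - 1 :> R by ring.
    by rewrite powR_inv1// nsq_ge0.
  have h2 : nsq x `^ (- (N%:R / 2) - 1) = nsq x `^ (- (N%:R / 2)) / nsq x.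
    by rewrite powRD ?sn0 ?implybT// powR_inv1// nsq_ge0.
  rewrite -[rho _ * _ * _]mulrA h1 h2 /psi.
  by field.
- exact: Ck1S (Cf 0%N) dF.
- move=> x i; rewrite mxE.
  have [_ ->] := is_derive_radial i (dF (nsq x)).
  by rewrite /f /radial_field; field.
- by move=> s s0; have [_ ->] := dF s; exact: f0.
Qed.

(** The defining property of the weak gradient, applied to each component of the
field. *)
Lemma weak_divergence rho psi F u g : neumann_potential rho psi F -> L2 u ->
  is_weak_grad u g ->
  bint (fun x => u x * rho (nsq x)) =
  bint (fun x => dot (g x) (grad (fun y => F (nsq y)) x)).
Proof.
move=> P Lu ug.
have tX := potential_field P.
have cX i : continuous ('D_(e i) (radial_field psi i)).
  exact: CkV_continuous (CkV_partial i (test_fun_smooth 1 (tX i))).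
have -> : bint (fun x => u x * rho (nsq x)) =
    bint (fun x => \sum_i u x * 'D_(e i) (radial_field psi i) x).
  by apply: eq_bint => x _; rewrite -(potential_div P) mulr_sumr.
have -> : bint (fun x => dot (g x) (grad (fun y => F (nsq y)) x)) =
    bint (fun x => \sum_i (- 1) * (g x ord0 i * radial_field psi i x)).
  apply: eq_bint => x _; apply: eq_bigr => i _.
  by rewrite (potential_grad P) mulrN mulN1r.
have i1 i : bintegrable (fun x => u x * 'D_(e i) (radial_field psi i) x).
  by apply: L2_mul => //; exact: L2_continuous.
have i2 i : bintegrable (fun x => g x ord0 i * radial_field psi i x).
  by apply: L1loc_mul_test_fun (tX i); have [] := ug i.
rewrite !bint_sum//; last by move=> i; exact: bintegrableZ.
apply: eq_bigr => i _; rewrite bintZ// mulN1r.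
have [_ /(_ _ (tX i))] := ug i.
by rewrite /partial bintE// bintE// => -[].
Qed.

End radial_poisson.

(** * Density of smooth radial functions *)

Section bump_like_closure.
Context {R : realType}.
Implicit Types (rho f : R -> R).

Lemma bump_like0 : bump_like (fun _ : R => 0).
Proof.
split; first by move=> k; exact: (Ck_cst (fun _ : unit => 1 : R)).
by exists (1 / 4), (1 / 2); split => //; lra.
Qed.

Lemma bump_likeZ c rho : bump_like rho -> bump_like (fun s => c * rho s).
Proof.
move=> [C [a [b [a0 ab b1 h]]]]; split; first by move=> k; exact: (CkZ c (C k)).
by exists a, b; split => // s sab; rewrite h ?mulr0.
Qed.

Lemma bump_likeD rho1 rho2 : bump_like rho1 -> bump_like rho2 ->
  bump_like (fun s => rho1 s + rho2 s).
Proof.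
move=> [C1 [a [b [a0 ab b1 h1]]]] [C2 [c [d [c0 cd d1 h2]]]].
split; first by move=> k; exact: (CkD (C1 k) (C2 k)).
exists (Num.min a c), (Num.max b d); split.
- by rewrite lt_min a0.
- by rewrite gt_min lt_max ab.
- by rewrite gt_max b1.
- move=> s; rewrite ge_min le_max negb_and !negb_or => h.
  by rewrite h1 ?h2 ?addr0// negb_and; move: h => /orP[]/andP[h3 h4];
    apply/orP; by [left|right].
Qed.

Lemma bump_likeB rho1 rho2 : bump_like rho1 -> bump_like rho2 ->
  bump_like (fun s => rho1 s - rho2 s).
Proof.
move=> h1 /(bump_likeZ (-1)) h2; have := bump_likeD h1 h2.
by under eq_fun do rewrite mulN1r.
Qed.

Lemma bump_like_bump (a b : R) k : 0 < a -> a < b -> b < 1 ->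
  bump_like (bump a b k).
Proof.
move=> a0 ab b1; split; first by move=> n; exact: Ck1_bump.
exists a, b; split => // s sab; apply: bump0; apply: contra sab.
by move=> /andP[/ltW -> /ltW ->].
Qed.

Lemma bump_like_continuous rho : bump_like rho -> continuous rho.
Proof. by move=> [/(_ 0%N)]. Qed.

End bump_like_closure.

Section density.
Context {R : realType} (N : nat).
Local Notation vec := 'rV[R]_N.
Local Notation mu := (lebesgue_rV R N).
Local Notation "f \@ 'r'" := (fun x : vec => f (nsq x)) (at level 40).
Implicit Types (rho f : R -> R) (g : vec -> R).

Lemma bump_like_L2 rho : bump_like rho -> L2 (rho \@ r).
Proof.
by move=> h; apply: L2_continuous; apply: continuous_radial; exact: bump_like_continuous.
Qed.

Lemma sqrD_le (a b : R) : (a + b) ^+ 2 <= 2 * a ^+ 2 + 2 * b ^+ 2.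
Proof. by have := sqr_ge0 (a - b); nra. Qed.

Lemma bint_sqrD_le g h : L2 g -> L2 h ->
  bint (fun x : vec => (g x + h x) ^+ 2) <=
  2 * bint (fun x => g x ^+ 2) + 2 * bint (fun x => h x ^+ 2).
Proof.
move=> Lg Lh; have [_ ig] := Lg; have [_ ih] := Lh.
rewrite -!bintZ// -bintD; [|exact: bintegrableZ|exact: bintegrableZ].
apply: le_bint => [||x _]; last exact: sqrD_le.
  by have [] := L2D Lg Lh.
by apply: bintegrableD; exact: bintegrableZ.
Qed.

Lemma measurable_radial f : measurable_fun setT f ->
  measurable_fun (uball : set vec) (f \@ r).
Proof.
move=> mf; apply: measurable_funTS; apply: measurableT_comp => //.
by apply: continuous_rV_measurable; exact: continuous_nsq.
Qed.

(** Approximation in the mean square on the ball, for the radial function with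
profile [f].  The class of such profiles is shown to be closed under linear
combinations and dominated limits, which leads from intervals to Borel sets, to
simple functions and to all square integrable profiles. *)
Definition approximable f := [/\ measurable_fun [set: R] f, L2 (f \@ r) &
  forall eps, 0 < eps -> exists2 rho, bump_like rho &
    bint (fun x : vec => (f (nsq x) - rho (nsq x)) ^+ 2) <= eps].

Lemma bump_like_approximable rho : bump_like rho -> approximable rho.
Proof.
move=> h; split; first by apply: continuous_measurable_fun; exact: bump_like_continuous.
  exact: bump_like_L2.
move=> eps e0; exists rho => //.
rewrite (@eq_bint _ _ _ (fun=> 0)) ?bint_cst ?mul0r ?ltW//.
by move=> x _; rewrite subrr expr0n.
Qed.

Lemma approximableD f1 f2 : approximable f1 -> approximable f2 ->
  approximable (fun s => f1 s + f2 s).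
Proof.
move=> [m1 L1 h1] [m2 L2_ h2]; split; first exact: measurable_funD.
  exact: L2D.
move=> eps e0; have e4 : 0 < eps / 4 by rewrite divr_gt0.
have [r1 b1 h1'] := h1 _ e4; have [r2 b2 h2'] := h2 _ e4.
exists (fun s => r1 s + r2 s); first exact: bump_likeD.
rewrite (@eq_bint _ _ _ (fun x => ((f1 (nsq x) - r1 (nsq x)) + (f2 (nsq x) - r2 (nsq x))) ^+ 2));
  last by move=> x _; congr (_ ^+ 2); ring.
have La := L2B L1 (bump_like_L2 b1); have Lb := L2B L2_ (bump_like_L2 b2).
apply: le_trans (bint_sqrD_le La Lb) _; lra.
Qed.

Lemma approximableZ c f : approximable f -> approximable (fun s => c * f s).
Proof.
move=> [m1 L1 h1]; split; first exact: measurable_funM.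
  exact: L2Z.
move=> eps e0; have c0 : 0 < c ^+ 2 + 1 by rewrite ltr_wpDl// sqr_ge0.
have [r1 b1 h1'] := h1 (eps / (c ^+ 2 + 1)) (divr_gt0 e0 c0).
exists (fun s => c * r1 s); first exact: bump_likeZ.
rewrite (@eq_bint _ _ _ (fun x => c ^+ 2 * (f (nsq x) - r1 (nsq x)) ^+ 2)); last first.
  by move=> x _; ring.
have Lb := L2B L1 (bump_like_L2 b1).
rewrite bintZ; last by case: Lb.
move: h1'; rewrite ler_pdivlMr//.
have : 0 <= bint (fun x : vec => (f (nsq x) - r1 (nsq x)) ^+ 2).
  by apply: bint_ge0 => x _; exact: sqr_ge0.
by set I := bint _; nra.
Qed.

Lemma approximableB f1 f2 : approximable f1 -> approximable f2 ->
  approximable (fun s => f1 s - f2 s).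
Proof.
move=> h1 /(approximableZ (-1)) h2; have := approximableD h1 h2.
by under eq_fun do rewrite mulN1r.
Qed.

Lemma approximable_sum (I : Type) (s : seq I) (f : I -> R -> R) :
  (forall i, approximable (f i)) -> approximable (fun t => \sum_(i <- s) f i t).
Proof.
move=> h; elim: s => [|i s ih].
  by under eq_fun do rewrite big_nil; apply: bump_like_approximable; exact: bump_like0.
by under eq_fun do rewrite big_cons; exact: approximableD.
Qed.

Lemma approximable_lim (f_ : nat -> R -> R) f g : (forall n, approximable (f_ n)) ->
  measurable_fun setT f -> L2 g ->
  (forall s, f_ n s @[n --> \oo] --> f s) ->
  (forall n x, uball x -> `|f_ n (nsq x)| <= g x) ->
  (forall x, uball x -> `|f (nsq x)| <= g x) -> approximable f.
Proof.
move=> af mf Lg f_f f_g fg.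
have Lf : L2 (f \@ r).
  have [mg ig] := Lg; split; first exact: measurable_radial.
  apply: (bintegrable_le _ ig).
    by apply: measurable_funX; exact: measurable_radial.
  move=> x Bx; rewrite normrX lerXn2r// ?nnegrE ?fg//.
  by apply: le_trans (fg x Bx).
split => // eps e0.
pose h n (x : vec) := (f (nsq x) - f_ n (nsq x)) ^+ 2.
have ih n : bintegrable (h n).
  by have [_ L _] := af n; have [] := L2B Lf L.
have [||||| _ _ +] := @dominated_convergence _ _ R mu uball measurable_uball
    (fun n x => (h n x)%:E) (cst 0%E) (fun x => (4 * g x ^+ 2)%:E).
- by move=> n; have /integrableP[] := ih n.
- exact: measurable_cst.
- apply: aeW => x Bx; apply: cvg_EFin; first by apply: nearW.
  have c1 : f (nsq x) - f_ n (nsq x) @[n --> \oo] --> f (nsq x) - f (nsq x).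
    by apply: cvgB; [exact: cvg_cst|exact: f_f].
  have := cvgM c1 c1; rewrite subrr mulr0; exact.
- by apply: bintegrableZ; case: Lg.
- apply: aeW => x n Bx; rewrite /= lee_fin /h ger0_norm ?sqr_ge0//.
  have := f_g n x Bx; have := fg x Bx.
  rewrite !ler_norml; set a := f _; set b := f_ _ _; move=> /andP[a1 a2] /andP[b1 b2].
  have -> : 4 * g x ^+ 2 = (2 * g x) ^+ 2 by ring.
  rewrite -real_normK ?num_real// lerXn2r// ?nnegrE// ?ler_norml; lra.
rewrite integral_cst ?mul0e; last exact: measurable_uball.
(* some f_ n is within eps / 4 of f, then some profile within eps / 4 of f_ n *)
move=> /fine_cvg /cvgr0Pnorm_lt /(_ _ (divr_gt0 e0 (ltr0n R 4)))[n _ /(_ n (leqnn n))] hn.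
have [_ Ln /(_ _ (divr_gt0 e0 (ltr0n R 4)))[rho brho hrho]] := af n.
exists rho => //.
rewrite (@eq_bint _ _ _ (fun x => ((f (nsq x) - f_ n (nsq x)) + (f_ n (nsq x) - rho (nsq x))) ^+ 2));
  last by move=> x _; congr (_ ^+ 2); ring.
have La := L2B Lf Ln; have Lb := L2B Ln (bump_like_L2 brho).
apply: le_trans (bint_sqrD_le La Lb) _.
have : bint (h n) < eps / 4 by apply: le_lt_trans hn; exact: ler_norm.
rewrite /h; lra.
Qed.

Let one_L2 : L2 (fun _ : vec => 1 : R).
Proof. by apply: L2_continuous; exact: cst_continuous. Qed.

Let indic_le1 (A : set R) s : `|\1_A s| <= 1 :> R.
Proof. by rewrite indicE; case: (s \in A); rewrite ?normr1 ?normr0. Qed.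

Lemma approximable_itv (a b : R) : 0 < a -> b < 1 -> approximable (\1_`]a, b[).
Proof.
move=> a0 b1; have [ab|ba] := ltP a b; last first.
  rewrite (_ : \1__ = fun=> 0); last first.
    apply/funext => s; rewrite indicE memNset//= in_itv/= => /andP[h1 h2].
    by have := lt_trans h1 h2; rewrite ltNge ba.
  by apply: bump_like_approximable; exact: bump_like0.
apply: (@approximable_lim (bump a b) _ (fun=> 1)) => //.
- by move=> k; apply: bump_like_approximable; exact: bump_like_bump.
- move=> s; have := @cvg_bump R a b s; rewrite indicE.
  suff -> : (s \in `]a, b[%classic) = (a < s < b)%R by [].
  by apply/idP/idP; rewrite inE/= in_itv.
- by move=> n x _; rewrite ger0_norm ?bump_ge0// bump_le1.
Qed.

Lemma approximable_itv0 (c : R) : c <= 1 -> approximable (\1_`]0, c[).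
Proof.
move=> c1; apply: (@approximable_lim (fun n => \1_`](n.+1%:R^-1), (c - n.+1%:R^-1)[) _ (fun=> 1)) => //.
- move=> n; apply: approximable_itv; first by rewrite invr_gt0.
  by rewrite ltrBlDr (le_lt_trans c1)// ltrDl invr_gt0.
- move=> s; have [sc|sc] := boolP (0 < s < c)%R; last first.
    rewrite indicE memNset/= ?in_itv/=; last exact/negP.
    rewrite (_ : (fun _ => _) = fun=> 0); first exact: cvg_cst.
    apply/funext => n; rewrite indicE memNset//= in_itv/=.
    move=> /andP[h1 h2]; move/negP: sc; apply; apply/andP; split.
      by apply: lt_trans h1; rewrite invr_gt0.
    by apply: lt_trans h2 _; rewrite ltrBlDr ltrDl invr_gt0.
  have /andP[s0 sc'] := sc.
  apply: cvg_near_cst; near=> n; rewrite !indicE; congr (nat_of_bool _)%:R.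
  rewrite !mem_set//= in_itv/= ?sc//; apply/andP; split.
    by near: n; exact: (near_infty_natSinv_lt (PosNum s0)).
  rewrite ltrBrDr -ltrBrDl; near: n.
  have d0 : 0 < c - s by rewrite subr_gt0.
  exact: (near_infty_natSinv_lt (PosNum d0)).
Unshelve. all: by end_near. Qed.

Lemma sum_indic (F : nat -> set R) (I : set R) k n s : trivIset setT F ->
  F k s /\ I s -> \sum_(i < n) \1_(F i `&` I) s = (k < n)%N%:R :> R.
Proof.
move=> tF [Fks Is].
have F0 i : i != k -> \1_(F i `&` I) s = 0 :> R.
  move=> ik; rewrite indicE memNset// => -[Fis _].
  by move/eqP: ik; apply; apply: tF => //; exists s.
case: ltnP => kn; last first.
  by rewrite big1// => i _; rewrite F0// ltn_eqF// (leq_trans _ kn).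
rewrite (bigD1 (Ordinal kn))//= big1 ?addr0; last by move=> i ik; rewrite F0.
by rewrite indicE mem_set.
Qed.

(** Only the values of the profile on the open unit interval matter, so the Dynkin
induction runs on traces on that interval. *)
Lemma approximable_indic (A : set R) : measurable A ->
  approximable (\1_(A `&` `]0, 1[)).
Proof.
pose P A := approximable (\1_(A `&` `]0, 1[)).
move=> mA; have e : measurable A = _ :=
  congr1 (fun M => M A) (measurable_realfun.RGenInftyO.measurableE R).
move: mA; rewrite e.
apply: (@dynkin_induction _ (measurableTypeR R) _ P
  (measurable_realfun.RGenInftyO.measurableE R)).
- move=> _ _ [a ->] [b ->]; exists (Num.min a b); apply/seteqP; split=> s /=.
    by rewrite !in_itv/= lt_min => -[-> ->].
  by rewrite !in_itv/= lt_min => /andP[].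
- by rewrite /P setTI; exact: approximable_itv0.
- move=> _ [c ->]; rewrite /P.
  rewrite (_ : _ `&` _ = `]0, (Num.min c 1)[%classic); last first.
    apply/seteqP; split=> s /=; rewrite !in_itv/= lt_min.
      by move=> [-> /andP[-> ->]].
    by move=> /and3P[-> -> ->].
  by apply: approximable_itv0; rewrite ge_min lexx orbT.
- move=> S mS PS; rewrite /P.
  rewrite (_ : \1__ = fun s => \1_`]0, 1[ s - \1_(S `&` `]0, 1[) s); last first.
    apply/funext => s; rewrite !indicE !in_setI in_setC.
    by case: (s \in S); case: (s \in _); rewrite /= ?subrr ?subr0.
  by apply: approximableB => //; exact: approximable_itv0.
- move=> F mF tF PF; rewrite /P.
  apply: (@approximable_lim (fun n s => \sum_(i < n) \1_(F i `&` `]0, 1[) s) _ (fun=> 1)) => //.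
  + by move=> n; apply: approximable_sum => i; exact: PF.
  + apply: measurable_indic; apply: measurableI => //.
    by apply: (@bigcup_measurable _ (measurableTypeR R)) => k _; exact: mF.
  + move=> s; apply: cvg_near_cst.
    have [[k Fks]|nF] := pselect (exists k, F k s /\ `]0, 1[%classic s).
      near=> n; rewrite (sum_indic n tF Fks).
      rewrite (_ : (k < n)%N) ?indicE ?mem_set//.
        by case: Fks => ? ?; split => //; exists k.
      by near: n; exists k.+1.
    apply: nearW => n; rewrite big1 => [|i _]; rewrite indicE memNset//.
      by move=> [[k _ Fks] I]; apply: nF; exists k.
    by move=> [Fis I]; apply: nF; exists i.
  + move=> n x _; set s := nsq x.
    have [[k Fks]|nF] := pselect (exists k, F k s /\ `]0, 1[%classic s).
      by rewrite (sum_indic n tF Fks); case: (k < n)%N; rewrite ?normr1 ?normr0.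
    rewrite big1 ?normr0// => i _; rewrite indicE memNset//.
    by move=> [Fis I]; apply: nF; exists i.
Unshelve. all: by end_near. Qed.

Import HBNNSimple.

Lemma approximable_nnsfun (phi : {nnsfun (measurableTypeR R) >-> R}) :
  (forall s, ~ `]0, 1[%classic s -> phi s = 0) -> approximable phi.
Proof.
move=> phi0.
rewrite (_ : (phi : R -> R) = fun s => \sum_(y <- finmap.enum_fset (fset_set (range phi)))
    y * \1_((phi @^-1` [set y]) `&` `]0, 1[) s); last first.
  apply/funext => s; rewrite fimfunE fsbig_finite//=.
  have [s01|s01] := pselect (`]0, 1[%classic s).
    by apply: eq_bigr => y _; rewrite !indicE in_setI (mem_set s01) andbT.
  rewrite [RHS]big1 => [|y _]; last by rewrite indicE in_setI (memNset s01) andbF mulr0.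
  rewrite -[RHS](phi0 s s01) [in RHS]fimfunE fsbig_finite//=.
apply: approximable_sum => y; apply: approximableZ; apply: approximable_indic.
rewrite -[X in measurable X]setTI.
by apply: (@measurable_funPT _ _ (measurableTypeR R) _ phi) => //; exact: measurable_set1.
Qed.

Lemma approximable_ge0 f : measurable_fun setT f -> L2 (f \@ r) ->
  (forall s, 0 <= f s) -> (forall s, ~ `]0, 1[%classic s -> f s = 0) ->
  approximable f.
Proof.
move=> mf Lf f0 fout.
have mf' : measurable_fun [set: measurableTypeR R] (EFin \o f) by exact/measurable_EFinP.
pose phi := nnsfun_approx measurableT mf'.
have f0' (s : measurableTypeR R) : [set: measurableTypeR R] s -> (0 <= (EFin \o f) s)%E.
  by move=> _; rewrite lee_fin.
have cphi s : phi n s @[n --> \oo] --> f s.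
  exact: (fine_cvg (cvg_nnsfun_approx measurableT mf' f0' (x := s) I)).
have phif n s : phi n s <= f s.
  rewrite -(cvg_lim (@Rhausdorff R) (cphi s)).
  apply: nondecreasing_cvgn_le; last by apply/cvg_ex; exists (f s).
  by move=> i j ij; have /lefP := nd_nnsfun_approx measurableT mf' ij; exact.
apply: (@approximable_lim (fun n => phi n) f (fun x => f (nsq x))) => //.
- move=> n; apply: approximable_nnsfun => s s01.
  by apply/eqP; rewrite eq_le fun_ge0 andbT -(fout s s01).
- by move=> n x _; rewrite ger0_norm// fun_ge0.
- by move=> x _; rewrite ger0_norm.
Qed.

Lemma approximable_L2 f : measurable_fun setT f -> L2 (f \@ r) ->
  (forall s, ~ `]0, 1[%classic s -> f s = 0) -> approximable f.
Proof.
move=> mf [mf2 if2] fout.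
have part (p : R -> R) : measurable_fun setT p -> (forall s, `|p s| <= `|f s|) ->
    (forall s, 0 <= p s) -> approximable p.
  move=> mp pf p0; apply: approximable_ge0 => // [|s /fout fs].
    split; first exact: measurable_radial.
    apply: (bintegrable_le _ if2).
      by apply: measurable_funX; exact: measurable_radial.
    move=> x _; rewrite normrX -[leRHS]real_normK ?num_real//.
    by rewrite lerXn2r ?nnegrE.
  apply/eqP; rewrite -normr_eq0 eq_le normr_ge0 andbT.
  by rewrite (le_trans (pf s))// fs normr0.
rewrite (_ : f = fun s => Num.max (f s) 0 - Num.max (- f s) 0); last first.
  by apply/funext => s; rewrite /Num.max; case: ltP => ?; case: ltP => ?; lra.
apply: approximableB; apply: part.
- exact: measurable_maxr.
- move=> s; rewrite ger0_norm ?le_max ?lexx ?orbT// ge_max ler_norm/= ?normr_ge0//.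
- by move=> s; rewrite le_max lexx orbT.
- by apply: measurable_maxr => //; exact: measurableT_comp.
- move=> s; rewrite ger0_norm ?le_max ?lexx ?orbT// ge_max -normrN ler_norm/= ?normr_ge0//.
- by move=> s; rewrite le_max lexx orbT.
Qed.

End density.

Section radial_density.
Context {R : realType} (N : nat).
Hypothesis N1 : (1 <= N)%N.
Local Notation vec := 'rV[R]_N.
Local Notation mu := (lebesgue_rV R N).
Implicit Types (rho f : R -> R) (w : vec -> R).

(** A measurable section of the squared norm: evaluating a radial function along it
gives its profile. *)
Definition axis_point (s : R) : vec := \row_i (if i == Ordinal N1 then Num.sqrt s else 0).

Lemma nsq_axis_point s : 0 <= s -> nsq (axis_point s) = s.
Proof.
move=> s0; rewrite /nsq /dot (bigD1 (Ordinal N1))//= big1 ?addr0.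
  by rewrite !mxE eqxx -expr2 sqr_sqrtr.
by move=> i /negbTE i0; rewrite mxE i0 mul0r.
Qed.

Lemma measurable_axis_point : measurable_fun setT axis_point.
Proof.
apply: measurable_fun_rVP => i.
under eq_fun do rewrite mxE.
case: (i == _); last exact: measurable_cst.
by apply: continuous_measurable_fun; exact: sqrt_continuous.
Qed.

(** The origin is the cube of side [0]; it is a null set because [N >= 1]. *)
Lemma ae_nsq_gt0 : {ae mu, forall x, uball x -> 0 < nsq x}.
Proof.
exists (cube 0); split; first exact: measurable_cube.
  by rewrite (cube_measure N (lexx 0)) mulr0 expr0n eqn0Ngt N1.
move=> x /= /not_implyP[_ /negP]; rewrite -leNgt => x0; apply/cubeP => i.
have : x ord0 i ^+ 2 <= 0 by exact: le_trans (coord_sqr_le_nsq x i) x0.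
by rewrite le_eqVlt ltNge sqr_ge0 orbF sqrf_eq0 => /eqP ->; rewrite normr0.
Qed.

Lemma radial_profile w : radial w -> measurable_fun uball w ->
  exists f, [/\ measurable_fun setT f, (forall s, ~ `]0, 1[%classic s -> f s = 0) &
    {ae mu, forall x, uball x -> w x = f (nsq x)}].
Proof.
move=> rw mw.
pose f := (w \o axis_point) \_ (`]0, 1[%classic).
exists f; split.
- apply/(measurable_restrictT _ _).1 => //.
  apply: (measurable_comp measurable_uball _ mw); last first.
    by apply: measurable_funTS; exact: measurable_axis_point.
  move=> _ [s + <-]; rewrite /= in_itv/= => /andP[s0 s1].
  by apply/uballE; rewrite nsq_axis_point// ltW.
- by move=> s s01; rewrite /f patchE memNset.
- apply: filterS ae_nsq_gt0 => x x0 Bx; have /uballE x1 := Bx.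
  rewrite /f patchE mem_set; last by rewrite /= in_itv/= x0// x1.
  apply: rw => //; first by apply/uballE; rewrite nsq_axis_point ?nsq_ge0.
  rewrite /enorm -!/(nsq _) nsq_axis_point//; exact: nsq_ge0.
Qed.

Lemma radial_approx w : radial w -> L2 w -> forall eps, 0 < eps ->
  exists2 rho, bump_like rho &
    bint (fun x => (w x - rho (nsq x)) ^+ 2) <= eps.
Proof.
move=> rw Lw eps e0; have [mw iw] := Lw.
have [f [mf f0 wf]] := radial_profile rw mw.
have mfr := (@measurable_radial _ N _ mf).
have Lf : L2 (fun x : vec => f (nsq x)).
  split => //; have /integrableP[_ lt] := iw; apply/integrableP; split.
    by apply/measurable_EFinP; exact: measurable_funX.
  apply: le_lt_trans lt; rewrite le_eqVlt; apply/orP; left; apply/eqP.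
  apply: ae_eq_integral.
  - exact: measurable_uball.
  - by apply: measurableT_comp => //; apply/measurable_EFinP; exact: measurable_funX.
  - by apply: measurableT_comp => //; apply/measurable_EFinP; exact: measurable_funX.
  - by apply: filterS wf => x wfx Bx /=; rewrite wfx.
have [_ _ /(_ _ e0)[rho brho h]] := approximable_L2 mf Lf f0.
exists rho => //; apply: le_trans h; rewrite le_eqVlt; apply/orP; left; apply/eqP.
have mrho : measurable_fun (uball : set vec) (fun x => rho (nsq x)).
  by have [] := bump_like_L2 N brho.
apply: ae_eq_bint.
- by apply: measurable_funX; exact: measurable_funB.
- by apply: measurable_funX; exact: measurable_funB.
- by apply: filterS wf => x wfx Bx; rewrite wfx.
Qed.

Lemma L2_cst (c : R) : L2 (fun _ : vec => c).
Proof. by apply: L2_continuous; exact: cst_continuous. Qed.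

Lemma bint_sqr_le (g : vec -> R) : L2 g ->
  bint g ^+ 2 <= @vol R N * bint (fun x => g x ^+ 2).
Proof.
move=> Lg; have v0 := @vol_gt0 R N; have [_ ig] := Lg; have ig1 := L2_bintegrable Lg.
pose m := bint g / @vol R N.
have : 0 <= bint (fun x => (g x - m) ^+ 2) by apply: bint_ge0 => x _; exact: sqr_ge0.
rewrite (@eq_bint _ _ _ (fun x => g x ^+ 2 - (2 * m * g x - m ^+ 2))); last first.
  by move=> x _; ring.
have ic : bintegrable (fun _ : vec => m ^+ 2) by apply: L2_bintegrable; exact: L2_cst.
rewrite bintB//; last by apply: bintegrableB => //; exact: bintegrableZ.
rewrite bintB//; last exact: bintegrableZ.
rewrite bintZ// bint_cst.
have -> : 2 * m * bint g - m ^+ 2 * @vol R N = bint g ^+ 2 / @vol R N.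
  by rewrite /m; field; rewrite gt_eqF.
by rewrite subr_ge0 ler_pdivrMr// mulrC.
Qed.

(** Zero mass with respect to the weight means zero integral over the ball: the
divergence of a compactly supported field has integral zero.  This links the
weighted primitive to the integral over the ball without polar coordinates. *)
Lemma bint_bump_eq0 rho E : bump_like rho -> weighted_primitive N rho E -> E 1 = 0 ->
  bint (fun x : vec => rho (nsq x)) = 0.
Proof.
move=> brho wE E1; have [psi [F P]] := exists_neumann_potential brho wE E1.
have := weak_divergence P (L2_cst 1) (weak_grad_C1 (CkV_cst 1 (1 : R))).
rewrite (@eq_bint _ _ _ (fun x => rho (nsq x))); last by move=> x _; rewrite mul1r.
move=> ->; rewrite (@eq_bint _ _ _ (fun=> 0)) ?bint_cst ?mul0r// => x _.
by rewrite grad_cst /dot big1// => i _; rewrite mxE mul0r.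
Qed.

(** Otherwise all profiles would be orthogonal to the constants, although they
approximate the constant [1]. *)
Lemma exists_bump_bint_neq0 : exists2 rho, bump_like rho &
  bint (fun x : vec => rho (nsq x)) != 0.
Proof.
have v0 := @vol_gt0 R N; apply: contrapT => h.
have [//|rho brho] := @radial_approx (fun=> 1) _ (L2_cst 1) _ (divr_gt0 v0 (ltr0n R 2)).
have z : bint (fun x : vec => rho (nsq x)) = 0.
  by apply/eqP/negPn/negP => h'; apply: h; exists rho.
rewrite (@eq_bint _ _ _ (fun x => 1 + rho (nsq x) ^+ 2 - 2 * rho (nsq x))); last first.
  by move=> x _; ring.
have Lr := bump_like_L2 N brho; have i1 := L2_bintegrable Lr; have [_ i2] := Lr.
have ic := L2_bintegrable (L2_cst 1).
rewrite bintB; [|exact: bintegrableD|exact: bintegrableZ].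
rewrite bintD// bintZ// z mulr0 subr0 bint_cst mul1r.
have : 0 <= bint (fun x : vec => rho (nsq x) ^+ 2).
  by apply: bint_ge0 => x _; exact: sqr_ge0.
lra.
Qed.

(** The approximation is corrected by a multiple of a fixed profile of nonzero mean;
the multiple is small because [w] has mean zero. *)
Lemma radial_approx_mean0 w : radial w -> L2 w -> bint w = 0 ->
  forall eps, 0 < eps -> exists rho E,
    [/\ bump_like rho, weighted_primitive N rho E, E 1 = 0 &
     bint (fun x => (w x - rho (nsq x)) ^+ 2) <= eps].
Proof.
move=> rw Lw w0 eps e0; have v0 := @vol_gt0 R N.
have [rho1 b1 m1] := exists_bump_bint_neq0.
have [E1 wE1] := exists_weighted_primitive N b1.
have E11 : E1 1 != 0.
  by apply/eqP => /(bint_bump_eq0 b1 wE1) h; rewrite h eqxx in m1.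
set M := bint _ in m1.
have L1 := bump_like_L2 N b1.
pose S := bint (fun x : vec => rho1 (nsq x) ^+ 2).
have S0 : 0 <= S by apply: bint_ge0 => x _; exact: sqr_ge0.
(* A is the factor lost when rho0 is replaced by rho0 - c rho1 *)
pose A := 2 + 2 * (@vol R N * S / M ^+ 2).
have M2 : 0 < M ^+ 2 by rewrite lt_neqAle eq_sym sqrf_eq0 m1 sqr_ge0.
have A0 : 0 < A.
  by rewrite ltr_pwDl// mulr_ge0// divr_ge0 ?sqr_ge0// mulr_ge0// ltW.
have [rho0 b0 h0] := radial_approx rw Lw (divr_gt0 e0 A0).
have [E0 wE0] := exists_weighted_primitive N b0.
have L0 := bump_like_L2 N b0.
pose c := E0 1 / E1 1.
pose rho s := rho0 s - c * rho1 s.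
pose E s := E0 s - c * E1 s.
have b : bump_like rho by apply: bump_likeB => //; exact: bump_likeZ.
have wE : weighted_primitive N rho E.
  have [d0 z0] := wE0; have [d1 z1] := wE1; split=> s; last first.
    by move=> s0; rewrite /E z0// z1// mulr0 subr0.
  have dZ := @is_deriveZ _ _ _ _ c _ _ _ (d1 s).
  have := @is_deriveB _ _ _ _ _ _ _ _ _ (d0 s) dZ; congr is_derive.
  by rewrite /GRing.scale/= /rho; ring.
have Ez : E 1 = 0 by rewrite /E /c divfK// subrr.
exists rho, E; split => //.
have := bint_bump_eq0 b wE Ez.
have i0 := L2_bintegrable L0; have i1 := L2_bintegrable L1; have iw := L2_bintegrable Lw.
rewrite /rho bintB//; last exact: bintegrableZ.
rewrite bintZ// -/M => /eqP; rewrite subr_eq0 => /eqP cM.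
have Ld := L2B Lw L0.
(* c M is the mean of rho0, which is small since that of w vanishes *)
have := bint_sqr_le Ld; rewrite bintB// w0 sub0r sqrrN cM exprMn => hc.
rewrite (@eq_bint _ _ _ (fun x => ((w x - rho0 (nsq x)) + c * rho1 (nsq x)) ^+ 2)); last first.
  by move=> x _; congr (_ ^+ 2); ring.
apply: le_trans (bint_sqrD_le Ld (L2Z c L1)) _.
have -> : bint (fun x : vec => (c * rho1 (nsq x)) ^+ 2) = c ^+ 2 * S.
  rewrite /S -bintZ; last by case: L1.
  by apply: eq_bint => x _; rewrite exprMn.
move: h0 hc; set I := bint _; rewrite ler_pdivlMr// => h0 hc.
have hS : c ^+ 2 * S <= @vol R N * I * S / M ^+ 2.
  by rewrite ler_pdivlMr// mulrAC ler_wpM2r.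
have -> : eps = eps - I * A + (2 * I + 2 * (@vol R N * I * S / M ^+ 2)).
  by rewrite /A; field.
lra.
Qed.

End radial_density.

(** * Monotone radial functions below the eigenvalue *)

Section eigenfunction.
Context {R : realType} (N : nat).
Hypothesis N1 : (1 <= N)%N.
Local Notation vec := 'rV[R]_N.
Local Notation mu := (lebesgue_rV R N).
Implicit Types (u w phi : vec -> R) (g h : vec -> vec).

Lemma measurable_dot g h : (forall i, measurable_fun uball (fun x => g x ord0 i)) ->
  (forall i, measurable_fun uball (fun x => h x ord0 i)) ->
  measurable_fun uball (fun x => dot (g x) (h x)).
Proof.
move=> mg mh; apply: measurable_sum => i; exact: measurable_funM.
Qed.

Lemma weak_grad_measurable u g i : is_weak_grad u g ->
  measurable_fun uball (fun x => g x ord0 i).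
Proof. by move=> /(_ i)[[]]. Qed.

Lemma sobolev_wgrad p u : sobolev p u -> is_weak_grad u (wgrad u).
Proof. by move=> [_ _ [g [ug _]]]; exact: wgradP ug. Qed.

Lemma sobolev2_L2 u : sobolev 2 u -> L2 u.
Proof.
move=> [mu_ lt _]; split => //; apply/integrableP; split.
  by apply/measurable_EFinP; exact: measurable_funX.
move: lt; congr (_ < _)%E; apply: eq_integral => x _.
by rewrite powR_mulrn// real_normK ?num_real// /= ger0_norm ?sqr_ge0.
Qed.

Lemma eigen_test lam w phi : sobolev 2 w ->
  (forall phi, sobolev 2 phi ->
    (\int[mu]_(x in uball) (dot (wgrad w x) (wgrad phi x))%:E =
     \int[mu]_(x in uball) (lam * w x * phi x)%:E)%E) ->
  CkV 1 phi ->
  bint (fun x => dot (wgrad w x) (grad phi x)) = lam * bint (fun x => w x * phi x).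
Proof.
move=> sw weq Cphi; have sphi : sobolev 2 phi by exact: sobolev_C1.
have ww := sobolev_wgrad sw; have wp := sobolev_wgrad sphi.
have gp := weak_grad_C1 Cphi.
rewrite -bintZ; last first.
  apply: L2_mul; first exact: sobolev2_L2.
  by apply: L2_continuous; exact: CkV_continuous Cphi.
have e : bint (fun x => dot (wgrad w x) (wgrad phi x)) =
    bint (fun x => lam * w x * phi x) := congr1 fine (weq phi sphi).
have -> : bint (fun x => lam * (w x * phi x)) = bint (fun x => lam * w x * phi x).
  by apply: eq_bint => x _; rewrite mulrA.
rewrite -e; apply: ae_eq_bint.
- by apply: measurable_dot => i; [exact: weak_grad_measurable ww|exact: weak_grad_measurable gp].
- by apply: measurable_dot => i; [exact: weak_grad_measurable ww|exact: weak_grad_measurable wp].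
- by apply: filterS (wgrad_C1 Cphi) => x h Bx; rewrite h.
Qed.

(** By contradiction, the Poincare inequality with constant [kappa] would hold for
nondecreasing, hence for all radial functions.  Let [rho] approximate the
eigenfunction [w], let [U] solve the Neumann problem for [rho], and let [y] be
[U] minus a constant.  Then

  [\int w rho = lambda \int w y] and [\int |grad U|^2 = \int y rho],

and the Poincare inequality, through [\int y rho >= kappa \int y^2], bounds
[kappa^2 \int y^2] by [\int rho^2].  Hence [\int w rho] is at most
[lambda / kappa] times the mean of [\int w^2] and [\int rho^2], which are close to
each other and to [\int w rho]; as [lambda < kappa], improving the approximation
gives [\int w^2 = 0]. *)
Lemma radial_competitor (lam kappa : R) : 0 < lam -> lam < kappa ->
  @radial_neumann_eigen R N lam ->
  exists V : R -> R, [/\ Ck1 1 V, {homo V : s t / s <= t},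
    bint (fun x : vec => V (nsq x)) = 0 &
    dirichlet (fun x : vec => V (nsq x)) < kappa * bint (fun x : vec => V (nsq x) ^+ 2)].
Proof.
move=> lam0 lamk [w [sw rw w_neq0 weq]].
apply: contrapT => noV; apply: w_neq0.
have k0 : 0 < kappa by exact: lt_trans lamk.
have Lw := sobolev2_L2 sw; have [_ iw2] := Lw.
have ww := sobolev_wgrad sw.
have poincare V : Ck1 1 V -> {homo V : s t / s <= t} ->
    bint (fun x : vec => V (nsq x)) = 0 ->
    kappa * bint (fun x : vec => V (nsq x) ^+ 2) <= dirichlet (fun x : vec => V (nsq x)).
  by move=> CV mV V0; rewrite leNgt; apply/negP => h; apply: noV; exists V.
(* eigenfunctions for a nonzero eigenvalue have mean zero *)
have w0 : bint w = 0.
  have := eigen_test sw weq (CkV_cst 1 (1 : R)).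
  rewrite (@eq_bint _ _ _ (fun=> 0)) ?bint_cst ?mul0r; last first.
    move=> x _; rewrite grad_cst /dot big1// => i _; by rewrite mxE mulr0.
  under eq_fun do rewrite mulr1.
  by move/esym/eqP; rewrite mulf_eq0 gt_eqF//= => /eqP.
apply: bint_sqr_eq0 => //; apply/eqP; rewrite eq_le; apply/andP; split; last first.
  by apply: bint_ge0 => x _; exact: sqr_ge0.
apply/ler_addgt0Pr => eps e0; rewrite add0r.
have d0 : 0 < 1 - lam / kappa by rewrite subr_gt0 ltr_pdivrMr// mul1r.
have [rho [E [brho wE E1 hrho]]] := radial_approx_mean0 N1 rw Lw w0 (mulr_gt0 e0 d0).
have [psi [F P]] := exists_neumann_potential brho wE E1.
have CF := potential_C1 P.
pose u (x : vec) : R := F (nsq x).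
have Cu : CkV 1 (u : vec -> R) by exact: CkV_radial.
have [c hc] := radial_poincare (ltW k0) poincare CF (potential_left P).
have Lrho := bump_like_L2 N brho; have [_ irho] := Lrho.
have cu : continuous (u : vec -> R) := CkV_continuous Cu.
pose y (x : vec) : R := u x - c.
have Ly : L2 (y : vec -> R).
  by apply: L2_continuous; apply: continuous_add => //; exact: cst_continuous.
have Lu : L2 (u : vec -> R) by exact: L2_continuous.
have iwu := L2_mul Lw Lu; have iwy := L2_mul Lw Ly; have iuy := L2_mul Lu Lrho.
have iyr := L2_mul Ly Lrho; have [_ iy2] := Ly.
have iw := L2_bintegrable Lw; have ir := L2_bintegrable Lrho.
have rho0 := bint_bump_eq0 brho wE E1.
(* the field of the potential is paired with the weak gradient of w *)
have w_rho : bint (fun x => w x * rho (nsq x)) = lam * bint (fun x => w x * y x).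
  rewrite (weak_divergence P Lw ww) (eigen_test sw weq Cu).
  congr (_ * _); rewrite (@eq_bint _ _ _ (fun x => w x * y x + c * w x)).
    by rewrite bintD ?bintZ// ?w0 ?mulr0 ?addr0//; exact: bintegrableZ.
  by move=> x _; rewrite /y; ring.
have u_rho : dirichlet (u : vec -> R) = bint (fun x => y x * rho (nsq x)).
  have := weak_divergence P Lu (weak_grad_C1 Cu).
  rewrite -/(dirichlet (u : vec -> R)) => <-.
  rewrite (@eq_bint _ _ _ (fun x => y x * rho (nsq x) + c * rho (nsq x))).
    by rewrite bintD ?bintZ// ?rho0 ?mulr0 ?addr0//; exact: bintegrableZ.
  by move=> x _; rewrite /y; ring.
rewrite -/u u_rho in hc.
set W := bint (fun x => w x ^+ 2) in iw2 *.
set Y := bint (fun x => y x ^+ 2) in iy2 hc *.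
set P2 := bint (fun x : vec => rho (nsq x) ^+ 2) in irho *.
have h1 : 2 * kappa * bint (fun x => y x * rho (nsq x)) <= kappa ^+ 2 * Y + P2.
  rewrite -!bintZ// -bintD//; last exact: bintegrableZ.
  apply: le_bint; [exact: bintegrableZ|by apply: bintegrableD => //; exact: bintegrableZ|].
  move=> x _; have := sqr_ge0 (kappa * y x - rho (nsq x)); lra.
have h2 : 2 * kappa * bint (fun x => w x * y x) <= W + kappa ^+ 2 * Y.
  rewrite -!bintZ// -bintD//; last exact: bintegrableZ.
  apply: le_bint; [exact: bintegrableZ|by apply: bintegrableD => //; exact: bintegrableZ|].
  move=> x _; have := sqr_ge0 (w x - kappa * y x); lra.
have h3 : W + P2 - 2 * bint (fun x => w x * rho (nsq x)) <= eps * (1 - lam / kappa).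
  apply: le_trans hrho; rewrite le_eqVlt; apply/orP; left; apply/eqP.
  have iwr := L2_mul Lw Lrho.
  rewrite -bintZ// -bintD// -bintB//; [|exact: bintegrableD|exact: bintegrableZ].
  by apply: eq_bint => x _; ring.
have P0 : 0 <= P2 by apply: bint_ge0 => x _; exact: sqr_ge0.
have W0 : 0 <= W by apply: bint_ge0 => x _; exact: sqr_ge0.
rewrite w_rho in h3.
set I := bint (fun x => w x * y x) in h2 h3; set J := bint (fun x => y x * rho (nsq x)) in h1 hc.
have h4 : kappa ^+ 2 * Y <= P2 by nra.
have h5 : 2 * (lam * I) <= lam / kappa * (W + P2).
  rewrite mulrAC ler_pdivlMr//; nra.
have h6 : (W + P2) * (1 - lam / kappa) <= eps * (1 - lam / kappa) by lra.
move: h6; rewrite ler_pM2r// => h6; lra.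
Qed.

End eigenfunction.

(** * Expansions of powers near 1 *)

Section powR_expansions.
Context {R : realType}.
Implicit Types (p q r x y : R).

(** The mean value theorem at [0], on both sides at once: the intermediate point has
the sign of [y] and is not farther from [0]. *)
Lemma MVT0 (f df : R -> R) r : f 0 = 0 ->
  (forall x, `|x| <= r -> is_derive x (1 : R) f (df x)) ->
  forall y, `|y| <= r -> exists x, [/\ `|x| <= `|y|, 0 <= x * y & f y = df x * y].
Proof.
move=> f0 fdf y yr.
have cf a b : `|a| <= r -> `|b| <= r -> {within `[a, b], continuous f}.
  move=> ar br; apply: derivable_within_continuous => x; rewrite in_itv/= => /andP[ax xb].
  have xr : `|x| <= r by move: ar br; rewrite !ler_norml; lra.
  by have [] := fdf x xr.
have r0 : `|0 : R| <= r by rewrite normr0 (le_trans _ yr).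
have [y0|y0|->] := ltgtP y 0; last by exists 0; rewrite !mulr0.
- have h x : x \in `]y, 0[ -> is_derive x (1 : R) f (df x).
    rewrite in_itv/= => /andP[yx x0]; apply: fdf; move: yr; rewrite !ler_norml; lra.
  have [x + /eqP] := @MVT R f df y 0 y0 h (cf _ _ yr r0).
  rewrite in_itv/= f0 !sub0r eqr_oppLR => /andP[yx x0] /eqP e.
  by exists x; rewrite e mulrN opprK !ltr0_norm//; split => //; nra.
- have h x : x \in `]0, y[ -> is_derive x (1 : R) f (df x).
    rewrite in_itv/= => /andP[yx x0]; apply: fdf; move: yr; rewrite !ler_norml; lra.
  have [x + /eqP] := @MVT R f df 0 y y0 h (cf _ _ r0 yr).
  rewrite in_itv/= f0 !subr0 => /andP[x0 xy] /eqP e.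
  by exists x; rewrite e !gtr0_norm//; split => //; nra.
Qed.

Lemma is_derive_powR1D p x : -1 < x ->
  is_derive x (1 : R) (fun y => (1 + y) `^ p) (p * (1 + x) `^ (p - 1)).
Proof.
move=> x1; have d1 : is_derive x (1 : R) (fun y => 1 + y) 1.
  have := @is_deriveD _ _ _ _ _ _ _ _ _ (is_derive_cst (1 : R) x (1 : R)) (is_derive_id x (1 : R)).
  by rewrite add0r.
have x0 : 0 < 1 + x by lra.
have := @is_derive_comp _ _ (fun y => y `^ p) (fun y => 1 + y) x 1 _ _ (is_derive1_powR p x0) d1.
by rewrite mulr1.
Qed.

Lemma near0_powR1D p (eps : R) : 0 < eps ->
  exists r, [/\ 0 < r, r <= 2^-1 & forall x, `|x| <= r -> `|(1 + x) `^ p - 1| <= eps].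
Proof.
move=> e0.
have c : {for (0 : R), continuous (fun y : R => (1 + y) `^ p)}.
  apply/differentiable_continuous/derivable1_diffP.
  by have [] := @is_derive_powR1D p 0 (ltrN10 R).
move: c => /cvgrPdist_le /(_ _ e0); rewrite addr0 powR1 => -[r /= r0 h].
exists (Num.min (r / 2) 2^-1); split.
- by rewrite lt_min; apply/andP; split; [rewrite divr_gt0|rewrite invr_gt0].
- by rewrite ge_min lexx orbT.
- move=> x; rewrite le_min => /andP[xr _]; rewrite distrC; apply: h => /=.
  by rewrite sub0r normrN (le_lt_trans xr)// ltr_pdivrMr// ltr_pMr// ltr1n.
Qed.

(** Two applications of the mean value theorem; the second derivative of the
difference is nonnegative near [0], being close to [q (q - 1) - 2 c > 0]. *)
Lemma powR1D_lower q c : 0 <= q -> c < q * (q - 1) / 2 ->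
  exists r, [/\ 0 < r, r <= 2^-1 & forall y, `|y| <= r ->
    1 + q * y + c * y ^+ 2 <= (1 + y) `^ q].
Proof.
move=> q0 hc; pose eps := (q * (q - 1) / 2 - c) / (`|q * (q - 1)| + 1).
have d0 : 0 < `|q * (q - 1)| + 1 by rewrite ltr_wpDl.
have e0 : 0 < eps by rewrite divr_gt0// subr_gt0.
have [r [r0 r1 hr]] := near0_powR1D (q - 2) e0.
exists r; split => // y yr.
pose f2 x := q * (q - 1) * (1 + x) `^ (q - 2) - 2 * c.
pose f1 x := q * (1 + x) `^ (q - 1) - q - 2 * c * x.
pose f x := (1 + x) `^ q - 1 - q * x - c * x ^+ 2.
have x1 x : `|x| <= r -> -1 < x by move=> xr; move: (le_trans xr r1); rewrite ler_norml; lra.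
have df x : `|x| <= r -> is_derive x (1 : R) f (f1 x).
  move=> /x1/(is_derive_powR1D q) d.
  have dZ := @is_deriveZ _ _ _ _ q _ _ _ (is_derive_id x (1 : R)).
  have dX := @is_deriveZ _ _ _ _ c _ _ _ (@is_deriveX _ _ _ 2 _ _ _ (is_derive_id x (1 : R))).
  have d1 := @is_deriveB _ _ _ _ _ _ _ _ _ d (is_derive_cst (1 : R) x (1 : R)).
  have d2 := @is_deriveB _ _ _ _ _ _ _ _ _ d1 dZ.
  have := @is_deriveB _ _ _ _ _ _ _ _ _ d2 dX.
  by congr is_derive; rewrite /f1 /GRing.scale/=; ring.
have df1 x : `|x| <= r -> is_derive x (1 : R) f1 (f2 x).
  move=> /x1/(is_derive_powR1D (q - 1)) d.
  have dZ := @is_deriveZ _ _ _ _ (2 * c) _ _ _ (is_derive_id x (1 : R)).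
  have dq := @is_deriveZ _ _ _ _ q _ _ _ d.
  have d1 := @is_deriveB _ _ _ _ _ _ _ _ _ dq (is_derive_cst q x (1 : R)).
  have := @is_deriveB _ _ _ _ _ _ _ _ _ d1 dZ.
  congr is_derive; rewrite /f2 /GRing.scale/=.
  have -> : q - 1 - 1 = q - 2 by ring.
  by ring.
have f2_ge0 x : `|x| <= r -> 0 <= f2 x.
  move=> xr; have := hr x xr; rewrite /f2; set P := _ `^ _.
  have : `|q * (q - 1)| * eps <= q * (q - 1) / 2 - c.
    rewrite /eps mulrA ler_pdivrMr//.
    have : 0 < q * (q - 1) / 2 - c by rewrite subr_gt0.
    set g := _ - c; set k := `|_|; have : 0 <= k by exact: normr_ge0.
    by nra.
  have : `|q * (q - 1) * (P - 1)| <= `|q * (q - 1)| * `|P - 1| by rewrite normrM.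
  move=> h1 h2 h3.
  have h4 : `|q * (q - 1) * (P - 1)| <= q * (q - 1) / 2 - c.
    by apply: le_trans h1 _; apply: le_trans h2; rewrite ler_wpM2l.
  move: h4; rewrite ler_norml; lra.
have [|x [xy xy0 fy]] := @MVT0 f f1 r _ df y yr.
  by rewrite /f addr0 powR1; ring.
have xr := le_trans xy yr.
have [|z [zx zx0 fx]] := @MVT0 f1 f2 r _ df1 x xr.
  by rewrite /f1 addr0 powR1; ring.
have : 0 <= f y.
  rewrite fy fx -mulrA mulr_ge0// f2_ge0// (le_trans zx)//.
rewrite /f; lra.
Qed.

Lemma powR1D_upper p eta : 0 <= p -> 0 < eta ->
  exists r, 0 < r /\ forall y, 0 <= y -> y <= r -> (1 + y) `^ p <= 1 + (p + eta) * y.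
Proof.
move=> p0 e0; have d0 : 0 < p + 1 by rewrite ltr_wpDl.
have [r [r0 r1 hr]] := near0_powR1D (p - 1) (divr_gt0 e0 d0).
exists r; split => // y y0 yr.
pose f x := (1 + x) `^ p - 1.
have df x : `|x| <= r -> is_derive x (1 : R) f (p * (1 + x) `^ (p - 1)).
  move=> xr; have /(is_derive_powR1D p) d : -1 < x.
    by move: (le_trans xr r1); rewrite ler_norml; lra.
  have := @is_deriveB _ _ _ _ _ _ _ _ _ d (is_derive_cst (1 : R) x (1 : R)).
  by rewrite subr0.
have yr' : `|y| <= r by rewrite ger0_norm.
have [|x [xy _ fy]] := @MVT0 f _ r _ df y yr'.
  by rewrite /f addr0 powR1 subrr.
have : f y <= (p + eta) * y.
  rewrite fy ler_wpM2r//; have := hr x (le_trans xy yr').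
  set P := _ `^ _; rewrite ler_norml => /andP[_].
  rewrite ler_pdivlMr// => h.
  have [P1|P1] := leP P 1; nra.
rewrite /f; lra.
Qed.

(** A strict inequality resists a small linear perturbation; the bound by [1] fits
the range of [delta] in the final statement. *)
Lemma exists_delta (a b k1 k2 : R) : a < b ->
  exists2 d, 0 < d < 1 & forall e, 0 <= e -> e < d -> a + e * k1 < b + e * k2.
Proof.
move=> ab; pose K := `|k1| + `|k2| + 1.
have K0 : 0 < K by rewrite ltr_wpDl// addr_ge0.
exists (Num.min 2^-1 ((b - a) / K)).
  by rewrite lt_min gt_min invr_gt0 divr_gt0 ?subr_gt0// invf_lt1// ltr1n ltr0n.
move=> e e0; rewrite lt_min => /andP[_]; rewrite ltr_pdivlMr// => eK.
have : k1 <= `|k1| by exact: ler_norm.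
have : - k2 <= `|k2| by rewrite -normrN ler_norm.
rewrite /K in eK; nra.
Qed.

End powR_expansions.

(** * The truncated nonlinearity *)

Section energy_tools.
Context {R : realType}.
Implicit Types (m q ell t y : R).

Lemma expR_convex_01 (th g : R) : 0 <= th -> th <= 1 ->
  expR (th * g) <= (1 - th) + th * expR g.
Proof.
move=> t0 t1; set h := expR (th * g).
have h0 : 0 < h by exact: expR_gt0.
have e1 : h * (1 - th * g) <= 1.
  have := expR_ge1Dx (- (th * g)); rewrite expRN -/h => e.
  by have := ler_wpM2l (ltW h0) e; rewrite divff ?gt_eqF.
have e2 : h * (1 + (1 - th) * g) <= expR g.
  have -> : expR g = h * expR ((1 - th) * g) by rewrite -expRD; congr expR; ring.
  by rewrite ler_wpM2l ?expR_ge1Dx// ltW.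
have t1' : 0 <= 1 - th by rewrite subr_ge0.
have := ler_wpM2l t1' e1; have := ler_wpM2l t0 e2; nra.
Qed.

(** The power [y ^ m] is convex in [m], and [m = (2 - m) 1 + (m - 1) 2].  This bounds the integrals
[A_m] linearly in [2 - m], without differentiating under the integral sign. *)
Lemma powR_young m y : 0 <= y -> 1 < m -> m < 2 ->
  y `^ m <= (2 - m) * y + (m - 1) * y ^+ 2.
Proof.
rewrite le_eqVlt => /predU1P[<-|y0] m1 m2.
  by rewrite powR0 ?gt_eqF ?(lt_trans ltr01)// mulr0 expr0n mulr0 addr0.
have -> : y `^ m = y * expR ((m - 1) * ln y).
  by rewrite /powR gt_eqF// -[in RHS](lnK y0) -expRD; congr expR; rewrite ?lnK//; ring.
have := @expR_convex_01 (m - 1) (ln y); rewrite lnK//.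
rewrite subr_ge0 (ltW m1) lerBlDr => /(_ isT) h.
have {h} := h (ltW m2); move=> /(ler_wpM2l (ltW y0)) h.
by apply: le_trans h _; nra.
Qed.

(** A version of the power that is continuous on the whole line. *)
Definition pospow p (s : R) : R := if 0 < s then s `^ p else 0.

Lemma continuous_pospow p : 0 < p -> continuous (pospow p).
Proof.
move=> p0 s; have [s0|s0|->] := ltgtP s 0.
- have d : is_derive s (1 : R) (pospow p) 0.
    apply: (@near_eq_is_derive _ _ _ (fun=> 0)).
    near=> y; rewrite /pospow ltNge ltW//.
    by near: y; exact: lt_nbhsl.
  by apply/differentiable_continuous/derivable1_diffP; have [] := d.
- have d : is_derive s (1 : R) (pospow p) (p * s `^ (p - 1)).
    apply: (@near_eq_is_derive _ _ _ (fun y => y `^ p)); last exact: is_derive1_powR.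
    near=> y; rewrite /pospow (_ : 0 < y)//.
    by near: y; exact: (cvgr_gt s).
  by apply/differentiable_continuous/derivable1_diffP; have [] := d.
- have p00 : pospow p 0 = 0 by rewrite /pospow ltxx.
  apply/cvgrPdist_le => e e0; near=> y; rewrite p00 sub0r normrN /pospow; case: ifPn => y0; last by rewrite normr0 ltW.
  rewrite ger0_norm ?powR_ge0//.
  have ye : y <= e `^ p^-1.
    apply: (le_trans (ler_norm _)); near: y.
    exists (e `^ p^-1) => /=; first exact: powR_gt0.
    by move=> x /=; rewrite sub0r normrN => /ltW.
  have := ge0_ler_powR (ltW p0) (ltW y0) (powR_ge0 _ _) ye.
  by rewrite -powRrM mulVf ?gt_eqF// powRr1// ltW.
Unshelve. all: by end_near. Qed.

(** The value [2] leaves room for the competitor, whose values stay below [2]: the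
truncation is never active. *)
Lemma s0_ge2 m q : 0 < m -> m < q -> 2 <= s0 m q.
Proof.
move=> m0 mq; rewrite /s0 -[2]/(1 + 1) lerD2r.
have e1 : (1 : R) `^ (q - m)^-1 = 1 by rewrite powR1.
rewrite -{1}e1 ge0_ler_powR ?nnegrE ?invr_ge0 ?subr_ge0 ?divr_ge0 ?ltW//.
  exact: lt_trans mq.
by rewrite ltr_pdivlMr// mul1r.
Qed.

Lemma fq_small m q ell t : t <= s0 m q -> fq m q ell t = t `^ (q - 1).
Proof. by rewrite /fq => ->. Qed.

Lemma Fq_small m q ell t : 1 < q -> 0 <= t -> t <= s0 m q ->
  Fq m q ell t = t `^ q / q.
Proof.
move=> q1; have q0 : 0 < q by exact: lt_trans q1.
rewrite le_eqVlt => /predU1P[<- _|t0 ts].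
  by rewrite /Fq set_itv1 Rintegral_set1 powR0 ?gt_eqF// mul0r.
rewrite /Fq.
have -> : (\int[@lebesgue_measure R]_(s in `[0, t]) fq m q ell s)%R =
    (\int[@lebesgue_measure R]_(s in `[0, t]) pospow (q - 1) s)%R.
  apply: eq_Rintegral => s; rewrite inE/= in_itv/= => /andP[s0' st].
  rewrite fq_small ?(le_trans st)// /pospow; case: ltgtP s0' => // <- _.
  by rewrite powR0// gt_eqF// subr_gt0.
have cq := continuous_pospow q0.
have d (s : R) : 0 < s -> is_derive s (1 : R) (fun s => pospow q s / q) (pospow (q - 1) s).
  move=> s0'.
  have d1 : is_derive s (1 : R) (pospow q) (q * s `^ (q - 1)).
    apply: (@near_eq_is_derive _ _ _ (fun y => y `^ q)); last exact: is_derive1_powR.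
    near=> y; rewrite /pospow (_ : 0 < y)//.
    by near: y; exact: (cvgr_gt s).
  have := @is_deriveZ _ _ _ _ q^-1 _ _ _ d1.
  rewrite (_ : q^-1 *: _ = pospow (q - 1) s); last first.
    by rewrite /GRing.scale/= /pospow s0' mulKf// gt_eqF.
  by congr is_derive; apply/funext => y; rewrite /GRing.scale/= mulrC.
rewrite /Rintegral (@continuous_FTC2 _ _ (fun s => pospow q s / q))//.
- by rewrite /= /pospow ltxx t0 mul0r subr0.
- by apply: continuous_subspaceT; apply: continuous_pospow; rewrite subr_gt0.
- have c s : (fun s => pospow q s / q) x @[x --> s] --> pospow q s / q.
    by apply: cvgM; [exact: cq|exact: cvg_cst].
  split.
  + by move=> s; rewrite in_itv/= => /andP[s0' _]; have [] := d s s0'.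
  + by apply: cvg_at_right_filter; exact: c.
  + by apply: cvg_at_left_filter; exact: c.
- by move=> s; rewrite in_itv/= => /andP[s0' _]; rewrite derive1E; have [_ ->] := d s s0'.
Unshelve. all: by end_near. Qed.

Lemma fq_ge0 m q ell t : 0 < m -> m < q -> 1 < ell -> 1 < q -> 0 <= t ->
  0 <= fq m q ell t.
Proof.
move=> m0 mq l1 q1 t0; rewrite /fq; case: ifPn => [_|]; first exact: powR_ge0.
rewrite -ltNge => st; rewrite addr_ge0 ?powR_ge0// mulr_ge0//.
  by rewrite mulr_ge0 ?powR_ge0// divr_ge0// subr_ge0 ltW.
rewrite subr_ge0 ge0_ler_powR ?subr_ge0 ?nnegrE// ltW//.
by rewrite (lt_le_trans _ (s0_ge2 m0 mq)).
Qed.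

Lemma measurable_fq m q ell : measurable_fun setT (fq m q ell).
Proof.
apply: measurable_fun_ifT => /=.
- by apply: measurable_fun_ler => //; exact: measurable_cst.
- exact: measurable_powR.
- apply: measurable_funD; first exact: measurable_cst.
  apply: measurable_funM; first exact: measurable_cst.
  apply: measurable_funB; last exact: measurable_cst.
  exact: measurable_powR.
Qed.

(** Monotonicity gives measurability; it is needed to compute the energy of a
function that is constant only almost everywhere. *)
Lemma measurable_Fq m q ell : 0 < m -> m < q -> 1 < ell -> 1 < q ->
  measurable_fun setT (Fq m q ell).
Proof.
move=> m0 mq l1 q1; apply: nondecreasing_measurable => // t1 t2 t12.
have fint t : (@lebesgue_measure R).-integrable `[0, t] (EFin \o fq m q ell).
  apply: measurable_bounded_integrable => //.
  - have lt : ((@lebesgue_measure R) `[0%R, t]%classic < +oo)%E.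
      by rewrite lebesgue_measure_itv/=; case: ifP => _; rewrite ?ltry.
    exact: lt.
  - by apply: measurable_funTS; exact: measurable_fq.
  - pose K := (q - 1) / (ell - 1) * s0 m q `^ (q - ell).
    have K0 : 0 <= K by rewrite mulr_ge0 ?powR_ge0// divr_ge0// subr_ge0 ltW.
    exists (s0 m q `^ (q - 1) + K * t `^ (ell - 1)); split; first exact: num_real.
    move=> D CD s /=; rewrite in_itv/= => /andP[s0' st]; apply: le_trans (ltW CD).
    rewrite ger0_norm ?fq_ge0//.
    have sp : 0 <= s0 m q by apply: le_trans (s0_ge2 m0 mq).
    have Kt : 0 <= K * t `^ (ell - 1) by rewrite mulr_ge0// powR_ge0.
    have q10 : 0 <= q - 1 by rewrite subr_ge0 ltW.
    have l10 : 0 <= ell - 1 by rewrite subr_ge0 ltW.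
    have t0 : 0 <= t by exact: le_trans st.
    rewrite /fq; case: ifPn => [ss|_].
      by rewrite -[leLHS]addr0 lerD// ge0_ler_powR ?nnegrE.
    rewrite lerD2l ler_wpM2l// lerBlDr -[leLHS]addr0 lerD ?powR_ge0//.
    by rewrite ge0_ler_powR ?nnegrE.
rewrite /Fq /Rintegral fine_le ?integrable_fin_num//.
apply: ge0_subset_integral => //.
- by apply/measurable_EFinP; apply: measurable_funTS; exact: measurable_fq.
- by move=> s; rewrite /= in_itv/= => /andP[s0' _]; rewrite lee_fin fq_ge0.
- by apply: subset_itvl; rewrite bnd_simp.
Qed.

End energy_tools.

(** * Perturbations of the constant function *)

(** With [X = vol / Bq < 1], the claim [tau ^ q Bq < vol] reads
[Am / Bq < X ^ ((q - m) / q)].  With [A2] for [Am] and [m = 2], this is the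
hypothesis raised to the power [2 / q].  For
[m = 2 - e] the left-hand side is bounded by an affine function of [e], and the
right-hand side is at least its tangent at [e = 0] by convexity of the
exponential, so that a small [e] does not destroy the strict inequality. *)
Lemma exponent_perturbation (R : realType) (q vol A1 A2 Bq : R) :
  2 < q -> 0 < vol -> vol <= A2 -> 0 < Bq ->
  (A2 / vol) `^ (q / 2) < Bq / vol ->
  exists2 d, 0 < d < 1 & forall m Am, 2 - d < m -> m < 2 -> 0 < Am ->
    Am <= (2 - m) * A1 + (m - 1) * A2 ->
    exists tau, [/\ 0 < tau, tau < 1, tau `^ m * Am = tau `^ q * Bq &
                    tau `^ q * Bq < vol].
Proof.
move=> q2 v0 vA B0 h; have q0 : 0 < q by lra.
have A0 : 0 < A2 by lra.
pose X := vol / Bq; have X0 : 0 < X by rewrite divr_gt0.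
have Xn0 : X != 0 by rewrite gt_eqF.
have X1 : X < 1.
  rewrite ltr_pdivrMr// mul1r -[ltLHS]mul1r -ltr_pdivlMr//.
  apply: le_lt_trans h.
  have h1 : 1 <= A2 / vol by rewrite ler_pdivlMr// mul1r.
  have q20 : 0 <= q / 2 by lra.
  have := ge0_ler_powR q20 ler01 (le_trans ler01 h1) h1.
  by rewrite powR1.
have gap : A2 / Bq < X `^ (1 - 2 / q).
  have qi : 0 < 2 / q by rewrite divr_gt0.
  have := @gt0_ltr_powR R (2 / q) qi ((A2 / vol) `^ (q / 2)) (Bq / vol).
  rewrite !nnegrE powR_ge0 divr_ge0 ?ltW// => /(_ isT isT h).
  rewrite -powRrM (_ : q / 2 * (2 / q) = 1); last by field; rewrite gt_eqF.
  rewrite powRr1 ?divr_ge0 ?ltW// => h'.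
  have -> : X `^ (1 - 2 / q) = X * (Bq / vol) `^ (2 / q).
    rewrite powRD ?Xn0 ?implybT// powRr1 ?ltW//; congr (_ * _).
    rewrite (_ : Bq / vol = X `^ (- 1)); last by rewrite powR_inv1 ?ltW// invf_div.
    by rewrite -powRrM mulN1r.
  have -> : A2 / Bq = X * (A2 / vol) by rewrite /X; field; rewrite !gt_eqF.
  by rewrite ltr_pM2l.
have [d d01 hd] := exists_delta ((A1 - A2) / Bq) (X `^ (1 - 2 / q) * (ln X / q)) gap.
exists d => // m Am dm m2 Am0 hA.
have e0 : 0 <= 2 - m by lra.
have ed : 2 - m < d by lra.
have qm : 0 < q - m by lra.
have Y0 : 0 < Am / Bq by rewrite divr_gt0.
have YX : Am / Bq < X `^ ((q - m) / q).
  have -> : (q - m) / q = (1 - 2 / q) + (2 - m) / q by field; rewrite gt_eqF.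
  rewrite powRD ?Xn0 ?implybT//.
  apply: (@lt_le_trans _ _ (X `^ (1 - 2 / q) * (1 + (2 - m) / q * ln X))); last first.
    rewrite ler_wpM2l ?powR_ge0// /powR (negPf Xn0); exact: expR_ge1Dx.
  have -> : X `^ (1 - 2 / q) * (1 + (2 - m) / q * ln X) =
     X `^ (1 - 2 / q) + (2 - m) * (X `^ (1 - 2 / q) * (ln X / q)) by ring.
  apply: le_lt_trans (hd _ e0 ed).
  have -> : A2 / Bq + (2 - m) * ((A1 - A2) / Bq) = ((2 - m) * A1 + (m - 1) * A2) / Bq by field; rewrite gt_eqF.
  by rewrite ler_pM2r// invr_gt0.
pose tau := (Am / Bq) `^ (q - m)^-1.
have t0 : 0 < tau by exact: powR_gt0.
have tq : tau `^ q < X.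
  have qi : 0 < q / (q - m) by rewrite divr_gt0.
  have := @gt0_ltr_powR R _ qi (Am / Bq) (X `^ ((q - m) / q)).
  rewrite !nnegrE powR_ge0 ltW// => /(_ isT isT YX).
  rewrite -powRrM (_ : _ / q * _ = 1); last by field; rewrite !gt_eqF.
  by rewrite powRr1 ?ltW// /tau -powRrM [_^-1 * q]mulrC.
exists tau; split => //.
- rewrite ltNge; apply/negP => t1.
  have := @ge0_ler_powR R q (ltW q0) 1 tau.
  by rewrite powR1 !nnegrE ler01 ltW// => /(_ isT isT t1); lra.
- have -> : tau `^ q = tau `^ m * tau `^ (q - m).
    rewrite -powRD ?(gt_eqF t0) ?implybT//; congr (_ `^ _); ring.
  rewrite -mulrA; congr (_ * _).
  rewrite /tau -powRrM mulVf ?gt_eqF// powRr1 ?ltW//.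
  by rewrite divfK ?gt_eqF.
- by rewrite -ltr_pdivlMr.
Qed.

Section competitor.
Context {R : realType} {N : nat}.
Local Notation vec := 'rV[R]_N.
Local Notation mu := (lebesgue_rV R N).
Variables (V : R -> R) (q : R).
Hypotheses (q2 : 2 < q) (CV : Ck1 1 V).
Let W (x : vec) : R := V (nsq x).
Let S2 := bint (fun x => W x ^+ 2).
Let D := dirichlet W.

Let contW : continuous W.
Proof. exact: continuous_radial (Ck1_continuous CV). Qed.

Lemma continuous_perturb t : continuous (fun x => 1 + t * W x).
Proof. by apply: continuous_add; [exact: cst_continuous|apply: continuous_mul; [exact: cst_continuous|exact: contW]]. Qed.

Lemma bintegrable_grad_sqr : bintegrable (fun x => nsq (grad W x)).
Proof. by apply: continuous_bintegrable; apply: continuous_dot_grad; exact: (CkV_radial CV). Qed.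

Lemma bint_quadratic a b c : bint W = 0 ->
  bint (fun x => a + b * W x + c * W x ^+ 2) = a * @vol R N + c * S2.
Proof.
move=> W0.
have iW : bintegrable W by exact: continuous_bintegrable contW.
have iW2 : bintegrable (fun x => W x ^+ 2).
  by apply: continuous_bintegrable; apply: continuous_mul contW contW.
have ic : bintegrable (fun _ : vec => a) by apply: continuous_bintegrable; exact: cst_continuous.
rewrite bintD ?bintD ?bintZ ?W0 ?mulr0 ?addr0 ?bint_cst//.
- exact: bintegrableZ.
- by apply: bintegrableD => //; exact: bintegrableZ.
- exact: bintegrableZ.
Qed.

(** To second order in [t], the left-hand side is
[1 + (q / 2) t^2 (S2 + D) / vol] and the right-hand side is
[1 + (q (q - 1) / 2) t^2 S2 / vol], the first order term being killed by the mean
value zero of [W].  The difference of the coefficients is a positive multiple of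
[(q - 2) S2 - D]. *)
Lemma static_gap : bint W = 0 -> D < (q - 2) * S2 ->
  exists t, [/\ 0 < t, forall x, uball x -> `|t * W x| <= 2^-1 &
    ((@vol R N + t ^+ 2 * (S2 + D)) / @vol R N) `^ (q / 2) <
      bint (fun x => (1 + t * W x) `^ q) / @vol R N].
Proof.
move=> W0 DS; have v0 := @vol_gt0 R N; set v := @vol R N in v0 *.
have D0 : 0 <= D by apply: bint_ge0 => x _; exact: nsq_ge0.
have S0 : 0 < S2 by have := le_lt_trans D0 DS; rewrite pmulr_rgt0 ?subr_gt0.
have q0 : 0 < q := lt_trans (ltr0n R 2) q2.
pose g := q * (q - 1) / 2 * S2 - q / 2 * (S2 + D).
have g0 : 0 < g by rewrite /g; nra.
(* a quarter of the gap g is spent on each of the two expansions *)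
pose c := q * (q - 1) / 2 - g / (4 * S2).
pose eta := g / (4 * (S2 + D)).
have SD0 : 0 < S2 + D by lra.
have eta0 : 0 < eta by rewrite divr_gt0// mulr_gt0.
have cS : c * S2 = q * (q - 1) / 2 * S2 - g / 4.
  by rewrite /c; field; rewrite gt_eqF.
have eS : (q / 2 + eta) * (S2 + D) = q / 2 * (S2 + D) + g / 4.
  by rewrite /eta; field; rewrite gt_eqF.
have cq : c < q * (q - 1) / 2.
  by rewrite /c ltrBlDr ltrDl divr_gt0// mulr_gt0.
have [r1 [r10 r1h hr1]] := powR1D_lower (ltW q0) cq.
have q20 : 0 <= q / 2 by lra.
have [r2 [r20 hr2]] := powR1D_upper q20 eta0.
have [C C0 WC] := continuous_bounded_ball contW.
pose t := Num.min 1 (Num.min (r1 / C) (r2 * v / (S2 + D))).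
have t0 : 0 < t by rewrite !lt_min ltr01 !divr_gt0// mulr_gt0.
have [t1 tC tr] : [/\ t <= 1, t * C <= r1 & t * (S2 + D) <= r2 * v].
  by rewrite -!ler_pdivlMr//; split; rewrite !ge_min lexx ?orbT.
have tW x : uball x -> `|t * W x| <= r1.
  move=> /WC h; rewrite normrM gtr0_norm//; apply: le_trans tC.
  by rewrite ler_pM2l.
exists t; split => //.
  by move=> x /tW h; exact: le_trans h r1h.
have t2 : 0 < t ^+ 2 by rewrite exprn_gt0.
pose y := t ^+ 2 * (S2 + D) / v.
have y0 : 0 <= y by rewrite /y divr_ge0 ?mulr_ge0 ?ltW.
have yr : y <= r2.
  rewrite /y ler_pdivrMr//; apply: le_trans tr; rewrite ler_pM2r// expr2.
  by rewrite -[leRHS]mulr1 ler_pM2l.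
rewrite mulrDl divff ?gt_eqF// -/y.
apply: (le_lt_trans (hr2 y y0 yr)).
apply: (@lt_le_trans _ _ (1 + t ^+ 2 * (c * S2) / v)).
  rewrite ltrD2l /y.
  have -> : (q / 2 + eta) * (t ^+ 2 * (S2 + D) / v) = t ^+ 2 / v * ((q / 2 + eta) * (S2 + D)).
    by ring.
  rewrite [ltRHS]mulrAC ltr_pM2l ?divr_gt0// eS cS; rewrite /g in g0 *.
  move: g0; clear; set a := _ * S2; set b := _ * (S2 + D); lra.
have -> : 1 + t ^+ 2 * (c * S2) / v = (1 * v + (c * t ^+ 2) * S2) / v.
  by field; rewrite gt_eqF.
rewrite ler_pM2r ?invr_gt0// -(bint_quadratic 1 (q * t) _ W0); apply: le_bint.
- apply: continuous_bintegrable => x.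
  apply: (@continuousD _ _ _ (fun x => 1 + q * t * W x) (fun x => c * t ^+ 2 * W x ^+ 2)).
    apply: continuousD; first exact: cst_continuous.
    by apply: continuousM; [exact: cst_continuous|exact: contW].
  apply: continuousM; first exact: cst_continuous.
  exact: (continuous_mul contW contW).
- apply: integrable_powR_ball; [exact: ltW|exact: continuous_perturb|].
  move=> x /tW h; have := le_trans h r1h; rewrite ler_norml; lra.
- move=> x /tW h; apply: le_trans (hr1 _ h); rewrite exprMn; lra.
Qed.

Lemma bint_energy2 t : bint W = 0 ->
  bint (fun x => (t * enorm (grad W x)) ^+ 2 + (1 + t * W x) ^+ 2) =
  @vol R N + t ^+ 2 * (S2 + D).
Proof.
move=> W0.
transitivity (bint (fun x => t ^+ 2 * nsq (grad W x) + (1 + 2 * t * W x + t ^+ 2 * W x ^+ 2))).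
  by apply: eq_bint => x _; rewrite exprMn enorm_sqr; ring.
have iW : bintegrable (fun x => 1 + 2 * t * W x + t ^+ 2 * W x ^+ 2).
  apply: continuous_bintegrable.
  rewrite (_ : (fun _ => _) = fun x => (1 + t * W x) * (1 + t * W x)); last first.
    by apply/funext => x; ring.
  by apply: continuous_mul; exact: continuous_perturb.
rewrite bintD ?bintZ ?bint_quadratic//; [rewrite /D /dirichlet; ring| | ].
- exact: bintegrable_grad_sqr.
- by apply: bintegrableZ; exact: bintegrable_grad_sqr.
Qed.

End competitor.

(** * Energies and the Nehari set *)

Section energies.
Context {R : realType} {N : nat}.
Local Notation vec := 'rV[R]_N.
Local Notation mu := (lebesgue_rV R N).
Implicit Types (u f g : vec -> R) (m q ell : R).

Lemma measurable_enorm_wgrad p u : sobolev p u ->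
  measurable_fun uball (fun x => enorm (wgrad u x)).
Proof.
move=> su; have wu := sobolev_wgrad su.
have md : measurable_fun uball (fun x => dot (wgrad u x) (wgrad u x)).
  by apply: measurable_dot => i; exact: weak_grad_measurable wu.
have ms : measurable_fun setT (@Num.sqrt R).
  by apply: continuous_measurable_fun; exact: sqrt_continuous.
exact: (measurableT_comp ms md).
Qed.

Lemma ae_eq_integral_bint f g : measurable_fun uball f -> bintegrable g ->
  {ae mu, forall x, uball x -> f x = g x} ->
  (\int[mu]_(x in uball) (f x)%:E = (bint g)%:E)%E.
Proof.
move=> mf ig fg; rewrite -bintE//; apply: ae_eq_integral => //.
- exact: measurable_uball.
- exact/measurable_EFinP.
- by have /integrableP[] := ig.
- by apply: filterS fg => x h Bx; rewrite h.
Qed.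

(** The ball has positive measure. *)
Lemma ae_ball_exists (P : vec -> Prop) :
  {ae mu, forall x, uball x -> P x} -> exists2 x, uball x & P x.
Proof.
move=> aeP; apply: contrapT => nP.
have : {ae mu, forall x : vec, uball x -> (fun=> 1 : R) x = (fun=> 0) x}.
  by apply: filterS aeP => x h Bx; case: nP; exists x => //; exact: h.
move=> /(ae_eq_bint (measurable_cst _) (measurable_cst _)).
rewrite -/(@vol R N) bint_cst mul0r => v0.
by have := @vol_gt0 R N; rewrite v0 ltxx.
Qed.

(** The constant test function suffices: it gives [c ^ (m - 1) = c ^ (q - 1)]. *)
Lemma constant_cone_solution m q u c : 1 < m -> m < q -> cone_solution m q u ->
  ae_const u c -> c = 1.
Proof.
move=> m1 mq [[su ru u0 mu_] up ueq] uc.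
have m0 : 0 < m by exact: lt_trans m1.
have [x Bx uxc] := ae_ball_exists uc.
have c0 : 0 < c by rewrite -uxc up.
have mU : measurable_fun uball u by case: su.
have C1 : CkV 1 (fun _ : vec => (1 : R)) by exact: CkV_cst.
have s1 : sobolev m (fun _ : vec => (1 : R)) by exact: sobolev_C1 (ltW m0) C1.
have := ueq _ s1.
have icst (k : R) : bintegrable (fun _ : vec => k).
  by apply: continuous_bintegrable; exact: cst_continuous.
have mpow p : measurable_fun uball (fun x => u x `^ p).
  exact: (measurableT_comp (measurable_powR p) mU).
rewrite (@ae_eq_integral_bint _ (fun=> c `^ (m - 1)))//; first last.
- have w0 := wgrad_ae_const mU uc.
  apply: filterS2 w0 uc => y h1 h2 By; rewrite h1// h2// /dot.
  by rewrite big1 ?mulr0 ?add0r ?mulr1// => i _; rewrite mxE mul0r.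
- apply: measurable_funD.
    apply: measurable_funM.
      exact: (measurableT_comp (measurable_powR _) (measurable_enorm_wgrad su)).
    apply: measurable_dot => i; apply: weak_grad_measurable;
      by [exact: sobolev_wgrad su|exact: sobolev_wgrad s1].
  by apply: measurable_funM; [exact: mpow|exact: measurable_cst].
rewrite (@ae_eq_integral_bint _ (fun=> c `^ (q - 1)))//; first last.
- by apply: filterS uc => y h By; rewrite h// mulr1.
- by apply: measurable_funM; [exact: mpow|exact: measurable_cst].
move=> -[]; rewrite !bint_cst => /(mulIf (lt0r_neq0 (@vol_gt0 R N))) e.
have {}e : (m - 1) * ln c = (q - 1) * ln c by rewrite -!ln_powR e.
have : (q - m) * ln c = 0 by move: e; set l := ln c; lra.
move/eqP; rewrite mulf_eq0 subr_eq0 (gt_eqF mq)/= => /eqP l0.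
by rewrite -[c]lnK// l0 expR0.
Qed.

Lemma energy_const1 m q ell u : 1 < m -> m < q -> 1 < ell -> sobolev m u ->
  ae_const u 1 -> energy m q ell u = ((m^-1 - q^-1) * @vol R N)%:E.
Proof.
move=> m1 mq l1 su uc; have m0 : 0 < m by exact: lt_trans m1.
have q1 : 1 < q by exact: lt_trans mq.
have mU : measurable_fun uball u by case: su.
have s2 := s0_ge2 m0 mq.
rewrite /energy (@ae_eq_integral_bint _ (fun=> m^-1 - q^-1)) ?bint_cst//.
- apply: measurable_funB; last exact: (measurableT_comp (measurable_Fq m0 mq l1 q1) mU).
  apply: measurable_funD; apply: measurable_funM => //.
    exact: (measurableT_comp (measurable_powR _) (measurable_enorm_wgrad su)).
  by apply: (measurableT_comp (measurable_powR _)); exact: measurableT_comp mU.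
- by apply: continuous_bintegrable; exact: cst_continuous.
- apply: filterS2 (wgrad_ae_const mU uc) uc => y h1 h2 By; rewrite h1// h2//.
  rewrite Fq_small ?powR1 ?normr1 ?powR1//; last by rewrite (le_trans _ s2)// ler1n.
  rewrite /enorm /dot big1 ?sqrtr0; last by move=> i _; rewrite mxE mul0r.
  by rewrite powR0 ?gt_eqF// !mul1r mul0r add0r.
Qed.

End energies.

(** Since the values stay in the range where [f_q] is the pure power, the Nehari
constraint for [v = tau z] is [tau ^ m A_m = tau ^ q B_q]. *)
Section nehari_competitor.
Context {R : realType} {N : nat}.
Local Notation vec := 'rV[R]_N.
Local Notation mu := (lebesgue_rV R N).
Variables (V : R -> R) (m q ell t tau : R).
Hypotheses (m1 : 1 < m) (mq : m < q) (l1 : 1 < ell).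
Hypotheses (CV : Ck1 1 V) (mV : {homo V : s t / s <= t}).
Hypotheses (t0 : 0 < t) (tau0 : 0 < tau) (tau1 : tau < 1).
Let W (x : vec) : R := V (nsq x).
Hypothesis tW : forall x, uball x -> `|t * W x| <= 2^-1.
Let F s := tau * (1 + t * V s).
Let v (x : vec) : R := F (nsq x).

Let CF : Ck1 1 F.
Proof. by apply: CkZ; apply: CkD; [exact: Ck_cst|exact: CkZ]. Qed.

Let Cv : CkV 1 v. Proof. exact: CkV_radial CF. Qed.

Let m0 : 0 < m. Proof. exact: lt_trans m1. Qed.
Let q1 : 1 < q. Proof. exact: lt_trans mq. Qed.
Let q0 : 0 < q. Proof. exact: lt_trans q1. Qed.

Let sv : sobolev m v. Proof. exact: sobolev_C1 (ltW m0) Cv. Qed.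

Lemma enorm_grad_competitor x :
  enorm (grad v x) = tau * (t * enorm (grad W x)).
Proof.
have d s : is_derive s (1 : R) F (tau * (t * 'D_1 V s)).
  have d1 := @is_deriveZ _ _ _ _ t _ _ _ (Ck1_derive s CV).
  have d2 := @is_deriveD _ _ _ _ _ _ _ _ _ (is_derive_cst (1 : R) s (1 : R)) d1.
  have := @is_deriveZ _ _ _ _ tau _ _ _ d2.
  by rewrite add0r.
have dF s : 'D_1 F s = tau * (t * 'D_1 V s) by have [_ ->] := d s.
apply/eqP; rewrite -(@eqrXn2 _ 2)// ?enorm_ge0 ?mulr_ge0 ?enorm_ge0 ?ltW//.
rewrite !exprMn !enorm_sqr /v /W !nsq_grad_radial// dF !exprMn.
by apply/eqP; ring.
Qed.

Lemma competitor_bounds x : uball x -> 2^-1 * tau <= v x /\ v x <= 2.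
Proof.
move=> /tW; rewrite /v /F /W ler_norml => /andP[h1 h2]; split.
  by rewrite mulrC ler_wpM2l ?(ltW tau0)//; lra.
have z0 : 0 <= 1 + t * V (nsq x) by lra.
by apply: (@le_trans _ _ (1 + t * V (nsq x))); [rewrite ler_piMl// ltW|lra].
Qed.

Let v_s0 x : uball x -> v x <= s0 m q.
Proof. by move=> /competitor_bounds[_ h]; apply: le_trans h (s0_ge2 m0 mq). Qed.

Let v_gt0 x : uball x -> 0 < v x.
Proof. by move=> /competitor_bounds[h _]; apply: lt_le_trans h; rewrite mulr_gt0// invr_gt0. Qed.

Let Am := bint (fun x => (t * enorm (grad W x)) `^ m + (1 + t * W x) `^ m).
Let Bq := bint (fun x => (1 + t * W x) `^ q).

Hypothesis tau_eq : tau `^ m * Am = tau `^ q * Bq.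

Let z_ge0 x : uball x -> 0 <= 1 + t * W x.
Proof. by move=> /tW; rewrite ler_norml => /andP[h _]; lra. Qed.

Let cz : continuous (fun x => 1 + t * W x).
Proof. exact: continuous_perturb. Qed.

Lemma bintegrable_energy_grad :
  bintegrable (fun x => (t * enorm (grad W x)) `^ m).
Proof.
apply: integrable_powR_ball; first exact: ltW.
  apply: continuous_mul; first exact: cst_continuous.
  by apply: continuous_enorm_grad; exact: CkV_radial.
by move=> x _; rewrite mulr_ge0 ?enorm_ge0// ltW.
Qed.

Lemma bintegrable_perturb_powR p : 0 <= p -> bintegrable (fun x => (1 + t * W x) `^ p).
Proof. by move=> p0; exact: integrable_powR_ball. Qed.

Let iA : bintegrable (fun x => (t * enorm (grad W x)) `^ m + (1 + t * W x) `^ m).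
Proof.
apply: bintegrableD; first exact: bintegrable_energy_grad.
by apply: bintegrable_perturb_powR; exact: ltW.
Qed.

Let powv p x : uball x -> v x `^ p = tau `^ p * (1 + t * W x) `^ p.
Proof. by move=> Bx; rewrite /v /F powRM// ?z_ge0// ltW. Qed.

Let powg x : enorm (grad v x) `^ m = tau `^ m * (t * enorm (grad W x)) `^ m.
Proof. by rewrite enorm_grad_competitor powRM ?mulr_ge0 ?enorm_ge0 ?ltW. Qed.

Lemma nehari_competitor : nehari m q ell v.
Proof.
have mv : measurable_fun uball v by case: sv.
split.
- split => //.
  + by move=> x y _ _ e; rewrite /v -!enorm_sqr e.
  + by move=> x /v_gt0/ltW.
  + move=> x y _ xy _; rewrite /v /F ler_wpM2l ?(ltW tau0)// lerD2l ler_wpM2l ?(ltW t0)//.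
    by apply: mV; rewrite -!enorm_sqr ler_sqr ?nnegrE ?enorm_ge0.
- move=> /ae_ball_exists[x Bx vx]; have := v_gt0 Bx; by rewrite vx ltxx.
- rewrite (@ae_eq_integral_bint _ _ _ (fun x =>
    tau `^ m * ((t * enorm (grad W x)) `^ m + (1 + t * W x) `^ m))); first last.
  + apply: filterS (wgrad_C1 Cv) => x h Bx.
    by rewrite h// powg ger0_norm ?powv ?mulrDr// ltW// v_gt0.
  + exact: bintegrableZ.
  + apply: measurable_funD.
      exact: (measurableT_comp (measurable_powR _) (measurable_enorm_wgrad sv)).
    by apply: (measurableT_comp (measurable_powR _)); exact: measurableT_comp mv.
  have iq : bintegrable (fun x => tau `^ q * (1 + t * W x) `^ q).
    by apply: bintegrableZ; apply: bintegrable_perturb_powR; exact: ltW.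
  rewrite bintZ// -/Am tau_eq /Bq -bintZ -?bintE//; last first.
    by apply: bintegrable_perturb_powR; exact: ltW.
  apply: eq_integral => x /set_mem Bx; rewrite fq_small ?v_s0// -powv//.
  rewrite -[X in _ * X]powRr1 ?(ltW (v_gt0 Bx))// -powRD ?subrK//.
  by rewrite (gt_eqF (v_gt0 Bx)) implybT.
Qed.

(** On the Nehari set the energy of a function with values below [s0] is
[1/m - 1/q] times the integral of its power [q]. *)
Lemma energy_competitor :
  energy m q ell v = ((m^-1 - q^-1) * (tau `^ q * Bq))%:E.
Proof.
have mv : measurable_fun uball v by case: sv.
have iq : bintegrable (fun x => (1 + t * W x) `^ q).
  by apply: bintegrable_perturb_powR; exact: ltW.
rewrite /energy (@ae_eq_integral_bint _ _ _ (fun x =>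
  tau `^ m / m * ((t * enorm (grad W x)) `^ m + (1 + t * W x) `^ m) -
  tau `^ q / q * (1 + t * W x) `^ q)); first last.
- apply: filterS (wgrad_C1 Cv) => x h Bx.
  rewrite h// powg ger0_norm ?powv//; last by rewrite ltW// v_gt0.
  rewrite Fq_small ?v_s0 ?powv//; last by rewrite ltW// v_gt0.
  by ring.
- by apply: bintegrableB; exact: bintegrableZ.
- apply: measurable_funB; last exact: (measurableT_comp (measurable_Fq m0 mq l1 q1) mv).
  apply: measurable_funD; apply: measurable_funM => //.
    exact: (measurableT_comp (measurable_powR _) (measurable_enorm_wgrad sv)).
  by apply: (measurableT_comp (measurable_powR _)); exact: measurableT_comp mv.
rewrite bintB ?bintZ//; [|exact: bintegrableZ|exact: bintegrableZ].
rewrite -/Am -/Bq; congr EFin.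
by rewrite mulrAC tau_eq; ring.
Qed.

End nehari_competitor.

(** * Ground states for m below 2 are nonconstant *)

Theorem corollary1p4 (R : realType) (N : nat) (HN : (1 <= N)%N) (q lam : R)
    (Hlam : @is_lambda2_rad R N lam) (Hq : 2 + lam < q) :
  exists delta : R, 0 < delta < 1 /\
    forall m : R, 2 - delta < m < 2 ->
    forall ell : R, m < ell -> (ell%:E < critical_exponent N m)%E ->
    forall u : 'rV[R]_N -> R, ground_state m q ell u ->
      ~ exists c : R, ae_const u c.
Proof.
have [lam0 elam _] := Hlam.
have q2 : 2 < q by lra.
have lq : lam < q - 2 by lra.
have [V [CV mV V0 DV]] := radial_competitor HN lam0 lq elam.
have [t [t0 tV gap]] := static_gap q2 CV V0 DV.
pose W (x : 'rV[R]_N) := V (nsq x).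
(* A1 and A2 are the analogues of A_m for the exponents 1 and 2 *)
pose A1 := bint (fun x => t * enorm (grad W x) + (1 + t * W x)).
have e2 := bint_energy2 CV t V0.
set A2 := _ + _ in gap e2; set Bq := bint _ in gap.
have v0 := @vol_gt0 R N.
have z_ge x : uball x -> 2^-1 <= 1 + t * W x.
  by move=> /tV; rewrite ler_norml => /andP[h _]; rewrite /W; lra.
have z_ge0 x : uball x -> 0 <= 1 + t * W x.
  by move=> /z_ge; apply: le_trans; rewrite invr_ge0.
have iz p : 0 <= p -> bintegrable (fun x => (1 + t * W x) `^ p).
  by move=> p0; exact: bintegrable_perturb_powR.
have cg : continuous (fun x => t * enorm (grad W x)).
  apply: continuous_mul; first exact: cst_continuous.
  by apply: continuous_enorm_grad; exact: CkV_radial.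
have cz : continuous (fun x => 1 + t * W x) by exact: continuous_perturb.
have g_ge0 x : 0 <= t * enorm (grad W x) by rewrite mulr_ge0 ?enorm_ge0 ?ltW.
have ig p : 0 <= p -> bintegrable (fun x => (t * enorm (grad W x)) `^ p).
  by move=> p0; exact: integrable_powR_ball.
have pow_bint_gt0 p : 0 <= p -> 0 < bint (fun x => (1 + t * W x) `^ p).
  move=> p0; apply: (@lt_le_trans _ _ (2^-1 `^ p * @vol R N)).
    by rewrite mulr_gt0// powR_gt0// invr_gt0.
  rewrite -bint_cst; apply: le_bint.
  - by apply: continuous_bintegrable; exact: cst_continuous.
  - exact: iz.
  - by move=> x Bx; rewrite ge0_ler_powR ?nnegrE ?invr_ge0 ?z_ge0 ?z_ge.
have B0 : 0 < Bq by apply: pow_bint_gt0; lra.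
have vA : @vol R N <= A2.
  rewrite /A2 lerDl mulr_ge0 ?sqr_ge0// addr_ge0//; apply: bint_ge0 => x _.
    exact: sqr_ge0.
  exact: nsq_ge0.
have [d /andP[d0 d1] hd] := exponent_perturbation A1 q2 v0 vA B0 gap.
exists d; split; first exact/andP.
move=> m /andP[dm m2] ell ml _ u [csol _ uE] [c uc].
have m1 : 1 < m by lra.
have mq : m < q by lra.
have l1 : 1 < ell by lra.
have m0 : 0 <= m by lra.
pose Am := bint (fun x => (t * enorm (grad W x)) `^ m + (1 + t * W x) `^ m).
have Am0 : 0 < Am.
  rewrite /Am bintD; [|exact: ig|exact: iz].
  by rewrite ltr_wpDl ?pow_bint_gt0//; apply: bint_ge0 => x _; exact: powR_ge0.
have AmA : Am <= (2 - m) * A1 + (m - 1) * A2.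
  have i1 : bintegrable (fun x => t * enorm (grad W x) + (1 + t * W x)).
    by apply: continuous_bintegrable; exact: continuous_add.
  have i2 : bintegrable (fun x => (t * enorm (grad W x)) ^+ 2 + (1 + t * W x) ^+ 2).
    by apply: continuous_bintegrable; apply: continuous_add; exact: continuous_mul.
  rewrite -e2 -!bintZ// -bintD; [|exact: bintegrableZ|exact: bintegrableZ].
  apply: le_bint.
  - by apply: bintegrableD; [exact: ig|exact: iz].
  - by apply: bintegrableD; exact: bintegrableZ.
  - move=> x Bx.
    have := lerD (powR_young (g_ge0 x) m1 m2) (powR_young (z_ge0 x Bx) m1 m2).
    by rewrite addrACA -!mulrDr.
have [tau [tau0 tau1 tau_eq tau_lt]] := hd m Am dm m2 Am0 AmA.
have nv := nehari_competitor ell m1 mq CV mV t0 tau0 tau1 tV tau_eq.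
have ev := energy_competitor m1 mq l1 CV t0 tau0 tau1 tV tau_eq.
have c1 := constant_cone_solution m1 mq csol uc.
have su : sobolev m u by case: csol => -[].
rewrite c1 in uc.
have eu := energy_const1 m1 mq l1 su uc.
pose v (x : 'rV[R]_N) := tau * (1 + t * V (nsq x)).
have : (energy m q ell u <= energy m q ell v)%E.
  by rewrite uE; apply: ereal_inf_lbound; exists v.
rewrite eu ev lee_fin leNgt ltr_pM2l ?tau_lt//.
by rewrite subr_gt0 ltf_pV2 ?posrE//; lra.
Qed.
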